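(* Let $Y\to X$ be a smooth fiber bundle, $\dim X=n$, and let $E\to Y$, $Q\to Y$ be vector bundles with density-duals $\overline E^*$, $\overline Q^*$. (1) Any linear $Q$-valued differential operator $\upsilon=\sum_{0\le|\Lambda|\le m}\upsilon^{a,\Lambda}_r\,\xi^r_\Lambda\,q_a$ on $E\to Y\to X$ yields the (globally defined) linear $\overline E^*$-valued differential operator on $\overline Q^*\to Y\to X$ $$\eta(\upsilon)=\sum_{0\le|\Sigma|\le m}(-1)^{|\Sigma|}d_\Sigma(\upsilon^{a,\Sigma}_r\,\overline q_a)\,\xi^r\omega=\sum_{0\le|\Lambda|\le m}\eta(\upsilon)^{a,\Lambda}_r\,\overline q_{\Lambda a}\,\xi^r\omega,$$ $$\eta(\upsilon)^{a,\Lambda}_r=\sum_{0\le|\Sigma|\le m-|\Lambda|}(-1)^{|\Sigma+\Lambda|}C^{|\Sigma|}_{|\Sigma+\Lambda|}\,d_\Sigma(\upsilon^{a,\Sigma+\Lambda}_r).$$ (2) Conversely, any linear $\overline E^*$-valued differential operator $\Delta=\sum_{0\le|\Lambda|\le m}\Delta^{a,\Lambda}_r\,\overline q_{\Lambda a}\,\xi^r\omega$ on $\overline Q^*\to Y\to X$ defines the (globally defined) linear $Q$-valued differential operator on $E\to Y\to X$ $$\eta(\Delta)=\sum_{0\le|\Sigma|\le m}(-1)^{|\Sigma|}d_\Sigma(\Delta^{a,\Sigma}_r\,\xi^r)\,q_a=\sum_{0\le|\Lambda|\le m}\eta(\Delta)^{a,\Lambda}_r\,\xi^r_\Lambda\,q_a,$$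 $$\eta(\Delta)^{a,\Lambda}_r=\sum_{0\le|\Sigma|\le m-|\Lambda|}(-1)^{|\Sigma+\Lambda|}C^{|\Sigma|}_{|\Sigma+\Lambda|}\,d_\Sigma(\Delta^{a,\Sigma+\Lambda}_r).$$ (3) For all such $\upsilon$ and $\Delta$, $\ \eta(\eta(\upsilon))=\upsilon$ and $\eta(\eta(\Delta))=\Delta$.
   Context: $Y\to X$ has bundle coordinates $(x^\lambda,y^i)$; $J^kY$ are its jet manifolds with jet coordinates $y^i_\Lambda$, $\Lambda=(\lambda_k\ldots\lambda_1)$ a symmetric multi-index of length $|\Lambda|=k$; $\Sigma+\Lambda$ is concatenation. $\omega=dx^1\wedge\cdots\wedge dx^n$. Total derivatives are $d_\lambda=\partial_\lambda+\sum_{0\le|\Lambda|}y^i_{\lambda+\Lambda}\partial^\Lambda_i$ (sum over distinct jet coordinates; similarly including all other fiber coordinates on jets of bundles over $Y$, e.g. $d_\lambda\xi^r_\Lambda=\xi^r_{\lambda+\Lambda}$), and $d_\Lambda=d_{\lambda_k}\circ\cdots\circ d_{\lambda_1}$. $E\to Y$ and $Q\to Y$ have fiber coordinates $\xi^r$ and $q^a$. The density-dual of $E$ is $\overline E^*=E^*\otimes_Y\bigwedge^nT^*X$, and likewise $\overline Q^*=Q^*\otimes_Y\bigwedge^nT^*X$. Fiber coordinates are $\xi_r$, $q_a$ on the duals $E^*$, $Q^*$, and $\overline\xi_r$, $\overline q_a$ on $\overline E^*$, $\overline Q^*$. A linear differential operator on $W\to Y\to X$ with values in $Z$ (for vector bundles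 $W,Z\to Y$) is a bundle morphism $J^kW\to Z$ over $Y$, for some $k$, linear on the fibers of $J^kW\to J^kY$. Its coefficients are local functions on a finite order jet manifold of $Y$ (any finite order), and $m$ bounds the length of the multi-indices $\Lambda$ in $w_\Lambda$. A $Q$-valued operator on $E$ with components $\upsilon^a=\sum_\Lambda\upsilon^{a,\Lambda}_r\xi^r_\Lambda$ is represented by the function $\upsilon^aq_a$. An $\overline E^*$-valued operator on $\overline Q^*$ with components $\Delta_r=\sum_\Lambda\Delta^{a,\Lambda}_r\overline q_{\Lambda a}$ is represented by the density $\Delta_r\xi^r\omega$. Convention: the coefficients $\upsilon^{a,\Lambda}_r$, $\Delta^{a,\Lambda}_r$ are symmetric in the indices of $\Lambda$, and sums over $\Lambda$, $\Sigma$ in these operators run over all ordered tuples of indices. $C^a_b=\frac{b!}{a!(b-a)!}$. ''Globally defined'' means that the local coordinate expressions agree under changes of bundle coordinates. *)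

(* Defs.v *)
From HB Require Import structures.
From mathcomp Require Import all_boot all_order all_algebra.
From mathcomp Require Import all_classical all_reals all_analysis.
Set Implicit Arguments.
Unset Strict Implicit.
Unset Printing Implicit Defensive.
Import Order.TTheory GRing.Theory Num.Theory.
Import numFieldNormedType.Exports.
Local Open Scope classical_set_scope.
Local Open Scope ring_scope.

(* C^oo on D, meant for an open subset D of a finite-dimensional space: all
   iterated directional derivatives are (Frechet) differentiable on D. *)
Definition smooth_on (R : realType) (V W : normedModType R) (D : set V)
    (f : V -> W) : Prop :=
  forall (vs : seq V) (x : V), D x ->
    differentiable (foldr (fun v g => 'D_v g) f vs) x.

(* cmap and cinv are total functions; only their values on cdom and on
   cmap @` cdom respectively are meaningful. *)
Record chart (R : realType) (V : normedModType R) (M : topologicalType) := Chart {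
  cdom : set M;
  cmap : M -> V;
  cinv : V -> M;
  cdom_open : open cdom;
  cimg_open : open (cmap @` cdom);
  cmapK : forall p, cdom p -> cinv (cmap p) = p;
  cmap_cont : forall p, cdom p -> {for p, continuous cmap};
  cinv_cont : forall v, (cmap @` cdom) v -> {for v, continuous cinv} }.

Definition smooth_transition (R : realType) (V : normedModType R)
    (M : topologicalType) (c c' : chart V M) : Prop :=
  smooth_on (cmap c @` (cdom c `&` cdom c')) (cmap c' \o cinv c).

Record manifold (R : realType) (V : normedModType R) := Manifold {
  mcar :> topologicalType;
  m_hausdorff : hausdorff_space mcar;
  m_second_countable : @second_countable mcar;
  m_atlas : set (chart V mcar);
  m_cover : forall p, exists2 c, m_atlas c & cdom c p;
  m_compat : forall c c', m_atlas c -> m_atlas c' -> smooth_transition c c' }.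

Definition adm_chart (R : realType) (V : normedModType R) (M : manifold V)
    (c : chart V M) : Prop :=
  forall c', m_atlas c' -> smooth_transition c c' /\ smooth_transition c' c.

(* Over U, the map (fb_proj, Phi) is a diffeomorphism onto U x (typical fiber):
   it is bijective and the product charts it pulls back are charts of the
   smooth structure of the total space. *)
Record fiber_bundle (R : realType) (n p : nat) := FiberBundle {
  fb_base : @manifold R 'rV[R]_n;
  fb_tot : @manifold R ('rV[R]_n * 'rV[R]_p)%type;
  fb_fiber : @manifold R 'rV[R]_p;
  fb_proj : fb_tot -> fb_base;
  fb_surj : forall x, exists y, fb_proj y = x;
  fb_triv : forall x0, exists (U : set fb_base) (Phi : fb_tot -> fb_fiber),
    [/\ open U, U x0,
        forall x f, U x -> exists! y, fb_proj y = x /\ Phi y = f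
      & forall (cX : chart 'rV[R]_n fb_base) (cF : chart 'rV[R]_p fb_fiber),
          adm_chart cX -> adm_chart cF ->
          exists c : chart ('rV[R]_n * 'rV[R]_p)%type fb_tot,
          [/\ adm_chart c,
              cdom c = fb_proj @^-1` (U `&` cdom cX) `&` Phi @^-1` cdom cF
            & forall y, cdom c y ->
                cmap c y = (cmap cX (fb_proj y), cmap cF (Phi y))]] }.

(* The vector bundle is presented by its fibers and an atlas of fiberwise linear
   trivializations with smooth transition matrices. *)
Record triv (R : realType) (V : normedModType R) (M : manifold V) (r : nat)
    (F : M -> lmodType R) := Triv {
  tdom : set M;
  tmap : forall y : M, {linear F y -> 'rV[R]_r};
  tinv : forall y : M, 'rV[R]_r -> F y;
  tdom_open : open tdom;
  tmapK : forall y, tdom y -> cancel (@tmap y) (@tinv y);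
  tinvK : forall y, tdom y -> cancel (@tinv y) (@tmap y) }.

Definition smooth_triv_transition (R : realType) (V : normedModType R)
    (M : manifold V) (r : nat) (F : M -> lmodType R) (t t' : triv r F) : Prop :=
  exists G : M -> 'M[R]_r,
    (forall y, tdom t y -> tdom t' y ->
       forall e : F y, tmap t' y e = tmap t y e *m G y)
    /\ (forall c, @m_atlas R V M c ->
         smooth_on (cmap c @` (cdom c `&` (tdom t `&` tdom t'))) (G \o cinv c)).

Record vbundle (R : realType) (V : normedModType R) (M : manifold V) (r : nat)
  := VBundle {
  vfib : M -> lmodType R;
  v_atlas : set (triv r vfib);
  v_cover : forall y, exists2 t, v_atlas t & tdom t y;
  v_compat : forall t t', v_atlas t -> v_atlas t' -> smooth_triv_transition t t' }.

Definition adm_triv (R : realType) (V : normedModType R) (M : manifold V)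
    (r : nat) (E : vbundle M r) (t : triv r (vfib E)) : Prop :=
  forall t', v_atlas t' ->
    smooth_triv_transition t t' /\ smooth_triv_transition t' t.

(* The fiber at y of the density-dual of E, the tensor product of E^* with the
   top exterior power of T^*X.  An element is represented by its components in
   the charts b of X around x = pi(y): it is dd_comp b (x) dx_b^1 /\ ... /\ dx_b^n
   with dd_comp b in the dual of E_y, for every such b.  Since
   dx_b'^1 /\ ... /\ dx_b'^n = det (dx_b'/dx_b) dx_b^1 /\ ... /\ dx_b^n, the
   components are related by dd_law. *)
Record density_dual (R : realType) (n p r : nat) (B : fiber_bundle R n p)
    (E : vbundle (fb_tot B) r) (y : fb_tot B) := DensityDual {
  dd_comp : chart 'rV[R]_n (fb_base B) -> {linear vfib E y -> R^o};
  dd_law : forall b b', adm_chart b -> adm_chart b' ->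
    cdom b (fb_proj y) -> cdom b' (fb_proj y) -> forall e,
    dd_comp b e =
      \det ('J (cmap b' \o cinv b) (cmap b (fb_proj y))) * dd_comp b' e }.

(* Bundle coordinates (x^lambda, y^i) of Y -> X with linear fiber coordinates
   xi^r and q^a of E and Q. *)
Record csys (R : realType) (n p e q : nat) (B : fiber_bundle R n p)
    (E : vbundle (fb_tot B) e) (Q : vbundle (fb_tot B) q) := CSys {
  cs_x : chart 'rV[R]_n (fb_base B);
  cs_xy : chart ('rV[R]_n * 'rV[R]_p)%type (fb_tot B);
  cs_E : triv e (vfib E);
  cs_Q : triv q (vfib Q);
  cs_x_adm : adm_chart cs_x;
  cs_xy_adm : adm_chart cs_xy;
  cs_fibered : forall y, cdom cs_xy y ->
    cdom cs_x (fb_proj y) /\ (cmap cs_xy y).1 = cmap cs_x (fb_proj y);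
  cs_E_adm : adm_triv cs_E;
  cs_Q_adm : adm_triv cs_Q }.

Section Coordinates.
Variables (R : realType) (n p e q : nat) (B : fiber_bundle R n p).
Variables (E : vbundle (fb_tot B) e) (Q : vbundle (fb_tot B) q).
Let C := csys E Q.

Definition csdom (c : C) : set (fb_tot B) :=
  cdom (cs_xy c) `&` (tdom (cs_E c) `&` tdom (cs_Q c)).

Definition csimg (c : C) : set ('rV[R]_n * 'rV[R]_p)%type :=
  cmap (cs_xy c) @` csdom c.

(* A family of fibers over Y together with its fiber coordinates in every
   coordinate system c (meaningful over csdom c). *)
Record fcoord (w : nat) := FCoord {
  fc_fib : fb_tot B -> Type;
  fc_map : C -> forall y, fc_fib y -> 'rV[R]_w }.

Definition fcE : fcoord e :=
  {| fc_fib := fun y => vfib E y; fc_map := fun c y u => tmap (cs_E c) y u |}.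

Definition fcQ : fcoord q :=
  {| fc_fib := fun y => vfib Q y; fc_map := fun c y u => tmap (cs_Q c) y u |}.

(* The coordinates \bar xi_r and \bar q_a: values of the component in the chart
   cs_x c on the coordinate frame. *)
Definition fcEd : fcoord e :=
  {| fc_fib := fun y => density_dual E y;
     fc_map := fun c y u =>
       \row_r dd_comp u (cs_x c) (tinv (cs_E c) y (delta_mx 0 r)) |}.

Definition fcQd : fcoord q :=
  {| fc_fib := fun y => density_dual Q y;
     fc_map := fun c y u =>
       \row_a dd_comp u (cs_x c) (tinv (cs_Q c) y (delta_mx 0 a)) |}.

(* A local section of W -> Y -> X around x0 is a section s of Y -> X with a section
   sw of W along s.  Here s and sw are total functions, constrained only on a
   neighborhood of x0. *)
Definition yrep (c : C) (s : fb_base B -> fb_tot B) (x : 'rV[R]_n) : 'rV[R]_p :=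
  (cmap (cs_xy c) (s (cinv (cs_x c) x))).2.

Definition wrep (w : nat) (W : fcoord w) (c : C) (s : fb_base B -> fb_tot B)
    (sw : forall x, fc_fib W (s x)) (x : 'rV[R]_n) : 'rV[R]_w :=
  fc_map c (sw (cinv (cs_x c) x)).

Definition local_section (w : nat) (W : fcoord w) (s : fb_base B -> fb_tot B)
    (sw : forall x, fc_fib W (s x)) (x0 : fb_base B) : Prop :=
  exists U : set (fb_base B),
  [/\ open U, U x0,
      forall x, U x -> fb_proj (s x) = x /\ {for x, continuous s}
    & forall c : C, let D := cmap (cs_x c) @` (U `&` s @^-1` csdom c) in
        smooth_on D (yrep c s) /\ smooth_on D (wrep c sw)].

End Coordinates.

(* Symmetric multi-indices by multiplicities; ordered tuples of indices are
   elements of seq 'I_n. *)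
Definition mindex (n : nat) := {ffun 'I_n -> nat}.

Definition mindex_of (n : nat) (s : seq 'I_n) : mindex n :=
  [ffun i => count_mem i s].

Definition mindex_seq (n : nat) (al : mindex n) : seq 'I_n :=
  flatten [seq nseq (al i) i | i <- enum 'I_n].

Definition mindex_incr (n : nat) (l : 'I_n) (al : mindex n) : mindex n :=
  [ffun i => ((i == l) + al i)%N].

(* A point of the infinite jet space in coordinates: (x^lambda) and the
   u^k_Lambda for fiber coordinates u^k, k in K.  The fiber coordinates are
   indexed by 'I_p for Y and by 'I_p + 'I_w for W -> Y -> X. *)
Definition jet (R : realType) (n : nat) (K : finType) : Type :=
  ('rV[R]_n * (K -> mindex n -> R))%type.

Definition kindex (n k : nat) : finType :=
  {al : {ffun 'I_n -> 'I_k.+1} | (\sum_i al i <= k)%N}.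

Definition jet_trunc (R : realType) (n p : nat) (k : nat) (z : jet R n 'I_p) :
    'rV[R]_n * 'M[R]_(p, #|kindex n k|) :=
  (z.1, \matrix_(i, j) z.2 i [ffun l => val (val (enum_val j : kindex n k) l)]).

(* The points of the jet space over a coordinate domain D of Y. *)
Definition jet_over (R : realType) (n p : nat) (D : set ('rV[R]_n * 'rV[R]_p)%type) :
    set (jet R n 'I_p) :=
  [set z | D (z.1, \row_i z.2 i [ffun=> 0%N])].

(* f is (the pullback of) a smooth function on the part of J^k Y over D. *)
Definition jet_smooth (R : realType) (n p : nat) (k : nat)
    (D : set ('rV[R]_n * 'rV[R]_p)%type) (f : jet R n 'I_p -> R) : Prop :=
  exists2 g : 'rV[R]_n * 'M[R]_(p, #|kindex n k|) -> R^o,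
    smooth_on (@jet_trunc R n p k @` jet_over D) g
    & forall z, jet_over D z -> f z = g (jet_trunc k z).

Section TotalDerivative.
Variables (R : realType) (n : nat) (K : finType).
Implicit Types (f : jet R n K -> R) (z : jet R n K).

Definition dbase (l : 'I_n) f z : R :=
  'D_(delta_mx 0 l : 'rV[R]_n) (fun x => f (x, z.2) : R^o) z.1.

Definition djet (i : K) (al : mindex n) f z : R :=
  derive1 (fun t : R => f (z.1, fun j be =>
    if (j == i) && (be == al) then t else z.2 j be) : R^o) (z.2 i al).

(* The inner sum has finite support when f depends on finitely many jet
   coordinates. *)
Definition dtot (l : 'I_n) f z : R :=
  dbase l f z
  + \sum_(i : K) \sum_(al \in [set: mindex n])
      z.2 i (mindex_incr l al) * djet i al f z.

Definition dtots (s : seq 'I_n) f : jet R n K -> R := foldr dtot f s.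

End TotalDerivative.

Definition pders (R : realType) (n : nat) (s : seq 'I_n) (f : 'rV[R]_n -> R) :
    'rV[R]_n -> R^o :=
  foldr (fun l (g : 'rV[R]_n -> R^o) => 'D_(delta_mx 0 l : 'rV[R]_n) g) f s.

Definition section_jet (R : realType) (n p w : nat) (fy : 'rV[R]_n -> 'rV[R]_p)
    (fw : 'rV[R]_n -> 'rV[R]_w) (x : 'rV[R]_n) : jet R n ('I_p + 'I_w)%type :=
  (x, fun k al => match k with
      | inl i => pders (mindex_seq al) (fun x' => fy x' 0 i) x
      | inr r => pders (mindex_seq al) (fun x' => fw x' 0 r) x
      end).

Definition yjet (R : realType) (n p w : nat) (z : jet R n ('I_p + 'I_w)%type) :
    jet R n 'I_p :=
  (z.1, fun i al => z.2 (inl i) al).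

(* Coefficients u Lambda a r of an operator of order <= m from a bundle with
   w fiber coordinates (index r) to one with v fiber coordinates (index a), in
   one coordinate system.  Only the values with size Lambda <= m matter. *)
Definition lcoef (R : realType) (n p w v : nat) : Type :=
  seq 'I_n -> 'I_v -> 'I_w -> jet R n 'I_p -> R.

(* The a-th component \sum_Lambda u^{a,Lambda}_r w^r_Lambda. *)
Definition op_fun (R : realType) (n p w v m : nat) (u : lcoef R n p w v)
    (a : 'I_v) (z : jet R n ('I_p + 'I_w)%type) : R :=
  \sum_(k < m.+1) \sum_(L : k.-tuple 'I_n) \sum_(r < w)
    u L a r (yjet z) * z.2 (inr r) (mindex_of L).

(* \sum_Sigma (-1)^|Sigma| d_Sigma (u^{a,Sigma}_r \bar w_a), for r fixed. *)
Definition adj_fun (R : realType) (n p w v m : nat) (u : lcoef R n p w v)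
    (r : 'I_w) : jet R n ('I_p + 'I_v)%type -> R :=
  fun z => \sum_(k < m.+1) \sum_(S : k.-tuple 'I_n)
    (-1) ^+ k * dtots S (fun z' : jet R n ('I_p + 'I_v)%type =>
       \sum_(a < v) u S a r (yjet z') * z'.2 (inr a) [ffun=> 0%N]) z.

(* eta(u)^{a,Lambda}_r; output and input indices are exchanged. *)
Definition eta (R : realType) (n p w v m : nat) (u : lcoef R n p w v) :
    lcoef R n p v w :=
  fun L r a z => \sum_(k < (m - size L).+1) \sum_(S : k.-tuple 'I_n)
    (-1) ^+ (k + size L) * 'C(k + size L, k)%:R * dtots S (u (S ++ L) a r) z.

Section Operators.
Variables (R : realType) (n p e q : nat) (B : fiber_bundle R n p).
Variables (E : vbundle (fb_tot B) e) (Q : vbundle (fb_tot B) q).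

(* A linear Z-valued differential operator of order <= m in w_Lambda on
   W -> Y -> X, given by its coefficients in all systems of bundle coordinates:
   they are symmetric, they are smooth functions on some J^k Y, and the local
   expressions agree, i.e. at the jet at x0 of every local section of
   W -> Y -> X they are the coordinates of one and the same element of the
   fiber of Z. *)
Definition linear_diff_op (w v m : nat) (W : fcoord E Q w) (Z : fcoord E Q v)
    (u : csys E Q -> lcoef R n p w v) : Prop :=
  [/\ forall c (L L' : seq 'I_n) a r z, (size L <= m)%N -> perm_eq L L' ->
        jet_over (csimg c) z -> u c L a r z = u c L' a r z,
      exists k, forall c (L : seq 'I_n) a r, (size L <= m)%N ->
        jet_smooth k (csimg c) (u c L a r)
    & forall (s : fb_base B -> fb_tot B) (sw : forall x, fc_fib W (s x)) x0,
        local_section sw x0 ->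
        exists zeta : fc_fib Z (s x0), forall c, csdom c (s x0) ->
          fc_map c zeta =
            \row_a op_fun m (u c) a
                     (section_jet (yrep c s) (wrep c sw) (cmap (cs_x c) x0))].

End Operators.

(* Main.v *)
(* Along the jet prolongation of a section of Y -> X, total derivatives become
   partial derivatives, and every jet of finite order is the jet of a polynomial
   section.  Hence all identities reduce to identities between linear differential
   operators over the ring of smooth functions on an open set of R^n.  There eta is
   the formal adjoint: the Leibniz rule gives its coefficients, and eta o eta = id
   is the binomial inversion \sum_j (-1)^j C(N, j) = 0 for N > 0.

   For the global definedness, an operator determines its formal adjoint, because
   its symmetrized coefficients are read off on monomials.  Under a change of base
   coordinates the partial derivatives become a commuting frame, whose formal
   adjoint is minus itself after multiplication by the Jacobian determinant
   (Piola's identity).  The determinant is the one in the transition law of the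
   density-duals, so the invariance of an operator passes to its adjoint. *)
From HB Require Import structures.
Require Import Defs.
From mathcomp Require Import all_boot all_order all_algebra.
From mathcomp Require Import all_classical all_reals all_analysis.
From mathcomp Require Import ring lra zify.
Set Implicit Arguments.
Unset Strict Implicit.
Unset Printing Implicit Defensive.
Import Order.TTheory GRing.Theory Num.Theory.
Import numFieldNormedType.Exports.
Local Open Scope classical_set_scope.
Local Open Scope ring_scope.

(** * Formal adjoints over a ring with commuting derivations *)

(** The formal adjoint is usually characterized by integration by parts against compactly supported
    functions. Here the characterization is algebraic: two maps are adjoint when one finite list of
    terms [a d_S] yields both. Such pairs are closed under sums, multiplications and derivations,
    and the second map is determined by the first. This matters because an operator written in a
    transformed frame, with arguments and values multiplied by transition matrices, has no
    manageable coefficients in the old coordinates; yet it is visibly a composite, and its adjoint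
    is the composite of the adjoints in reverse order.

    Functions of infinitely many jet coordinates are handled through a smooth representative on some
    [J^k Y], because the coefficients are known only over a coordinate domain and only such a
    representative can be differentiated safely.

    The relation between a bundle and its density-dual is stated symmetrically, so that one
    invariance argument serves both directions of the theorem with the roles exchanged. *)

Section TupleSums.
Variables (V : nmodType) (n : nat).
Implicit Types (F G : seq 'I_n -> V).

(** Recursion on the first index, with plain sequences in place of tuples: this matches the
    recursion of [ders] and lets a tuple be split or concatenated without casts. *)
Fixpoint tsum k F : V :=
  if k is k'.+1 then \sum_(l < n) tsum k' (fun S => F (l :: S)) else F [::].

Lemma tsumE k F : \sum_(S : k.-tuple 'I_n) F S = tsum k F.
Proof.
elim: k F => [|k IH] F /=.
  rewrite (big_pred1 [tuple]) // => t; rewrite (tuple0 t); exact/esym/eqP.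
rewrite -(eq_bigr _ (fun l _ => IH (fun S => F (l :: S)))) pair_big /=.
rewrite (reindex (fun p : 'I_n * k.-tuple 'I_n => [tuple of p.1 :: p.2])) //=.
exists (fun t : k.+1.-tuple 'I_n => (thead t, [tuple of behead t])) => [[l S]|t] _ /=.
  by congr (_, _); apply: val_inj.
by rewrite [RHS](tuple_eta t); apply: val_inj.
Qed.

Lemma eq_tsum k F G : (forall S, size S = k -> F S = G S) -> tsum k F = tsum k G.
Proof.
elim: k F G => [|k IH] F G H /=; first exact: H.
by apply: eq_bigr => l _; apply: IH => S sS; apply: H; rewrite /= sS.
Qed.

Lemma tsum0 k F : (forall S, size S = k -> F S = 0) -> tsum k F = 0.
Proof.
elim: k F => [|k IH] F H /=; first exact: H.
by rewrite big1 // => l _; apply: IH => S sS; apply: H; rewrite /= sS.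
Qed.

Lemma tsum_sum (I : Type) (r : seq I) (Q : pred I) k (F : I -> seq 'I_n -> V) :
  tsum k (fun S => \sum_(i <- r | Q i) F i S) = \sum_(i <- r | Q i) tsum k (F i).
Proof.
elim: k F => [|k IH] F //=.
by rewrite exchange_big; apply: eq_bigr => l _; rewrite IH.
Qed.

Lemma tsumD k F G : tsum k (fun S => F S + G S) = tsum k F + tsum k G.
Proof.
elim: k F G => [|k IH] F G //=.
by rewrite -big_split; apply: eq_bigr => l _; rewrite IH.
Qed.

Lemma tsum_cat i j F :
  tsum (i + j) F = tsum i (fun S => tsum j (fun T => F (S ++ T))).
Proof.
elim: i F => [|i IH] F //=.
by apply: eq_bigr => l _; rewrite IH.
Qed.

Lemma tsumC i j (F : seq 'I_n -> seq 'I_n -> V) :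
  tsum i (fun S => tsum j (F S)) = tsum j (fun T => tsum i (F^~ T)).
Proof.
rewrite -!tsumE -(eq_bigr _ (fun S _ => tsumE j (F (tval S)))) exchange_big.
by apply: eq_bigr => T _; rewrite -(tsumE i (F^~ (tval T))).
Qed.

End TupleSums.

Lemma tsum_morph (V W : nmodType) n (h : V -> W) :
  h 0 = 0 -> {morph h : x y / x + y} ->
  forall k (F : seq 'I_n -> V), h (tsum k F) = tsum k (h \o F).
Proof.
move=> h0 hD; elim=> [|k IH] F //=.
by rewrite (big_morph h hD h0); apply: eq_bigr => l _; rewrite IH.
Qed.

Lemma mulr_tsumr (A : pzRingType) n k (a : A) (F : seq 'I_n -> A) :
  a * tsum k F = tsum k (fun S => a * F S).
Proof. by rewrite (tsum_morph (mulr0 a)) // => x y; rewrite mulrDr. Qed.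

Lemma mulr_tsuml (A : pzRingType) n k (a : A) (F : seq 'I_n -> A) :
  tsum k F * a = tsum k (fun S => F S * a).
Proof. by rewrite (@tsum_morph _ _ _ ( *%R^~ a) (mul0r a)) // => x y; rewrite mulrDl. Qed.

(** Serves to collect the Leibniz expansion by the order left on the argument, and backwards to
    collect a double sum by total order in the binomial inversion. *)
Lemma sum_triangle (V : nmodType) (F : nat -> nat -> V) m :
  \sum_(k < m.+1) \sum_(i < k.+1) F i (k - i)%N =
  \sum_(j < m.+1) \sum_(i < (m - j).+1) F i j.
Proof.
elim: m => [|m IH]; first by rewrite !big_ord1.
rewrite big_ord_recr IH [RHS]big_ord_recr /= subnn big_ord1.
have -> : \sum_(i < m.+2) F i (m.+1 - i)%N = \sum_(j < m.+1) F (m - j).+1 j + F 0 m.+1.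
  rewrite -(big_mkord xpredT (fun i => F i (m.+1 - i)%N)) big_nat_rev /= big_mkord.
  rewrite big_ord_recr /= ?add0n ?addn0 ?subSS ?subnn ?subn0 //; congr (_ + _).
  by apply: eq_bigr => j _; have lj := ltn_ord j; congr F; lia.
rewrite addrA -big_split /=; congr (_ + _); apply: eq_bigr => j _.
by rewrite subSn ?leq_ord // [RHS]big_ord_recr.
Qed.

(** Two instances occur: the partial derivatives on an open set ([sfun_cderiv]), and the partial
    derivatives of other coordinates seen in the same ring ([frame]). *)
Record cderiv (A : comPzRingType) (n : nat) := CDeriv {
  der :> 'I_n -> A -> A;
  derD : forall l, {morph der l : x y / x + y};
  derM : forall l a b, der l (a * b) = der l a * b + a * der l b;
  derC : forall k l a, der k (der l a) = der l (der k a) }.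

Section Derivations.
Variables (A : comPzRingType) (n : nat) (d : cderiv A n).
Implicit Types (a f g : A) (S T L : seq 'I_n) (P : seq 'I_n -> A).

Lemma der0 l : d l 0 = 0.
Proof. by apply: (addrI (d l 0)); rewrite -derD !addr0. Qed.

Lemma derN l : {morph d l : a / - a}.
Proof. by move=> a; apply/eqP; rewrite -addr_eq0 -derD addNr der0. Qed.

Lemma der1 l : d l 1 = 0.
Proof. by apply: (addrI (d l 1)); rewrite addr0 -{3}[1]mulr1 derM !mulr1 mul1r. Qed.

Lemma der_sum l (I : Type) (r : seq I) (Q : pred I) (F : I -> A) :
  d l (\sum_(i <- r | Q i) F i) = \sum_(i <- r | Q i) d l (F i).
Proof. exact: (big_morph _ (derD d l) (der0 l)). Qed.

Lemma derMn l a k : d l (a *+ k) = d l a *+ k.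
Proof. by elim: k => [|k IH]; rewrite ?der0 // !mulrS derD IH. Qed.

Definition ders S f : A := foldr (fun l => d l) f S.

Lemma ders_cat S T f : ders (S ++ T) f = ders S (ders T f).
Proof. exact: foldr_cat. Qed.

Lemma dersD S : {morph ders S : a b / a + b}.
Proof. by move=> a b; elim: S => //= l S ->; rewrite derD. Qed.

Lemma ders0 S : ders S 0 = 0.
Proof. by elim: S => //= l S ->; rewrite der0. Qed.

Lemma dersN S : {morph ders S : a / - a}.
Proof. by move=> a; elim: S => //= l S ->; rewrite derN. Qed.

Lemma dersMn S a k : ders S (a *+ k) = ders S a *+ k.
Proof. by elim: S => //= l S ->; rewrite derMn. Qed.

Lemma ders_sum S (I : Type) (r : seq I) (Q : pred I) (F : I -> A) :
  ders S (\sum_(i <- r | Q i) F i) = \sum_(i <- r | Q i) ders S (F i).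
Proof. exact: (big_morph _ (dersD S) (ders0 S)). Qed.

Lemma ders_tsum S k (F : seq 'I_n -> A) :
  ders S (tsum k F) = tsum k (fun T => ders S (F T)).
Proof. exact: (tsum_morph (ders0 S) (dersD S)). Qed.

Lemma ders_sign S k a : ders S ((-1) ^+ k * a) = (-1) ^+ k * ders S a.
Proof.
by elim: k => [|k IH]; rewrite ?mul1r // exprS mulN1r !mulNr dersN IH.
Qed.

Lemma ders_scale S k b a :
  ders S ((-1) ^+ k * b%:R * a) = (-1) ^+ k * b%:R * ders S a.
Proof. by rewrite -!mulrA ders_sign !mulr_natl dersMn. Qed.

Lemma der_ders l S f : d l (ders S f) = ders S (d l f).
Proof. by elim: S => //= k S IH; rewrite -IH derC. Qed.

Lemma perm_ders S T f : perm_eq S T -> ders S f = ders T f.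
Proof.
elim: S T => [|l S IH] T; first by rewrite perm_sym => /perm_nilP ->.
move=> ST; have /splitPr lT : l \in T by rewrite -(perm_mem ST) mem_head.
case: T / lT ST => T1 T2; rewrite perm_sym perm_catC cat_cons perm_cons perm_catC.
rewrite perm_sym => /IH /= ->.
by rewrite !ders_cat /= der_ders.
Qed.

(** [dop], [dadj] and [dopadj] are the scalar counterparts of [op_fun], [adj_fun] and [eta], with
    coefficients in [A]. *)
Definition dop m P f : A := \sum_(k < m.+1) tsum k (fun S => P S * ders S f).
Definition dadj m P f : A :=
  \sum_(k < m.+1) (-1) ^+ k * tsum k (fun S => ders S (P S * f)).
Definition dopadj m P L : A :=
  \sum_(k < (m - size L).+1)
    tsum k (fun S => (-1) ^+ (k + size L) * 'C(k + size L, k)%:R * ders S (P (S ++ L))).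

Definition perm_inv m P := forall L L', (size L <= m)%N -> perm_eq L L' -> P L = P L'.

(** Induction on [k] with the outermost derivative peeled off: it falls either on the coefficient,
    which lengthens [T], or on [f], which lengthens [L]. Pascal's rule adds the two
    contributions. *)
Lemma tsum_leibniz k P f :
  (forall L L', size L = k -> perm_eq L L' -> P L = P L') ->
  tsum k (fun S => ders S (P S * f)) =
  \sum_(i < k.+1) tsum i (fun T => tsum (k - i) (fun L =>
     ders T (P (T ++ L)) * ders L f)) *+ 'C(k, i).
Proof.
elim: k P => [|k IH] P sP; first by rewrite big_ord1 bin0.
rewrite [LHS]/=.
pose F i := tsum i (fun T => tsum (k.+1 - i) (fun L => ders T (P (T ++ L)) * ders L f)).
have step l : tsum k (fun S => d l (ders S (P (l :: S) * f))) =
    \sum_(i < k.+1) (tsum i (fun T => tsum (k - i) (fun L =>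
        ders (l :: T) (P (l :: T ++ L)) * ders L f)) *+ 'C(k, i)
     + tsum i (fun T => tsum (k - i) (fun L =>
        ders T (P (l :: T ++ L)) * ders (l :: L) f)) *+ 'C(k, i)).
  have -> : tsum k (fun S => d l (ders S (P (l :: S) * f))) =
      d l (tsum k (fun S => ders S (P (l :: S) * f))).
    by rewrite (tsum_morph (der0 l) (derD d l)).
  rewrite IH; last by move=> L L' sL LL'; apply: sP; rewrite /= ?sL ?perm_cons.
  rewrite der_sum; apply: eq_bigr => i _; rewrite derMn -mulrnDl; congr (_ *+ _).
  rewrite (tsum_morph (der0 l) (derD d l)) -tsumD; apply: eq_tsum => T _ /=.
  rewrite (tsum_morph (der0 l) (derD d l)) -tsumD; apply: eq_tsum => L _ /=.
  by rewrite derM.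
under eq_bigr do rewrite step.
rewrite exchange_big /=.
have e1 (i : 'I_k.+1) : \sum_(l < n) tsum i (fun T => tsum (k - i) (fun L =>
        ders (l :: T) (P (l :: T ++ L)) * ders L f)) = F i.+1.
  by rewrite /F /= subSS.
(* The index [l] has to move from the front of [T ++ L] to the front of [L]; this is where the
   symmetry of [P] enters. *)
have e2 (i : 'I_k.+1) : \sum_(l < n) tsum i (fun T => tsum (k - i) (fun L =>
        ders T (P (l :: T ++ L)) * ders (l :: L) f)) = F i.
  rewrite /F subSn ?leq_ord //= -tsum_sum; apply: eq_tsum => T sT.
  apply: eq_bigr => l _; apply: eq_tsum => L sL.
  rewrite (sP (T ++ l :: L) (l :: T ++ L)) //.
    by rewrite size_cat /= sT sL addnS subnKC // leq_ord.
  by rewrite (perm_catCA T [:: l] L).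
under eq_bigr => i _ do rewrite big_split /= !sumrMnl e1 e2.
rewrite big_split /= -/(F _).
transitivity (\sum_(i < k.+2) F i *+ 'C(k.+1, i)); last by [].
rewrite [RHS]big_ord_recl bin0 mulr1n.
(* Pascal's rule on the target side; the surplus top term carries ['C(k, k.+1) = 0]. *)
under [in RHS]eq_bigr => i _ do rewrite lift0 binS mulrnDr.
rewrite big_split [RHS]addrA addrC; congr (_ + _).
rewrite big_ord_recl bin0 mulr1n [in RHS]big_ord_recr bin_small //= mulr0n addr0.
by congr (_ + _); apply: eq_bigr => i _; rewrite lift0.
Qed.

(** Leibniz on each order [k], then regrouping by the number [j] of derivatives left on [f]; those
    on the coefficient are the [d_Sigma] of the formula. *)
Lemma dadjE m P f : perm_inv m P -> dadj m P f = dop m (dopadj m P) f.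
Proof.
move=> sP; rewrite /dadj /dop.
pose H (i j : nat) : A := tsum j (fun L => tsum i (fun T =>
  (-1) ^+ (i + j) * 'C(i + j, i)%:R * ders T (P (T ++ L)) * ders L f)).
transitivity (\sum_(k < m.+1) \sum_(i < k.+1) H i (k - i)%N).
  apply: eq_bigr => k _.
  rewrite tsum_leibniz; last first.
    by move=> L L' sL; apply: sP; rewrite sL -ltnS.
  rewrite mulr_sumr; apply: eq_bigr => i _.
  rewrite /H subnKC ?leq_ord // [RHS]tsumC -[X in _ * X]mulr_natl mulrA.
  rewrite mulr_tsumr; apply: eq_tsum => T _; rewrite mulr_tsumr.
  by apply: eq_tsum => L _; rewrite !mulrA.
rewrite sum_triangle; apply: eq_bigr => j _.
rewrite -tsum_sum; apply: eq_tsum => L sL.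
rewrite /dopadj sL mulr_suml; apply: eq_bigr => i _.
by rewrite mulr_tsuml.
Qed.

Lemma sum_bin_sign N : \sum_(j < N.+1) (-1) ^+ j * 'C(N, j)%:R = (N == 0)%:R :> A.
Proof.
transitivity ((1 - 1 : A) ^+ N); last by rewrite subrr expr0n.
rewrite exprBn; apply: eq_bigr => j _.
by rewrite !expr1n !mulr1 mulr_natr.
Qed.

(** By symmetry the terms depend on [S] and [T] only through the concatenated tuple, of length [N]
    say. The coefficients factor into a part common to all splittings and [(-1)^j C(N, j)], whose
    sum over [j] vanishes unless [N = 0]; what remains is [P L]. *)
Lemma dopadjK m P L : perm_inv m P -> (size L <= m)%N -> dopadj m (dopadj m P) L = P L.
Proof.
move=> sP; have [l El] : exists l, size L = l by exists (size L).
rewrite El => sL.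
pose H (i j : nat) : A := tsum (i + j) (fun T =>
  (-1) ^+ i * 'C(i + j, i)%:R * ('C(l + (i + j), l)%:R * ders T (P (T ++ L)))).
transitivity (\sum_(k < (m - l).+1) \sum_(j < (m - l - k).+1) H j k).
  rewrite {1}/dopadj El; apply: eq_bigr => k _.
  have kl : (k <= m - l)%N by rewrite -ltnS.
  transitivity (\sum_(j < (m - l - k).+1) tsum k (fun S => tsum j (fun T =>
     (-1) ^+ (k + l) * 'C(k + l, k)%:R * ((-1) ^+ (j + (k + l)) *
       'C(j + (k + l), j)%:R * ders (S ++ T) (P (T ++ S ++ L)))))).
    rewrite -tsum_sum; apply: eq_tsum => S sS.
    rewrite /dopadj size_cat sS El -subnDA (addnC k l) ders_sum mulr_sumr.
    apply: eq_bigr => j _; rewrite ders_tsum mulr_tsumr; apply: eq_tsum => T sT.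
    by rewrite ders_scale ders_cat.
  apply: eq_bigr => j _; rewrite /H -{1}(addnC k j) tsum_cat.
  apply: eq_tsum => S sS; apply: eq_tsum => T sT.
  rewrite -(sP (T ++ S ++ L) ((S ++ T) ++ L)); first last.
  - by rewrite catA perm_cat2r perm_catC.
  - rewrite !size_cat sS sT El; have := ltn_ord j; lia.
  rewrite !mulrA; congr (_ * _).
  (* The factor [(-1)^(k+l)] occurs twice, so only the sign [(-1)^j] survives. *)
  have -> : (-1) ^+ (k + l) * 'C(k + l, k)%:R * (-1) ^+ (j + (k + l)) * 'C(j + (k + l), j)%:R
     = (-1) ^+ j * ('C(k + l, k) * 'C(j + (k + l), j))%:R :> A.
    have aux (x y a b : A) : x * x = 1 -> x * a * (y * x) * b = y * (a * b).
      by move=> xx; rewrite -[RHS]mul1r -xx; ring.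
    by rewrite (exprD _ j (k + l)) natrM aux // -expr2 sqrr_sign.
  (* Both products of binomials are the trinomial coefficient [(j+k+l)! / (j! k! l!)]; this is
     checked by clearing the three factorials. *)
  rewrite -mulrA -natrM; congr (_ * _%:R).
    have f1 := @bin_fact (k + l) k (leq_addr _ _).
  have f2 := @bin_fact (j + (k + l)) j (leq_addr _ _).
  have f3 := @bin_fact (j + k) j (leq_addr _ _).
  have f4 := @bin_fact (l + (j + k)) l (leq_addr _ _).
  rewrite !addKn in f1 f2 f3 f4.
  have e : (l + (j + k) = j + (k + l))%N by lia.
  rewrite e in f4 *.
  apply/eqP; rewrite -(eqn_pmul2r (fact_gt0 j)) -(eqn_pmul2r (fact_gt0 k)).
  rewrite -(eqn_pmul2r (fact_gt0 l)); apply/eqP.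
  transitivity ('C(j + (k + l), j) * (j`! * ('C(k + l, k) * (k`! * l`!))))%N; first by ring.
  rewrite f1 f2 -f4 -f3; ring.
rewrite -sum_triangle.
transitivity (\sum_(N < (m - l).+1) tsum N (fun T =>
  (N == 0 :> nat)%:R * ('C(l + N, l)%:R * ders T (P (T ++ L))))).
  apply: eq_bigr => N _; rewrite -sum_bin_sign.
  under [in RHS]eq_tsum => T _ do rewrite mulr_suml.
  rewrite tsum_sum; apply: eq_bigr => i _.
  by rewrite /H subnKC // -ltnS.
rewrite big_ord_recl big1 ?addr0 => [|i _].
  by rewrite /= mul1r addn0 binn mul1r.
by apply: tsum0 => T _; rewrite lift0 mul0r.
Qed.
End Derivations.

(** * Pairs of formally adjoint operators *)

Section AdjointPairs.
Variables (A : comPzRingType) (n : nat) (d : cderiv A n).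
Implicit Types (s : seq (A * seq 'I_n)) (T : A -> A).

(** An operator is presented by a possibly redundant list of terms [(a, S)], and its adjoint is
    computed termwise from the same list. Adjointness asks only for some presentation, so composites
    need no normal form of their coefficients. *)
Definition op_act s (f : A) : A := \sum_(x <- s) x.1 * ders d x.2 f.
Definition op_adj s (f : A) : A := \sum_(x <- s) (-1) ^+ size x.2 * ders d x.2 (x.1 * f).
Definition adjoint_pair T T' := exists s, T =1 op_act s /\ T' =1 op_adj s.

Lemma adjoint_pair_ext T1 T1' T2 T2' :
  T1 =1 T2 -> T1' =1 T2' -> adjoint_pair T1 T1' -> adjoint_pair T2 T2'.
Proof. by move=> e e' [s [h h']]; exists s; split=> f; rewrite -?e -?e'. Qed.

Lemma adjoint_pair0 : adjoint_pair (fun=> 0) (fun=> 0).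
Proof. by exists [::]; split=> f; rewrite /op_act /op_adj big_nil. Qed.

Lemma adjoint_pairD T1 T1' T2 T2' : adjoint_pair T1 T1' -> adjoint_pair T2 T2' ->
  adjoint_pair (fun f => T1 f + T2 f) (fun f => T1' f + T2' f).
Proof.
move=> [s1 [h1 h1']] [s2 [h2 h2']]; exists (s1 ++ s2).
by split=> f; rewrite /op_act /op_adj big_cat ?h1 ?h2 ?h1' ?h2'.
Qed.

Lemma adjoint_pair_sum (I : Type) (r : seq I) (T T' : I -> A -> A) :
  (forall i, adjoint_pair (T i) (T' i)) ->
  adjoint_pair (fun f => \sum_(i <- r) T i f) (fun f => \sum_(i <- r) T' i f).
Proof.
move=> H; elim: r => [|i r IH].
  by apply: adjoint_pair_ext adjoint_pair0 => f; rewrite big_nil.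
by apply: adjoint_pair_ext (adjoint_pairD (H i) IH) => f; rewrite big_cons.
Qed.

Lemma adjoint_pair_tsum k (T T' : seq 'I_n -> A -> A) :
  (forall S, adjoint_pair (T S) (T' S)) ->
  adjoint_pair (fun f => tsum k (T^~ f)) (fun f => tsum k (T'^~ f)).
Proof.
elim: k T T' => [|k IH] T T' H /=; first exact: H.
by apply: adjoint_pair_sum => l; apply: IH.
Qed.

Lemma adjoint_pair_id a : adjoint_pair ( *%R a) ( *%R a).
Proof.
exists [:: (a, [::])].
by split=> f; rewrite /op_act /op_adj big_seq1 //= expr0 mul1r.
Qed.

Lemma adjoint_pairM a T T' : adjoint_pair T T' ->
  adjoint_pair (fun f => a * T f) (fun f => T' (a * f)).
Proof.
move=> [s [h h']]; exists [seq (a * x.1, x.2) | x <- s].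
split=> f; rewrite /op_act /op_adj big_map ?h ?h' /op_act /op_adj.
  by rewrite mulr_sumr; apply: eq_bigr => x _; rewrite mulrA.
by apply: eq_bigr => x _; rewrite mulrCA mulrA.
Qed.

(** By Leibniz each term [(a, S)] splits into [(d l a, S)] and [(a, l :: S)]; on the adjoint side
    these recombine into minus the old adjoint applied to [d l f]. *)
Lemma adjoint_pair_der l T T' : adjoint_pair T T' ->
  adjoint_pair (fun f => d l (T f)) (fun f => - T' (d l f)).
Proof.
move=> [s [h h']].
exists ([seq (d l x.1, x.2) | x <- s] ++ [seq (x.1, l :: x.2) | x <- s]).
split=> f; rewrite /op_act /op_adj big_cat /= !big_map ?h ?h' /op_act /op_adj.
  by rewrite der_sum -big_split; apply: eq_bigr => x _; rewrite derM.
rewrite -big_split -sumrN; apply: eq_bigr => x _ /=.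
by rewrite exprS mulN1r der_ders derM dersD; ring.
Qed.

(** Since the derivations commute, coefficients can be recovered only after summation over all
    reorderings of a multi-index. For smooth functions the property is [sfun_separated]. *)
Definition op_separated :=
  forall s, (forall f, op_act s f = 0) ->
  forall S, \sum_(x <- s | perm_eq S x.2) x.1 = 0.

(** The terms are grouped by multi-index up to reordering; within a group the operator
    [(-1)^|S| d_S] is common and the coefficients sum to zero. *)
Lemma op_adj_eq0 s : op_separated -> (forall f, op_act s f = 0) -> forall f, op_adj s f = 0.
Proof.
move=> sep H g.
(* The sorted tuple is a canonical name for the permutation class of [x.2]. *)
pose key (x : A * seq 'I_n) := sort leq (map val x.2).
have keyP x y : key x = key y <-> perm_eq x.2 y.2.
  split=> [e|e]; last first.
    by apply/perm_sortP; [exact: leq_total|exact: leq_trans|exact: anti_leq|exact: perm_map].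
  by apply: (perm_map_inj val_inj); rewrite -(perm_sort leq) -/(key x) e perm_sort.
have sumE : op_adj s g = \sum_(al <- undup (map key s))
    \sum_(x <- s | key x == al) (-1) ^+ size x.2 * ders d x.2 (x.1 * g).
  rewrite (exchange_big_dep xpredT) //= /op_adj big_seq [RHS]big_seq.
  apply: eq_bigr => x xs; rewrite (big_rem (key x)) ?mem_undup ?map_f //= eqxx.
  rewrite big1_seq ?addr0 // => al /andP[/eqP <-].
  by rewrite rem_filter ?undup_uniq // mem_filter /= eqxx.
rewrite sumE big1_seq // => al /=; rewrite mem_undup => /mapP[x0 x0s ->].
rewrite (eq_bigl (fun x => perm_eq x0.2 x.2)); last first.
  by move=> x; apply/eqP/idP => [e|e]; [apply/keyP|apply/esym/keyP].
transitivity ((-1) ^+ size x0.2 * ders d x0.2 ((\sum_(x <- s | perm_eq x0.2 x.2) x.1) * g)).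
  rewrite mulr_suml ders_sum mulr_sumr; apply: eq_bigr => x e.
  by rewrite (perm_size e) (perm_ders d _ e).
by rewrite sep // mul0r ders0 mulr0.
Qed.

(** The difference of the two presentations acts as zero, so its adjoint [T1 - T2] vanishes. *)
Lemma adjoint_pair_uniq T T1 T2 : op_separated ->
  adjoint_pair T T1 -> adjoint_pair T T2 -> T1 =1 T2.
Proof.
move=> sep h1 [s2 [h2 h2']].
have [s [h h']] : adjoint_pair (fun=> 0) (fun f => T1 f - T2 f).
  have : adjoint_pair (fun f => - T f) (fun f => - T2 f).
    exists [seq (- x.1, x.2) | x <- s2].
    split=> f; rewrite /op_act /op_adj big_map ?h2 ?h2' /op_act /op_adj -sumrN;
      apply: eq_bigr => x _ /=; first by rewrite mulNr.
    by rewrite mulNr dersN mulrN.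
  by move/(adjoint_pairD h1); apply: adjoint_pair_ext => // f; rewrite subrr.
move=> f; apply/eqP; rewrite -subr_eq0; apply/eqP.
by rewrite h'; apply: op_adj_eq0 => // g; rewrite -h.
Qed.
End AdjointPairs.

(** * Change of frame *)

Section Frames.
Variables (A : comPzRingType) (n : nat) (d : cderiv A n).

Lemma der_prod l (I : finType) (F : I -> A) :
  d l (\prod_i F i) = \sum_i d l (F i) * \prod_(j | j != i) F j.
Proof.
have H (r : seq I) : uniq r -> d l (\prod_(i <- r) F i) =
    \sum_(i <- r) d l (F i) * \prod_(j <- r | j != i) F j.
  elim: r => [|i r IH] /=; first by rewrite !big_nil der1.
  move=> /andP[ir ur]; rewrite !big_cons derM eqxx /= IH //; congr (_ + _).
    congr (_ * _); rewrite big_seq [RHS]big_seq_cond; apply: eq_bigl => j.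
    by case: eqP => [->|]; rewrite ?(negPf ir) ?andbF ?andbT.
  rewrite mulr_sumr big_seq [RHS]big_seq; apply: eq_bigr => j jr.
  rewrite big_cons ifT; first by rewrite mulrCA.
  by apply: contraNneq ir => ->.
by rewrite H // index_enum_uniq.
Qed.

(** Jacobi's formula: the derivative is the sum of the determinants with one row differentiated,
    each expanded along that row. *)
Lemma der_det l k (M : 'M[A]_k) :
  d l (\det M) = \sum_i \sum_j d l (M i j) * cofactor M i j.
Proof.
pose M' (i : 'I_k) := \matrix_(a, b) (if a == i then d l (M a b) else M a b).
transitivity (\sum_i \det (M' i)).
  rewrite /(\det _) der_sum exchange_big /=; apply: eq_bigr => s _.
  rewrite -mulr_sumr.
  rewrite -[d l _]/(ders d [:: l] _) ders_sign /=.
  congr (_ * _); rewrite der_prod; apply: eq_bigr => i _.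
  rewrite [RHS](bigD1 i) //= mxE eqxx; congr (_ * _).
  by apply: eq_bigr => j /negPf ji; rewrite mxE ji.
apply: eq_bigr => i _; rewrite (expand_det_row _ i); apply: eq_bigr => j _.
rewrite mxE eqxx; congr (_ * _); rewrite /cofactor; congr (_ * \det _).
by apply/matrixP=> a b; rewrite !mxE eq_sym (negPf (neq_lift _ _)).
Qed.

(* [N] is the inverse of the Jacobian matrix [M] of new coordinates [psi], so
   [\sum_i N j i * d i] is the partial derivative along [psi j]. *)
Variables (psi : 'I_n -> A) (N : 'M[A]_n).
Let M := \matrix_(i, j) d i (psi j).
Hypothesis NM : N *m M = 1%:M.

Let NME j k : \sum_i N j i * d i (psi k) = (j == k)%:R.
Proof.
by move/matrixP: NM => /(_ j k); rewrite !mxE => <-; apply: eq_bigr => i _; rewrite mxE.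
Qed.

Let MNE i k : \sum_j d i (psi j) * N j k = (i == k)%:R.
Proof.
have /matrixP/(_ i k) := mulmx1C NM; rewrite !mxE => <-.
by apply: eq_bigr => j _; rewrite mxE.
Qed.

Let delta_sum j (F : 'I_n -> A) : \sum_i (j == i)%:R * F i = F j.
Proof.
rewrite (bigD1 j) //= eqxx mul1r big1 ?addr0 // => i ij.
by rewrite eq_sym (negPf ij) mul0r.
Qed.

Let cof i j : cofactor M i j = \det M * N j i.
Proof.
have /matrixP/(_ j i) : \adj M = \det M *: N.
  by rewrite -[LHS]mul1mx -NM -mulmxA mul_mx_adj mul_mx_scalar.
by rewrite !mxE.
Qed.

(** Says that the [j]-th frame field times [\det M] is divergence-free. Jacobi's formula expresses
    the derivatives of [\det M] by second derivatives of [psi], and differentiating [N *m M = 1%:M]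
    turns these into derivatives of [N]. *)
Lemma frame_det j :
  \sum_i N j i * d i (\det M) = - (\det M * \sum_i d i (N j i)).
Proof.
have dJ l : d l (\det M) = \det M * \sum_a \sum_b N b a * d l (d a (psi b)).
  rewrite der_det mulr_sumr; apply: eq_bigr => a _; rewrite mulr_sumr.
  by apply: eq_bigr => b _; rewrite cof mxE mulrC mulrA.
under eq_bigr do rewrite dJ mulrCA mulr_sumr.
rewrite -mulr_sumr -mulrN; congr (_ * _).
rewrite exchange_big /= -sumrN; apply: eq_bigr => a _.
under eq_bigr do rewrite mulr_sumr.
rewrite exchange_big /=.
(* Here it matters that [M] is a Jacobian matrix: [d i (d a (psi b)) = d a (d i (psi b))]. *)
transitivity (\sum_b \sum_i - (d a (N j i) * (d i (psi b) * N b a))).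
  apply: eq_bigr => b _.
  have : d a (\sum_i N j i * d i (psi b)) = 0.
    by rewrite NME; case: eqP => _; rewrite ?der1 ?der0.
  rewrite der_sum (eq_bigr _ (fun i _ => derM d a (N j i) (d i (psi b)))).
  rewrite big_split /= => /eqP; rewrite addr_eq0 => /eqP e.
  transitivity (N b a * \sum_i N j i * d a (d i (psi b))).
    by rewrite mulr_sumr; apply: eq_bigr => i _; rewrite mulrCA (derC d a i).
  rewrite sumrN -[X in _ * X]opprK -e mulrN mulr_sumr; congr (- _).
  by apply: eq_bigr => i _; ring.
rewrite exchange_big /=.
transitivity (\sum_i (a == i)%:R * (- d a (N j i))); last by rewrite delta_sum.
apply: eq_bigr => i _; rewrite sumrN -mulr_sumr MNE eq_sym mulrN mulrC.
by case: eqP => [->|]; rewrite ?mulr0 ?mul0r ?oppr0.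
Qed.

Definition frame_der j f : A := \sum_i N j i * d i f.

Lemma frame_derD j : {morph frame_der j : x y / x + y}.
Proof.
by move=> x y; rewrite -big_split; apply: eq_bigr => i _; rewrite derD mulrDr.
Qed.

Lemma frame_derM j a b : frame_der j (a * b) = frame_der j a * b + a * frame_der j b.
Proof.
by rewrite /frame_der mulr_suml mulr_sumr -big_split; apply: eq_bigr => i _ /=; rewrite derM; ring.
Qed.

(* The commutator of two frame fields is a vector field that kills every [psi k]. *)
Lemma frame_derC j k f : frame_der j (frame_der k f) = frame_der k (frame_der j f).
Proof.
pose c l := frame_der j (N k l) - frame_der k (N j l).
have E g : frame_der j (frame_der k g) - frame_der k (frame_der j g) = \sum_l c l * d l g.
  have e u v : frame_der u (frame_der v g) = \sum_l frame_der u (N v l) * d l g +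
      \sum_l \sum_i N v l * N u i * d i (d l g).
    transitivity (\sum_i \sum_l (N u i * d i (N v l) * d l g + N v l * N u i * d i (d l g))).
      apply: eq_bigr => i _; rewrite der_sum mulr_sumr; apply: eq_bigr => l _.
      by rewrite derM; ring.
    rewrite exchange_big -big_split; apply: eq_bigr => l _ /=.
    by rewrite big_split mulr_suml.
  rewrite !e; have -> : \sum_l \sum_i N j l * N k i * d i (d l g) =
      \sum_l \sum_i N k l * N j i * d i (d l g).
    rewrite exchange_big /=; apply: eq_bigr => i _; apply: eq_bigr => l _.
    by rewrite derC; ring.
  rewrite opprD addrACA subrr addr0 -sumrB.
  by apply: eq_bigr => l _; rewrite mulrBl.
have c0 l : c l = 0.
  transitivity (\sum_i c i * \sum_m d i (psi m) * N m l).
    under eq_bigr do rewrite MNE eq_sym mulrC.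
    by rewrite delta_sum.
  under eq_bigr do rewrite mulr_sumr.
  rewrite exchange_big big1 // => m _.
  transitivity ((\sum_i c i * d i (psi m)) * N m l).
    by rewrite mulr_suml; apply: eq_bigr => i _; rewrite mulrA.
  rewrite -E; have z u v : frame_der u (frame_der v (psi m)) = 0.
    rewrite {2}/frame_der NME /frame_der big1 // => i _.
    by case: eqP => _; rewrite ?der1 ?der0 mulr0.
  by rewrite !z subrr mul0r.
apply/eqP; rewrite -subr_eq0 E; apply/eqP.
by rewrite big1 // => l _; rewrite c0 mul0r.
Qed.

Definition frame : cderiv A n := CDeriv frame_derD frame_derM frame_derC.

(* Piola's identity: the formal adjoint of a frame field becomes minus the field
   itself after multiplication by the Jacobian determinant. *)
Lemma frame_adj j h : \sum_i d i (N j i * (\det M * h)) = \det M * frame j h.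
Proof.
have := frame_det j; move: (\det M) => D eD.
transitivity ((\sum_i d i (N j i)) * (D * h) + (\sum_i N j i * d i D) * h
   + \sum_i N j i * (D * d i h)).
  rewrite !mulr_suml -!big_split; apply: eq_bigr => i _ /=.
  by rewrite !derM; ring.
rewrite eD -[RHS]add0r; congr (_ + _); first by ring.
by rewrite mulr_sumr; apply: eq_bigr => i _; rewrite mulrCA.
Qed.

(** The adjoint of [ders frame S]. It is a left fold because passing to adjoints reverses the order
    of composition. *)
Definition frame_adjs S (g : A) : A := foldl (fun g l => - \sum_i d i (N l i * g)) g S.

Lemma frame_adjsD S : {morph frame_adjs S : x y / x + y}.
Proof.
elim: S => [|k S IH] x y //; rewrite /frame_adjs /= -!/(frame_adjs _ _) -IH.
congr frame_adjs; rewrite -opprD -big_split /=.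
by congr (- _); apply: eq_bigr => i _; rewrite mulrDr derD.
Qed.

(** Piola's identity at every step. The reversal of [S] comes from the left fold and disappears
    later, since frame derivatives commute. *)
Lemma frame_adjsE S h :
  frame_adjs S (\det M * h) = \det M * ((-1) ^+ size S * ders frame (rev S) h).
Proof.
elim: S h => [|l S IH] h; first by rewrite mul1r.
rewrite /frame_adjs [foldl _ _ _]/= -/(frame_adjs _ _) frame_adj -mulrN IH.
by rewrite rev_cons -cats1 ders_cat exprS mulN1r mulNr -mulrN -dersN.
Qed.

Lemma adjoint_pair_frame S T T' : adjoint_pair d T T' ->
  adjoint_pair d (fun f => ders frame S (T f)) (fun g => T' (frame_adjs S g)).
Proof.
move=> TT'; elim: S => [|l S IH] //.
have Hi i : adjoint_pair d (fun f => N l i * d i (ders frame S (T f)))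
    (fun g => - T' (frame_adjs S (d i (N l i * g)))).
  exact: (adjoint_pairM (N l i) (adjoint_pair_der i IH)).
apply: adjoint_pair_ext (adjoint_pair_sum (index_enum 'I_n) Hi) => // g.
have HD : {morph (fun g => T' (frame_adjs S g)) : x y / x + y}.
  move=> x y; case: TT' => s [_ h']; rewrite frame_adjsD !h' /op_adj -big_split.
  by apply: eq_bigr => u _; rewrite mulrDr dersD mulrDr.
have H0 : T' (frame_adjs S 0) = 0.
  by apply: (addrI (T' (frame_adjs S 0))); rewrite -HD !addr0.
have HN x : T' (frame_adjs S (- x)) = - T' (frame_adjs S x).
  by apply/eqP; rewrite -addr_eq0 -HD addNr H0.
rewrite sumrN [frame_adjs (l :: S) g]/(frame_adjs S _) HN; congr (- _).
by rewrite (big_morph _ HD H0).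
Qed.

(** The hypothesis on [P] and [P'] says that one operator is given in two frames, with [GW] and [GZ]
    acting on its arguments and values; [th] and [th'] correspond contragrediently, up to the
    Jacobian determinant. For fixed [r] and [a'] the scalar operator [T a'] is presented in both
    frames, and uniqueness of its adjoint gives [U1 = U2]. Evaluation on [\det M * th' a'] and
    summation over [a'] yield the conclusion. *)
Lemma system_adjoint m v w (P P' : seq 'I_n -> 'I_v -> 'I_w -> A)
    (GW : 'I_w -> 'I_w -> A) (GZ : 'I_v -> 'I_v -> A) :
  op_separated d ->
  (forall xi a', \sum_(k < m.+1) tsum k (fun S =>
       \sum_r' P' S a' r' * ders frame S (\sum_r xi r * GW r r')) =
     \sum_a (\sum_(k < m.+1) tsum k (fun S =>
       \sum_r P S a r * ders d S (xi r))) * GZ a a') ->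
  forall th th', (forall a, th a = \sum_a' GZ a a' * (\det M * th' a')) ->
  forall r, \sum_(k < m.+1) (-1) ^+ k * tsum k (fun S =>
      ders d S (\sum_a P S a r * th a)) =
    \sum_r' GW r r' * (\det M * \sum_(k < m.+1) (-1) ^+ k * tsum k (fun S =>
      ders frame S (\sum_a' P' S a' r' * th' a'))).
Proof.
move=> sep H th th'; move: (\det M) frame_adjsE => D frame_adjsDE Hth r.
pose T a' f := \sum_(k < m.+1) tsum k (fun S =>
  \sum_r' P' S a' r' * ders frame S (GW r r' * f)).
have TE a' f : T a' f = \sum_a GZ a a' * \sum_(k < m.+1) tsum k (fun S =>
    P S a r * ders d S f).
  (* A single nonzero entry [f] in slot [r] isolates one column of the system. *)
  have := H (fun i => if i == r then f else 0) a'.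
  have -> : \sum_(k < m.+1) tsum k (fun S => \sum_r' P' S a' r' *
      ders frame S (\sum_r0 (if r0 == r then f else 0) * GW r0 r')) = T a' f.
    apply: eq_bigr => k _; apply: eq_tsum => S _; apply: eq_bigr => r' _.
    rewrite (bigD1 r) //= eqxx big1 ?addr0; first by rewrite [f * _]mulrC.
    by move=> i /negPf ->; rewrite mul0r.
  move=> ->; apply: eq_bigr => a _; rewrite mulrC; congr (_ * _).
  apply: eq_bigr => k _; apply: eq_tsum => S _.
  rewrite (bigD1 r) //= eqxx big1 ?addr0 // => i /negPf ->.
  by rewrite ders0 mulr0.
pose U1 a' g := \sum_(k < m.+1) tsum k (fun S =>
  \sum_r' GW r r' * frame_adjs S (P' S a' r' * g)).
pose U2 a' g := \sum_a \sum_(k < m.+1) tsum k (fun S =>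
  (-1) ^+ size S * ders d S (P S a r * (GZ a a' * g))).
have pair1 a' : adjoint_pair d (T a') (U1 a').
  apply: adjoint_pair_sum => k; apply: adjoint_pair_tsum => S.
  apply: adjoint_pair_sum => r'.
  apply: (@adjoint_pairM _ _ _ (P' S a' r') (fun f => ders frame S (GW r r' * f))
    (fun g => GW r r' * frame_adjs S g)).
  apply: (@adjoint_pair_frame S ( *%R (GW r r')) ( *%R (GW r r'))).
  exact: adjoint_pair_id.
have pair2 a' : adjoint_pair d (T a') (U2 a').
  apply: adjoint_pair_ext (_ : adjoint_pair d (fun f => \sum_a GZ a a' *
    \sum_(k < m.+1) tsum k (fun S => P S a r * ders d S f)) _).
  - by move=> f; rewrite TE.
  - by move=> g.
  apply: adjoint_pair_sum => a.
  apply: (@adjoint_pairM _ _ _ _ _ (fun g => \sum_(k < m.+1) tsum k (fun S =>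
    (-1) ^+ size S * ders d S (P S a r * g)))).
  apply: adjoint_pair_sum => k; apply: adjoint_pair_tsum => S.
  by exists [:: (P S a r, S)]; split=> f; rewrite /op_act /op_adj big_seq1.
have U12 a' : U1 a' =1 U2 a' := adjoint_pair_uniq sep (pair1 a') (pair2 a').
(* On the side of [U2] the sum over [a'] reassembles [th a]; on the side of [U1] Piola's identity
   pulls the determinant out in front. *)
transitivity (\sum_a' U2 a' (D * th' a')).
  rewrite [RHS]exchange_big /=.
  transitivity (\sum_(k < m.+1) \sum_a tsum k (fun S =>
     (-1) ^+ k * ders d S (P S a r * th a))).
    apply: eq_bigr => k _; rewrite -tsum_sum mulr_tsumr; apply: eq_tsum => S _.
    by rewrite ders_sum mulr_sumr.
  rewrite exchange_big /=; apply: eq_bigr => a _.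
  rewrite [RHS]exchange_big; apply: eq_bigr => k _ /=.
  rewrite -tsum_sum; apply: eq_tsum => S sS.
  by rewrite Hth mulr_sumr ders_sum mulr_sumr sS.
transitivity (\sum_a' U1 a' (D * th' a')).
  by apply: eq_bigr => a' _; rewrite U12.
rewrite exchange_big /=.
transitivity (\sum_r' \sum_(k < m.+1) GW r r' * (D * ((-1) ^+ k * tsum k (fun S =>
      ders frame S (\sum_a' P' S a' r' * th' a'))))); last first.
  by apply: eq_bigr => r' _; rewrite !mulr_sumr.
rewrite [RHS]exchange_big /=; apply: eq_bigr => k _.
rewrite -tsum_sum.
transitivity (\sum_r' tsum k (fun S => GW r r' * (D * ((-1) ^+ k *
      ders frame S (\sum_a' P' S a' r' * th' a'))))); last first.
  by apply: eq_bigr => r' _; rewrite !mulr_tsumr.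
rewrite -[RHS]tsum_sum; apply: eq_tsum => S sS.
rewrite exchange_big /=; apply: eq_bigr => r' _.
rewrite ders_sum !mulr_sumr; apply: eq_bigr => a' _.
by rewrite mulrCA frame_adjsDE sS (perm_ders frame (T := S)) // perm_rev.
Qed.
End Frames.

(** * Smooth maps *)

Section LocalDifferentiability.
Variables (R : realType) (V W : normedModType R).
Implicit Types f g : V -> W.

Lemma near_eq_differentiable f g (x : V) :
  {near x, f =1 g} -> differentiable f x -> differentiable g x.
Proof.
move=> fg df.
have [cf ef] : continuous ('d f x) /\ f \o shift x = cst (f x) + 'd f x +o_ (nbhs 0) id.
  by split; [exact: diff_continuous|exact: diff_locally].
have eg : g \o shift x = cst (g x) + 'd f x +o_ (nbhs 0) id.
  apply/eqaddoP => _/posnumP[e].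
  have /eqaddoP/(_ e%:num [gt0 of e%:num]) H := ef.
  have fg0 : \forall h \near 0, f (h + x) = g (h + x).
    by have := fg; rewrite (near_shift 0) subr0.
  near=> h.
  have -> : (g \o shift x - (cst (g x) + 'd f x)) h = (f \o shift x - (cst (f x) + 'd f x)) h.
    rewrite /= !fctE /= -(nbhs_singleton fg); congr (_ - _); apply/esym.
    by near: h.
  by near: h.
have e : 'd f x = 'd g x :> (V -> W) by apply/esym/diff_unique.
by apply/diff_locallyP; rewrite -e.
Unshelve. all: by end_near. Qed.
End LocalDifferentiability.

Section SmoothOn.
Variables (R : realType) (V : normedModType R).
Implicit Types (W : normedModType R) (D : set V).

(** A finite-order version of [smooth_on], suited to induction: the product and chain rules need
    functions and their derivatives at the same order [k], which [CkS] provides. *)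
Fixpoint Ck W k D (f : V -> W) : Prop :=
  (forall x, D x -> differentiable f x) /\
  (if k is k'.+1 then forall v, Ck k' D ('D_v f) else True).

Lemma Ck_differentiable W k D (f : V -> W) x : Ck k D f -> D x -> differentiable f x.
Proof. by case: k => [|k] [df _]; apply: df. Qed.

Lemma CkS W k D (f : V -> W) : Ck k.+1 D f -> Ck k D f.
Proof.
elim: k f => [|k IH] f; first by case.
by move=> [df H]; split=> // v; apply: IH (H v).
Qed.

Lemma smooth_on_derive W D (f : V -> W) v : smooth_on D f -> smooth_on D ('D_v f).
Proof. by move=> sf vs x Dx; have := sf (rcons vs v) x Dx; rewrite foldr_rcons. Qed.

Lemma smooth_onP W D (f : V -> W) : smooth_on D f <-> forall k, Ck k D f.
Proof.
split=> [sf k|Cf vs].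
  elim: k f sf => [|k IH] f sf; first by split=> //; exact: (sf [::]).
  by split=> [|v]; [exact: (sf [::])|apply/IH/smooth_on_derive].
(* [foldr] differentiates along the last vector first, so the induction removes vectors from the
   end. *)
elim/last_ind: vs f Cf => [|vs v IH] f Cf x Dx; first by have [H _] := Cf 0; apply: H.
by rewrite foldr_rcons; apply: IH => // k; have [_] := Cf k.+1; apply.
Qed.

Lemma smooth_on_differentiable W D (f : V -> W) x :
  smooth_on D f -> D x -> differentiable f x.
Proof. by move=> sf; apply: (sf [::]). Qed.

Lemma smooth_on_sub W D D' (f : V -> W) : D' `<=` D -> smooth_on D f -> smooth_on D' f.
Proof. by move=> sD sf vs x /sD; apply: sf. Qed.

Lemma eq_derive_open W D (f g : V -> W) v : open D -> (forall x, D x -> f x = g x) ->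
  forall x, D x -> 'D_v f x = 'D_v g x.
Proof.
move=> oD fg x Dx; apply: near_eq_derive.
by apply: filterS (open_nbhs_nbhs (conj oD Dx)) => y /fg.
Qed.

Lemma eq_Ck W k D (f g : V -> W) : open D -> (forall x, D x -> f x = g x) ->
  Ck k D f -> Ck k D g.
Proof.
move=> oD; elim: k f g => [|k IH] f g fg [df Hf].
all: split=> [x Dx|]; first by
  (apply: near_eq_differentiable (df x Dx); apply: filterS (open_nbhs_nbhs (conj oD Dx)) => y /fg).
- by [].
- by move=> v; apply: IH (Hf v); apply: eq_derive_open.
Qed.

Lemma eq_smooth_on W D (f g : V -> W) : open D -> (forall x, D x -> f x = g x) ->
  smooth_on D f -> smooth_on D g.
Proof. by move=> oD fg /smooth_onP Cf; apply/smooth_onP => k; apply: eq_Ck (Cf k). Qed.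

Lemma smooth_on_local W D (f : V -> W) :
  (forall x, D x -> exists2 D', D' x & smooth_on D' f) -> smooth_on D f.
Proof. by move=> H vs x /H[D' D'x sf]; apply: sf. Qed.

Lemma Ck_cst W k D (a : W) : Ck k D (cst a).
Proof.
elim: k a => [|k IH] a; split=> [x _|].
all: try exact: differentiable_cst; try by [].
move=> v; have -> : 'D_v (cst a) = cst (0 : W) by apply/funext => x; exact: derive_cst.
exact: IH.
Qed.

Lemma CkD W k D (f g : V -> W) : open D -> Ck k D f -> Ck k D g -> Ck k D (f + g).
Proof.
move=> oD; elim: k f g => [|k IH] f g [df Hf] [dg Hg].
all: split=> [x Dx|]; first exact: differentiableD (df x Dx) (dg x Dx).
- by [].
move=> v; apply: eq_Ck (IH _ _ (Hf v) (Hg v)) => // x Dx.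
by rewrite deriveD //; apply: diff_derivable; [apply: df|apply: dg].
Qed.

Lemma Ck_linear W (W' : normedModType R) (L : {linear W -> W'}) k D (f : V -> W) : open D ->
  continuous L -> Ck k D f -> Ck k D (L \o f).
Proof.
move=> oD cL; elim: k f => [|k IH] f [df Hf].
all: have dLf x : D x -> differentiable (L \o f) x
  by move=> Dx; apply: differentiable_comp (df x Dx) _; exact: linear_differentiable.
all: split=> //.
move=> v; apply: eq_Ck (IH _ (Hf v)) => // x Dx.
rewrite [RHS]deriveE; last exact: dLf.
rewrite diff_comp /=; [|exact: df|exact: linear_differentiable].
by rewrite diff_lin //= -deriveE //; exact: df.
Qed.

Lemma CkM k D (f g : V -> R^o) : open D -> Ck k D f -> Ck k D g ->
  Ck k D (fun x => f x * g x : R^o).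
Proof.
move=> oD; elim: k f g => [|k IH] f g Cf Cg.
  by split=> // x Dx; apply: differentiableM; [apply: (Ck_differentiable Cf)|apply: (Ck_differentiable Cg)].
split=> [x Dx|v].
  by apply: differentiableM; [apply: (Ck_differentiable Cf)|apply: (Ck_differentiable Cg)].
have [df Hf] := Cf; have [dg Hg] := Cg.
apply: eq_Ck (CkD oD (IH _ _ (CkS Cf) (Hg v)) (IH _ _ (CkS Cg) (Hf v))) => // x Dx.
rewrite -[LHS]/(f x *: 'D_v g x + g x *: 'D_v f x).
by rewrite -deriveM //; apply: diff_derivable; [apply: df|apply: dg].
Qed.

Lemma Ck_sum W k D (I : Type) (r : seq I) (F : I -> V -> W) : open D ->
  (forall i, Ck k D (F i)) -> Ck k D (fun x => \sum_(i <- r) F i x).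
Proof.
move=> oD H; elim: r => [|i r IH].
  by apply: eq_Ck (Ck_cst k D 0) => // x _; rewrite big_nil.
by apply: eq_Ck (CkD oD (H i) IH) => // x _; rewrite big_cons.
Qed.

Lemma Ck_scalel W k D (h : V -> R^o) (e : W) : open D ->
  Ck k D h -> Ck k D (fun x => h x *: e).
Proof.
move=> oD; elim: k h => [|k IH] h [dh Hh].
all: have dhe x : D x -> differentiable (fun x => h x *: e) x
  by move=> Dx; apply: differentiableZl; exact: dh.
all: split=> //.
move=> v; apply: eq_Ck (IH _ (Hh v)) => // x Dx.
rewrite [RHS]deriveE; last exact: dhe.
by rewrite diffZl /=; [rewrite deriveE //; exact: dh|exact: dh].
Qed.
End SmoothOn.

(** In the derivative of [g \o f] the direction in which [g] is differentiated varies with the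
    point. Expansion over a fixed finite family of vectors, with continuous linear coordinates,
    turns it into a sum of products with fixed directions, to which induction on the order
    applies. *)
Record fdbasis (R : realType) (V : normedModType R) := FdBasis {
  fd_idx : finType;
  fd_vec : fd_idx -> V;
  fd_coord : fd_idx -> {linear V -> R^o};
  fd_cont : forall i, continuous (fd_coord i);
  fd_sum : forall v, v = \sum_i fd_coord i v *: fd_vec i }.

Definition mxcoord (R : realType) (m n : nat) (ij : 'I_m * 'I_n) (M : 'M[R]_(m, n)) : R^o :=
  M ij.1 ij.2.

Lemma mxcoord_is_linear (R : realType) m n ij : linear (@mxcoord R m n ij).
Proof. by move=> a x y; rewrite /mxcoord !mxE. Qed.

HB.instance Definition _ (R : realType) m n ij :=
  GRing.isLinear.Build R 'M[R]_(m, n) R^o _ (@mxcoord R m n ij)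
    (@mxcoord_is_linear R m n ij).

Lemma mxcoord_continuous (R : realType) m n ij : continuous (@mxcoord R m n ij).
Proof. by case: ij => i j; exact: coord_continuous. Qed.

Definition mxbasis (R : realType) (m n : nat) : fdbasis 'M[R]_(m, n).
Proof.
apply: (@FdBasis R _ ('I_m * 'I_n)%type (fun ij => delta_mx ij.1 ij.2) (@mxcoord R m n)).
- exact: mxcoord_continuous.
- by move=> M; rewrite {1}[M]matrix_sum_delta pair_big.
Defined.

Definition pairbasis (R : realType) (V W : normedModType R) (b : fdbasis V) (c : fdbasis W) :
  fdbasis (V * W)%type.
Proof.
pose vec i := match i : fd_idx b + fd_idx c with
  | inl i => (fd_vec i, 0) | inr j => (0, fd_vec j) end : (V * W)%type.
pose crd i := match i : fd_idx b + fd_idx c with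
  | inl i => (fd_coord i \o fst : {linear (V * W)%type -> R^o})
  | inr j => fd_coord j \o snd end.
apply: (@FdBasis R _ (fd_idx b + fd_idx c)%type vec crd).
- case=> i /= x.
    by apply: continuous_comp; [exact: cvg_fst|exact: fd_cont].
  by apply: continuous_comp; [exact: cvg_snd|exact: fd_cont].
- case=> v w; rewrite big_sumType /=.
  rewrite [X in X + _](_ : _ = (v, 0)); last first.
    rewrite {2}(fd_sum b v); elim/big_rec2: _ => // i x y _ ->.
    by apply/pair_equal_spec; split; rewrite //= scaler0 addr0.
  rewrite [X in _ + X](_ : _ = (0, w)); last first.
    rewrite {2}(fd_sum c w); elim/big_rec2: _ => // i x y _ ->.
    by apply/pair_equal_spec; split; rewrite //= scaler0 addr0.
  by apply/pair_equal_spec; rewrite /= addr0 add0r.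
Defined.

Section Composition.
Variables (R : realType) (V : normedModType R).
Implicit Types (W : normedModType R) (D : set V).

Lemma derive_comp_basis W (b : fdbasis W) (f : V -> W) (g : W -> R^o) v x :
  differentiable f x -> differentiable g (f x) ->
  'D_v (g \o f) x = \sum_i fd_coord (f := b) i ('D_v f x) * 'D_(fd_vec i) g (f x).
Proof.
move=> df dg; rewrite [LHS]deriveE; last exact: differentiable_comp.
rewrite diff_comp //= -(deriveE v df) {1}(fd_sum b ('D_v f x)) linear_sum.
by apply: eq_bigr => i _; rewrite linearZ /= -deriveE.
Qed.

Lemma Ck_comp W (b : fdbasis W) k D (D' : set W) (f : V -> W) (g : W -> R^o) : open D ->
  (forall x, D x -> D' (f x)) -> Ck k D f -> Ck k D' g -> Ck k D (g \o f).
Proof.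
move=> oD ff; elim: k g => [|k IH] g Cf Cg.
all: have dgf x : D x -> differentiable (g \o f) x
  by move=> Dx; apply: differentiable_comp (Ck_differentiable Cf Dx) (Ck_differentiable Cg (ff _ Dx)).
all: split=> //.
have [df Hf] := Cf; have [dg Hg] := Cg => v.
apply: (@eq_Ck _ _ _ k D (fun x => \sum_(i : fd_idx b)
    (fd_coord i \o 'D_v f) x * ('D_(fd_vec i) g \o f) x)) => //.
  by move=> x Dx; rewrite (derive_comp_basis b) //; [exact: df|exact/dg/ff].
apply: Ck_sum => // i; apply: CkM => //; last by apply: IH (CkS Cf) (Hg _).
by apply: Ck_linear (Hf v) => //; exact: fd_cont.
Qed.

Lemma smooth_comp W (b : fdbasis W) D (D' : set W) (f : V -> W) (g : W -> R^o) : open D ->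
  (forall x, D x -> D' (f x)) -> smooth_on D f -> smooth_on D' g -> smooth_on D (g \o f).
Proof.
move=> oD ff /smooth_onP Cf /smooth_onP Cg; apply/smooth_onP => k.
exact: (Ck_comp b oD ff (Cf k) (Cg k)).
Qed.

Lemma smooth_linear W (W' : normedModType R) (L : {linear W -> W'}) D (f : V -> W) : open D ->
  continuous L -> smooth_on D f -> smooth_on D (L \o f).
Proof. by move=> oD cL /smooth_onP Cf; apply/smooth_onP => k; apply: Ck_linear. Qed.

Lemma smooth_coordP W (b : fdbasis W) D (f : V -> W) : open D ->
  smooth_on D f <-> forall i, smooth_on D (fd_coord (f := b) i \o f).
Proof.
move=> oD; split=> [sf i|H]; first by apply: smooth_linear => //; exact: fd_cont.
apply: (@eq_smooth_on _ _ _ D (fun x => \sum_(i : fd_idx b) fd_coord i (f x) *: fd_vec i)) => //.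
  by move=> x _; rewrite -(fd_sum b).
apply/smooth_onP => k; apply: Ck_sum => // i; apply: Ck_scalel => //.
by have /smooth_onP := H i; apply.
Qed.

Lemma smooth_mxP m n D (f : V -> 'M[R]_(m, n)) : open D ->
  smooth_on D f <-> forall i j, smooth_on D (fun x => f x i j : R^o).
Proof.
move=> oD; rewrite (smooth_coordP (mxbasis R m n) f oD).
by split=> [H i j|H [i j]]; [exact: (H (i, j))|exact: H].
Qed.

End Composition.

Section SmoothClosure.
Variables (R : realType) (V : normedModType R).
Implicit Types (W : normedModType R) (D : set V).

Lemma smooth_comp_basis W W' (b : fdbasis W) (c : fdbasis W') D (D' : set W)
    (f : V -> W) (g : W -> W') : open D -> open D' ->
  (forall x, D x -> D' (f x)) -> smooth_on D f -> smooth_on D' g -> smooth_on D (g \o f).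
Proof.
move=> oD oD' ff sf /(smooth_coordP c _ oD') sg; apply/(smooth_coordP c _ oD) => i.
exact: (smooth_comp b oD ff sf (sg i)).
Qed.

Lemma smooth_pair W W' D (f : V -> W) (g : V -> W') (b : fdbasis W) (c : fdbasis W') : open D ->
  smooth_on D f -> smooth_on D g -> smooth_on D (fun x => (f x, g x)).
Proof.
move=> oD sf sg; apply/(smooth_coordP (pairbasis b c) _ oD) => -[i|i].
  by apply: (smooth_linear (L := fd_coord i)) => //; exact: fd_cont.
by apply: (smooth_linear (L := fd_coord i)) => //; exact: fd_cont.
Qed.

Lemma smooth_cst W D (a : W) : smooth_on D (cst a).
Proof. by apply/smooth_onP => k; exact: Ck_cst. Qed.

Lemma smooth_id D : open D -> smooth_on D (@id V).
Proof.
move=> oD; apply/smooth_onP => -[|k]; split=> // v.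
have -> : 'D_v (@id V) = cst v by apply/funext => x; exact: derive_id.
exact: Ck_cst.
Qed.

Lemma smoothD W D (f g : V -> W) : open D ->
  smooth_on D f -> smooth_on D g -> smooth_on D (fun x => f x + g x).
Proof. by move=> oD /smooth_onP Cf /smooth_onP Cg; apply/smooth_onP => k; apply: CkD. Qed.

Lemma smoothM D (f g : V -> R^o) : open D ->
  smooth_on D f -> smooth_on D g -> smooth_on D (fun x => f x * g x : R^o).
Proof. by move=> oD /smooth_onP Cf /smooth_onP Cg; apply/smooth_onP => k; apply: CkM. Qed.

Lemma smooth_sum W D (I : Type) (r : seq I) (F : I -> V -> W) : open D ->
  (forall i, smooth_on D (F i)) -> smooth_on D (fun x => \sum_(i <- r) F i x).
Proof.
move=> oD H; apply/smooth_onP => k; apply: Ck_sum => // i.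
by have /smooth_onP := H i; apply.
Qed.
End SmoothClosure.

Lemma dist_halves (R : realFieldType) (a b c e : R) :
  `|a - c| < e / 2 -> `|b - c| < e / 2 -> `|a - b| <= e.
Proof.
move=> ac bc; rewrite -(subrKA c) (le_trans (ler_normD _ _)) // [e in _ <= e]splitr.
by rewrite lerD // ltW // distrC.
Qed.

(** * Symmetry of second derivatives *)

Section Schwarz.
Variables (R : realType) (V : normedModType R).
Implicit Types (f g : V -> R^o) (D : set V).

Lemma is_derive_line g x v (t : R) : differentiable g (x + t *: v) ->
  is_derive t 1 (fun t => g (x + t *: v)) ('D_v g (x + t *: v)).
Proof.
move=> dg.
have E : (fun h : R => h^-1 *: (((fun t => g (x + t *: v)) \o shift t) (h *: (1 : R))
    - g (x + t *: v))) =
    (fun h => h^-1 *: ((g \o shift (x + t *: v)) (h *: v) - g (x + t *: v))).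
  apply/funext => h /=; rewrite [h *: 1]mulr1; congr (_ *: (g _ - _)).
  by rewrite scalerDl addrCA.
by apply: DeriveDef; rewrite /derivable /derive E //; exact: diff_derivable.
Qed.

Lemma MVT_line g x v (h : R) : 0 < h ->
  (forall t, 0 <= t <= h -> differentiable g (x + t *: v)) ->
  exists2 t, 0 <= t <= h & g (x + h *: v) - g x = h * 'D_v g (x + t *: v).
Proof.
move=> h0 dg.
pose phi : R -> R := fun t => g (x + t *: v).
pose dphi : R -> R := fun t => 'D_v g (x + t *: v).
have dl t : t \in `[0, h]%R -> is_derive t (1 : R) phi (dphi t).
  by rewrite in_itv /= => /dg; exact: is_derive_line.
have cphi : {within `[0, h], continuous phi}.
  by apply: derivable_within_continuous => t /dl[].
have [t th e] := MVT h0 (fun t th => dl t (subset_itv_oo_cc th)) cphi.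
exists t; first by have := subset_itv_oo_cc th; rewrite in_itv.
by have := e; rewrite /phi /dphi scale0r addr0 subr0 mulrC.
Qed.

Lemma differentiable_shift f c x : differentiable f (x + c) ->
  differentiable (fun y => f (y + c)) x.
Proof.
by move=> df; apply: (@differentiable_comp _ _ _ _ (fun y => y + c) f x).
Qed.

Lemma derive_shiftE f c v x : 'D_v (fun y => f (y + c)) x = 'D_v f (x + c).
Proof.
rewrite /derive; congr (lim (_ @ 0^')); apply/funext => h /=.
by rewrite addrA.
Qed.

(** The mean value theorem twice: along [u] for the increment [f (y + h *: v) - f y], then along [v]
    for ['D_u f]. *)
Lemma MVT_rectangle D f u v x (h : R) : 0 < h -> smooth_on D f ->
  (forall s t, 0 <= s <= h -> 0 <= t <= h -> D (x + s *: u + t *: v)) ->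
  exists s t, [/\ 0 <= s <= h, 0 <= t <= h &
    f (x + h *: u + h *: v) - f (x + h *: u) - (f (x + h *: v) - f x) =
    h * (h * 'D_v ('D_u f) (x + s *: u + t *: v))].
Proof.
move=> h0 sf HD.
have hh : 0 <= h <= h by rewrite lexx ltW.
have zh : 0 <= (0 : R) <= h by rewrite lexx ltW.
have d1 s : 0 <= s <= h -> differentiable (fun y => f (y + h *: v)) (x + s *: u).
  by move=> sh; apply/differentiable_shift/(smooth_on_differentiable sf)/HD.
have d2 s : 0 <= s <= h -> differentiable f (x + s *: u).
  move=> sh; apply/(smooth_on_differentiable sf).
  by have := HD s 0 sh zh; rewrite scale0r addr0.
have [s sh es] := @MVT_line ((fun y => f (y + h *: v)) - f) x u h h0
  (fun s sh => differentiableB (d1 s sh) (d2 s sh)).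
have [t th et] := @MVT_line ('D_u f) (x + s *: u) v h h0
  (fun t th => smooth_on_differentiable (smooth_on_derive u sf) (HD s t sh th)).
exists s, t; split=> //; rewrite -et.
move: es; rewrite !fctE deriveB; [|exact/diff_derivable/d1|exact/diff_derivable/d2].
by rewrite derive_shiftE.
Qed.

(** The second difference over a small parallelogram is symmetric in [u] and [v], and for either
    order it is [h * h] times a mixed derivative at some point of the parallelogram. The two points
    may differ, so each mixed derivative is compared with its value at [x] by continuity. *)
Lemma schwarz D f u v x : open D -> smooth_on D f -> D x ->
  'D_u ('D_v f) x = 'D_v ('D_u f) x.
Proof.
move=> oD sf Dx.
have rect_eq (a b c d : R^o) : a - b - (c - d) = a - c - (b - d).
  by rewrite !opprB [LHS]addrACA [RHS]addrACA (addrC (- b)).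
have cont a b : {for x, continuous ('D_a ('D_b f))}.
  apply: differentiable_continuous.
  by apply: (smooth_on_differentiable (smooth_on_derive _ (smooth_on_derive _ sf))).
apply/eqP; rewrite -subr_eq0 -normr_le0; apply/ler_addgt0Pl => e e0; rewrite addr0.
have e2 : 0 < e / 2 by rewrite divr_gt0.
have /cvgrPdist_lt/(_ _ e2) A := cont u v.
have /cvgrPdist_lt/(_ _ e2) B := cont v u.
have C := open_nbhs_nbhs (conj oD Dx).
have /(nbhs_ballP x _)[d /= d0 Hd] : nbhs x [set y | (`|'D_u ('D_v f) x - 'D_u ('D_v f) y| < e / 2 /\
    `|'D_v ('D_u f) x - 'D_v ('D_u f) y| < e / 2) /\ D y].
  exact: filterI (filterI A B) C.
(* As [h * k = d / 2], the parallelogram of side [h] stays in the ball of radius [d]; the summand 1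
   keeps [k] positive when [u] and [v] vanish. *)
pose k := `|u| + `|v| + 1.
have k0 : 0 < k by rewrite ltr_wpDl // addr_ge0.
pose h := d / 2 / k.
have h0 : 0 < h by rewrite !divr_gt0.
have near_x s t : 0 <= s <= h -> 0 <= t <= h -> ball x d (x + s *: u + t *: v).
  move=> /andP[s0 sh] /andP[t0 th]; rewrite -ball_normE /ball_ /=.
  rewrite -addrA opprD addrA subrr sub0r normrN.
  apply: (le_lt_trans (ler_normD _ _)); rewrite !normrZ !ger0_norm //.
  apply: (@le_lt_trans _ _ (h * k)).
    rewrite /k !mulrDr mulr1; have := @ler_wpM2r _ `|u| (normr_ge0 _) _ _ sh.
    have := @ler_wpM2r _ `|v| (normr_ge0 _) _ _ th; lra.
  by rewrite /h divfK ?gt_eqF //; lra.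
have HD s t sh th := (Hd _ (near_x s t sh th)).2.
have [s [t [sh th E]]] := MVT_rectangle h0 sf HD.
have near_x' s' t' : 0 <= s' <= h -> 0 <= t' <= h -> ball x d (x + s' *: v + t' *: u).
  by move=> ? ?; rewrite addrAC; exact: near_x.
have HD' s' t' sh' th' := (Hd _ (near_x' s' t' sh' th')).2.
have [s' [t' [sh' th' E']]] := MVT_rectangle h0 sf HD'.
have {E E'} E : 'D_v ('D_u f) (x + s *: u + t *: v) = 'D_u ('D_v f) (x + s' *: v + t' *: u).
  apply: (mulfI (lt0r_neq0 h0)); apply: (mulfI (lt0r_neq0 h0)).
  apply: (etrans (esym E)); apply: (etrans _ E').
  rewrite (addrAC x (h *: v)).
  exact: rect_eq.
have [[_ P] _] := Hd _ (near_x s t sh th).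
have [[Q _] _] := Hd _ (near_x' s' t' sh' th').
rewrite E in P; exact: dist_halves Q P.
Qed.
End Schwarz.

(** * The ring of smooth functions on an open set *)

Record openset (V : topologicalType) := OpenSet { os_set :> set V; os_open : open os_set }.

Section SmoothFunctionRing.
Variables (R : realType) (n : nat) (O : openset 'rV[R]_n).

(* Smooth functions on [O], extended by [0] so that equality on [O] is equality. *)
Record sfun := SFun {
  sf_val :> 'rV[R]_n -> R^o;
  sf_smooth : smooth_on O sf_val;
  sf_off : forall x, ~ os_set O x -> sf_val x = 0 }.

Lemma sfun_eq (f g : sfun) : (forall x, os_set O x -> f x = g x) -> f = g.
Proof.
move=> fg; have e : sf_val f = sf_val g.
  apply/funext => x; have [Ox|nOx] := pselect (os_set O x); first exact: fg.
  by rewrite !sf_off.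
case: f g e fg => f sf of_ [g sg og] /= e _; case: _ / e sg og => sg og.
by congr SFun; exact: Prop_irrelevance.
Qed.

Definition cutoff (f : 'rV[R]_n -> R^o) x : R^o := if `[< os_set O x >] then f x else 0.

Lemma cutoffE f x : os_set O x -> cutoff f x = f x.
Proof. by move=> Ox; rewrite /cutoff asboolT. Qed.

Lemma cutoff_smooth f : smooth_on O f -> smooth_on O (cutoff f).
Proof. by apply: eq_smooth_on (os_open O) _ => x Ox; rewrite cutoffE. Qed.

Lemma cutoff_off f x : ~ os_set O x -> cutoff f x = 0.
Proof. by move=> nOx; rewrite /cutoff asboolF. Qed.

Definition mksfun f (sf : smooth_on O f) : sfun := SFun (cutoff_smooth sf) (@cutoff_off f).

Lemma mksfunE f (sf : smooth_on O f) x : os_set O x -> mksfun sf x = f x.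
Proof. exact: cutoffE. Qed.

HB.instance Definition _ := gen_eqMixin sfun.
HB.instance Definition _ := gen_choiceMixin sfun.

Definition sfun_cst (c : R) : sfun := mksfun (@smooth_cst R _ _ O (c : R^o)).
Definition sfun_add (f g : sfun) : sfun :=
  mksfun (smoothD (os_open O) (sf_smooth f) (sf_smooth g)).
Definition sfun_mul (f g : sfun) : sfun :=
  mksfun (smoothM (os_open O) (sf_smooth f) (sf_smooth g)).
Definition sfun_opp (f : sfun) : sfun := sfun_mul (sfun_cst (-1)) f.

Lemma sfun_addA : associative sfun_add.
Proof. by move=> f g h; apply: sfun_eq => x Ox; rewrite !mksfunE // addrA. Qed.
Lemma sfun_addC : commutative sfun_add.
Proof. by move=> f g; apply: sfun_eq => x Ox; rewrite !mksfunE // addrC. Qed.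
Lemma sfun_add0 : left_id (sfun_cst 0) sfun_add.
Proof. by move=> f; apply: sfun_eq => x Ox; rewrite !mksfunE // add0r. Qed.
Lemma sfun_addN : left_inverse (sfun_cst 0) sfun_opp sfun_add.
Proof. by move=> f; apply: sfun_eq => x Ox; rewrite !mksfunE //= mulN1r addNr. Qed.
HB.instance Definition _ := GRing.isZmodule.Build sfun
  sfun_addA sfun_addC sfun_add0 sfun_addN.

Lemma sfun_mulA : associative sfun_mul.
Proof. by move=> f g h; apply: sfun_eq => x Ox; rewrite !mksfunE // mulrA. Qed.
Lemma sfun_mulC : commutative sfun_mul.
Proof. by move=> f g; apply: sfun_eq => x Ox; rewrite !mksfunE // mulrC. Qed.
Lemma sfun_mul1 : left_id (sfun_cst 1) sfun_mul.
Proof. by move=> f; apply: sfun_eq => x Ox; rewrite !mksfunE // mul1r. Qed.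
Lemma sfun_mulD : left_distributive sfun_mul sfun_add.
Proof. by move=> f g h; apply: sfun_eq => x Ox; rewrite !mksfunE // mulrDl. Qed.
HB.instance Definition _ := GRing.Zmodule_isComPzRing.Build sfun
  sfun_mulA sfun_mulC sfun_mul1 sfun_mulD.

Implicit Types f g : sfun.

Lemma sfunDE f g x : os_set O x -> (f + g) x = f x + g x. Proof. exact: mksfunE. Qed.
Lemma sfunME f g x : os_set O x -> (f * g) x = f x * g x. Proof. exact: mksfunE. Qed.
Lemma sfun0E x : (0 : sfun) x = 0. Proof. by rewrite /= /cutoff; case: ifP. Qed.
Lemma sfun1E x : os_set O x -> (1 : sfun) x = 1. Proof. exact: mksfunE. Qed.
Lemma sfunNE f x : os_set O x -> (- f) x = - f x.
Proof. by move=> Ox; rewrite -[RHS]mulN1r [LHS]mksfunE // mksfunE. Qed.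

Lemma sfun_sumE x (I : Type) (r : seq I) (Q : pred I) (F : I -> sfun) : os_set O x ->
  (\sum_(i <- r | Q i) F i) x = \sum_(i <- r | Q i) F i x.
Proof.
move=> Ox; elim/big_rec2: _ => [|i a b _ <-]; first by rewrite sfun0E.
exact: sfunDE.
Qed.

Lemma sfun_tsumE x m k (F : seq 'I_m -> sfun) : os_set O x ->
  tsum k F x = tsum k (fun S => F S x).
Proof.
move=> Ox; elim: k F => [|k IH] F //=; rewrite sfun_sumE //.
by apply: eq_bigr => l _; exact: IH.
Qed.

Definition dvec (l : 'I_n) : 'rV[R]_n := delta_mx 0 l.

Definition sfun_der (l : 'I_n) f : sfun := mksfun (smooth_on_derive (dvec l) (sf_smooth f)).

Lemma sfun_derE l f x : os_set O x -> sfun_der l f x = 'D_(dvec l) f x.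
Proof. exact: mksfunE. Qed.

Lemma derive_eqO l (f : 'rV[R]_n -> R^o) (g : 'rV[R]_n -> R^o) x :
  (forall x, os_set O x -> f x = g x) -> os_set O x -> 'D_(dvec l) f x = 'D_(dvec l) g x.
Proof. by move=> fg; apply: eq_derive_open (os_open O) fg _. Qed.

Lemma sfun_derivable l f x : os_set O x -> derivable f x (dvec l).
Proof. by move=> Ox; apply/diff_derivable/(smooth_on_differentiable (sf_smooth f)). Qed.

Lemma sfun_derD l : {morph sfun_der l : f g / f + g}.
Proof.
move=> f g; apply: sfun_eq => x Ox; rewrite sfunDE // !sfun_derE //.
rewrite -deriveD; [|exact: sfun_derivable|exact: sfun_derivable].
by apply: derive_eqO => // y Oy; rewrite sfunDE.
Qed.

Lemma sfun_derM l f g : sfun_der l (f * g) = sfun_der l f * g + f * sfun_der l g.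
Proof.
apply: sfun_eq => x Ox; rewrite sfunDE // !sfunME // !sfun_derE //.
rewrite addrC (mulrC _ (g x)) -[RHS]/(f x *: 'D_(dvec l) g x + g x *: 'D_(dvec l) f x).
rewrite -deriveM; [|exact: sfun_derivable|exact: sfun_derivable].
by apply: derive_eqO => // y Oy; rewrite sfunME.
Qed.

Lemma sfun_derC k l f : sfun_der k (sfun_der l f) = sfun_der l (sfun_der k f).
Proof.
apply: sfun_eq => x Ox.
apply: (etrans (sfun_derE k (sfun_der l f) Ox)); apply: (etrans _ (esym (sfun_derE l (sfun_der k f) Ox))).
have e1 := derive_eqO k (fun y Oy => sfun_derE l f (x := y) Oy) Ox.
have e2 := derive_eqO l (fun y Oy => sfun_derE k f (x := y) Oy) Ox.
apply: (etrans e1); apply: (etrans _ (esym e2)).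
exact: (schwarz _ _ (os_open O) (sf_smooth f) Ox).
Qed.

Definition sfun_cderiv : cderiv sfun n := CDeriv sfun_derD sfun_derM sfun_derC.
Local Notation d := sfun_cderiv.

Lemma eq_pders S (f g : 'rV[R]_n -> R^o) :
  (forall x, os_set O x -> f x = g x) -> forall x, os_set O x -> pders S f x = pders S g x.
Proof.
by move=> fg; elim: S => [|l S IH] x Ox /=; [exact: fg|exact: derive_eqO].
Qed.

Lemma sfun_dersE S f x : os_set O x -> ders d S f x = pders S f x.
Proof.
elim: S x => [|l S IH] x Ox //=.
by rewrite [LHS]sfun_derE //; apply: derive_eqO => // y; exact: IH.
Qed.

Lemma sfun_der_cst l c : d l (sfun_cst c) = 0.
Proof.
apply: sfun_eq => x Ox; rewrite [LHS]sfun_derE // sfun0E -[RHS](derive_cst (c : R^o) x (dvec l)).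
by apply: derive_eqO => // y; exact: mksfunE.
Qed.
End SmoothFunctionRing.

Arguments der : simpl never.

Lemma smooth_on_pders (R : realType) n (O : set 'rV[R]_n) S (f : 'rV[R]_n -> R^o) :
  smooth_on O f -> smooth_on O (pders S f).
Proof. by move=> sf; elim: S => //= l S; exact: smooth_on_derive. Qed.

Lemma perm_pders (R : realType) n (O : openset 'rV[R]_n) S T (f : 'rV[R]_n -> R^o) x :
  smooth_on O f -> os_set O x -> perm_eq S T -> pders S f x = pders T f x.
Proof.
move=> sf Ox ST.
have e U : pders U f x = ders (sfun_cderiv O) U (mksfun sf) x.
  by rewrite sfun_dersE //; apply: (@eq_pders _ _ O) => // y Oy; rewrite mksfunE.
by rewrite !e (perm_ders _ _ ST).
Qed.

(** * Multi-indices and polynomials with prescribed jets *)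

Section MultiIndices.
Variable n : nat.
Implicit Types (S T : seq 'I_n) (al : mindex n).

Lemma mindex_of_perm S T : (mindex_of S == mindex_of T) = perm_eq S T.
Proof.
apply/eqP/idP => [/ffunP e|/permP e]; last by apply/ffunP => i; rewrite !ffunE e.
by rewrite /perm_eq; apply/allP => i _ /=; have := e i; rewrite !ffunE => ->.
Qed.

Lemma mindex_seqK al : mindex_of (mindex_seq al) = al.
Proof.
apply/ffunP => i; rewrite ffunE /mindex_seq count_flatten -map_comp sumnE big_map.
rewrite big_enum /= (bigD1 i) //= count_nseq /= eqxx mul1n big1 ?addn0 // => j /negPf ji.
by rewrite count_nseq /= ji mul0n.
Qed.

Lemma mindex_of_cons l S : mindex_of (l :: S) = mindex_incr l (mindex_of S).
Proof. by apply/ffunP => i; rewrite !ffunE /= eq_sym. Qed.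

Lemma mindex_incr_inj l : injective (@mindex_incr n l).
Proof. by move=> a b /ffunP e; apply/ffunP => i; have := e i; rewrite !ffunE => /addnI. Qed.
End MultiIndices.

Lemma derive_linear (R : realType) (V W : normedModType R) (L : {linear V -> W}) x v :
  continuous L -> 'D_v L x = L v.
Proof. by move=> cL; rewrite deriveE ?diff_lin //; exact: linear_differentiable. Qed.

Section PolynomialJets.
Variables (R : realType) (n : nat) (x0 : 'rV[R]_n).
Let OT : openset 'rV[R]_n := OpenSet openT.
Local Notation A := (sfun OT).
Local Notation d := (sfun_cderiv OT).
Let OTx x : os_set OT x. Proof. by []. Qed.

Lemma smooth_coord (O : openset 'rV[R]_n) i : smooth_on O (fun x : 'rV[R]_n => x 0 i : R^o).
Proof.
have /(smooth_mxP _ (os_open O)) := smooth_id (os_open O); exact.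
Qed.

Let X (i : 'I_n) : A := mksfun (@smooth_coord OT i) - sfun_cst OT (x0 0 i).
Let cst : R -> A := @sfun_cst R n OT.

Let XE i : X i x0 = 0.
Proof. by rewrite sfunDE // sfunNE // !mksfunE // subrr. Qed.

Let dX l i : d l (X i) = (l == i)%:R.
Proof.
rewrite derD derN [d l (sfun_cst _ _)]sfun_der_cst subr0; apply: sfun_eq => x _.
apply: (etrans (sfun_derE l _ (OTx x))).
apply: (etrans (derive_eqO (O := OT) l (g := mxcoord (0, i)) (x := x) _ (OTx x))).
  by move=> y _; rewrite mksfunE.
rewrite derive_linear; last exact: mxcoord_continuous.
rewrite -[LHS]/((delta_mx 0 l : 'rV[R]_n) 0 i) mxE eqxx /= eq_sym.
by case: eqP => _; rewrite ?sfun1E ?sfun0E.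
Qed.

(** The divided power [(x_i - x0_i)^k / k!]: differentiation lowers [k] without a factor, so the
    derivatives at [x0] of products of these are 0 or 1. *)
Let pw i k : A := cst (k`!%:R)^-1 * X i ^+ k.

Let dXn l i k : d l (X i ^+ k) = (l == i)%:R * (X i ^+ k.-1 *+ k).
Proof.
elim: k => [|k IH]; first by rewrite expr0 der1 mulr0n mulr0.
rewrite exprS derM IH dX mulrCA -mulrDr /= mulrSr; congr (_ * _).
rewrite addrC; congr (_ + _).
by case: k {IH} => [|k]; rewrite ?mulr0n ?mulr0 // mulrnAr -exprS.
Qed.

Let cstM a b : cst a * cst b = cst (a * b).
Proof. by apply: sfun_eq => x Ox; rewrite sfunME // !mksfunE. Qed.

Let cstn k : k%:R = cst k%:R.
Proof.
elim: k => [|k IH]; first by [].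
rewrite -natr1 IH; apply: sfun_eq => x Ox.
by rewrite sfunDE // sfun1E // !mksfunE // -natr1.
Qed.

Let dpw l i k : d l (pw i k) = if (l == i) && (0 < k)%N then pw i k.-1 else 0.
Proof.
rewrite derM [d l (cst _)]sfun_der_cst mul0r add0r dXn.
case: eqP => _; rewrite ?mul0r ?mulr0 //= mul1r.
case: k => [|k] /=; first by rewrite mulr0n mulr0.
rewrite -[X in _ * X]mulr_natl mulrA cstn cstM; congr (cst _ * _).
by rewrite factS natrM invfM mulrAC mulVf ?mul1r // pnatr_eq0.
Qed.

Let mono (al : mindex n) : A := \prod_i pw i (al i).

Let dmono l al : d l (mono (mindex_incr l al)) = mono al.
Proof.
rewrite der_prod (bigD1 l) //= [X in _ + X]big1 ?addr0; last first.
  by move=> i /negPf il; rewrite dpw eq_sym il mul0r.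
rewrite dpw eqxx /= ffunE eqxx add1n /= /mono [RHS](bigD1 l) //=; congr (_ * _).
by apply: eq_bigr => j /negPf jl; rewrite ffunE jl.
Qed.

Let dmono0 l (al : mindex n) : al l = 0%N -> d l (mono al) = 0.
Proof.
move=> al0; rewrite der_prod big1 // => i _; rewrite dpw.
by case: eqP => [<-|]; rewrite ?al0 mul0r.
Qed.

Let mono_x0 al : mono al x0 = (al == [ffun=> 0%N])%:R.
Proof.
rewrite /mono (big_morph (fun f : A => f x0) (fun f g => sfunME f g (OTx x0)) (sfun1E (OTx x0))).
have pwx i k : pw i k x0 = (k == 0%N)%:R.
  rewrite sfunME // mksfunE //; case: k => [|k]; first by rewrite fact0 invr1 expr0 sfun1E // mulr1.
  by rewrite exprS sfunME // XE mul0r mulr0.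
under eq_bigr do rewrite pwx.
case: eqP => [->|/eqP al0]; first by rewrite big1 // => i _; rewrite ffunE.
have [i ali] : exists i, al i != 0%N.
  apply/existsP; apply: contraNT al0; rewrite negb_exists => /forallP H.
  by apply/eqP/ffunP => i; rewrite ffunE; apply/eqP; have := H i; rewrite negbK.
by rewrite (bigD1 i) //= (negPf ali) mul0r.
Qed.

Let ders_mono S (al : mindex n) : ders d S (mono al) x0 = (mindex_of S == al)%:R.
Proof.
elim/last_ind: S al => [|S l IH] al.
  have -> : mindex_of [::] = [ffun=> 0%N] :> mindex n by apply/ffunP => i; rewrite !ffunE.
  by rewrite /= mono_x0 eq_sym.
rewrite -cats1 ders_cat /=.
have e : mindex_of (S ++ [:: l]) = mindex_incr l (mindex_of S).
  by rewrite -mindex_of_cons; apply/eqP; rewrite mindex_of_perm perm_catC.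
have [al0|al0] := posnP (al l).
  rewrite dmono0 // ders0 sfun0E; case: eqP => // eal.
  by move: al0; rewrite -eal e ffunE eqxx.
pose be : mindex n := [ffun i => (al i - (i == l))%N].
have albe : al = mindex_incr l be.
  by apply/ffunP => i; rewrite !ffunE; case: eqP => [->|_]; rewrite ?subn0 // subnKC.
by rewrite e albe dmono IH (inj_eq (@mindex_incr_inj n l)).
Qed.

(** The witness is the Taylor polynomial with the prescribed derivatives. *)
Lemma exists_jet (N : nat) (z : mindex n -> R) :
  exists2 f : 'rV[R]_n -> R^o, smooth_on setT f &
    forall S, (size S <= N)%N -> pders S f x0 = z (mindex_of S).
Proof.
(* The exponents run over the finite box with entries at most [N], which contains all multi-indices
   of length at most [N]. *)
pose vals (b : {ffun 'I_n -> 'I_N.+1}) : mindex n := [ffun i => val (b i)].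
pose f : A := \sum_b cst (z (vals b)) * mono (vals b).
exists f; first exact: (sf_smooth f).
move=> S sS; rewrite -(sfun_dersE (O := OT)) // ders_sum sfun_sumE //.
pose b0 : {ffun 'I_n -> 'I_N.+1} := [ffun i => inord (mindex_of S i)].
have b0E : vals b0 = mindex_of S.
  apply/ffunP => i; rewrite [LHS]ffunE [b0 i]ffunE [LHS]inordK // ffunE ltnS.
  by apply: leq_trans sS; exact: count_size.
have t b : ders d S (cst (z (vals b)) * mono (vals b)) x0 = (mindex_of S == vals b)%:R * z (vals b).
  have -> : ders d S (cst (z (vals b)) * mono (vals b)) = cst (z (vals b)) * ders d S (mono (vals b)).
    elim: (S) => //= l S' ->; rewrite derM [d l (cst _)]sfun_der_cst mul0r add0r //.
  by rewrite sfunME // ders_mono mksfunE // mulrC.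
under eq_bigr do rewrite t.
rewrite (bigD1 b0) //= b0E eqxx mul1r big1 ?addr0 // => b bb0.
case: eqP => [e|_]; last by rewrite mul0r.
case/eqP: bb0; apply/ffunP => i; apply/val_inj.
by have /ffunP/(_ i) := b0E; rewrite e !ffunE => ->.
Qed.
End PolynomialJets.

(** At each point [x0] the operator is applied to a polynomial whose derivative at [x0] is 1 for the
    multi-index of [S] and 0 for all others, up to the largest order that occurs in [s]. *)
Lemma sfun_separated (R : realType) n (O : openset 'rV[R]_n) : op_separated (sfun_cderiv O).
Proof.
move=> s H S; apply: sfun_eq => x0 Ox; rewrite sfun0E sfun_sumE //.
pose N := (\max_(x <- s) size x.2)%N.
have [f sf fE] := exists_jet x0 N (fun al => (mindex_of S == al)%:R).
have sfO : smooth_on O f by apply: smooth_on_sub sf.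
transitivity (op_act (sfun_cderiv O) s (mksfun sfO) x0); last by rewrite H sfun0E.
rewrite /op_act sfun_sumE //.
rewrite [LHS]big_mkcond [LHS]big_seq [RHS]big_seq; apply: eq_bigr => x xs.
rewrite sfunME // sfun_dersE //.
rewrite (@eq_pders _ _ O x.2 _ f) //; last by move=> y Oy; rewrite mksfunE.
rewrite fE; last by rewrite /N (big_rem x) //= leq_maxl.
by rewrite mindex_of_perm; case: ifP => _; rewrite ?mulr1 ?mulr0.
Qed.

(** * Functions on jet spaces *)

Section JetIndices.
Variables n k : nat.

Definition kidx (j : 'I_#|kindex n k|) : mindex n :=
  [ffun l => val (val (enum_val j : kindex n k) l)].

Lemma kidx_inj : injective kidx.
Proof.
move=> i j /ffunP e; apply: enum_val_inj; apply: val_inj; apply/ffunP => l; apply: val_inj.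
by have := e l; rewrite !ffunE.
Qed.

Lemma kidx_le j : (\sum_l kidx j l <= k)%N.
Proof.
by apply: leq_trans (valP (enum_val j)); apply: eq_leq; apply: eq_bigr => l _; rewrite ffunE.
Qed.

Lemma kidx_surj (al : mindex n) : (\sum_l al l <= k)%N -> exists j, kidx j = al.
Proof.
move=> Hal; have lt l : (al l < k.+1)%N.
  by rewrite ltnS (leq_trans _ Hal) // (bigD1 l) //= leq_addr.
pose b : {ffun 'I_n -> 'I_k.+1} := [ffun l => Ordinal (lt l)].
have Hb : (\sum_l b l <= k)%N.
  by apply: leq_trans Hal; apply: eq_leq; apply: eq_bigr => l _; rewrite ffunE.
exists (enum_rank (exist _ b Hb : kindex n k)).
by apply/ffunP => l; rewrite ffunE enum_rankK /= ffunE.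
Qed.

Lemma kidx_surj0 : exists j, kidx j = [ffun=> 0%N].
Proof. by apply: kidx_surj; rewrite big1 // => l _; rewrite ffunE. Qed.

Definition jidx0 := projT1 (cid kidx_surj0).
(** Inverse of [kidx] on multi-indices of length at most [k]; on longer ones the value [jidx0] is
    junk. *)
Definition jidx (al : mindex n) := odflt jidx0 [pick j | kidx j == al].

Lemma jidxK (al : mindex n) : (\sum_l al l <= k)%N -> kidx (jidx al) = al.
Proof.
move=> /kidx_surj[j <-]; rewrite /jidx; case: pickP => [i /eqP//|/(_ j)].
by rewrite eqxx.
Qed.

Lemma kidx0 : kidx jidx0 = [ffun=> 0%N].
Proof. exact: (projT2 (cid kidx_surj0)). Qed.
End JetIndices.

Lemma mindex_incr_sum n l (al : mindex n) :
  (\sum_i mindex_incr l al i = (\sum_i al i).+1)%N.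
Proof.
under eq_bigr do rewrite ffunE.
rewrite big_split /= (bigD1 l) //= eqxx big1 ?addn0 // => i /negPf -> //.
Qed.

Lemma mindex_of_sum n (S : seq 'I_n) : (\sum_i mindex_of S i = size S)%N.
Proof.
elim: S => [|l S IH]; first by rewrite big1 // => i _; rewrite ffunE.
by rewrite mindex_of_cons mindex_incr_sum IH.
Qed.

Lemma smooth_lin (R : realType) (V W : normedModType R) (L : {linear V -> W}) (O : set V) :
  open O -> continuous L -> smooth_on O L.
Proof. by move=> oO cL; apply: (smooth_linear oO cL (smooth_id oO)). Qed.

Lemma congr_lim_near (R : realType) (V : normedModType R) (F : set_system R) (FF : Filter F)
    (f g : R -> V) : (\forall h \near F, f h = g h) -> lim (f @ F) = lim (g @ F).
Proof.
move=> fg; congr (lim _); apply/seteqP; split; apply: near_eq_cvg.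
  by apply: filterS fg => h.
by apply: filterS fg => h ->.
Qed.

(* [c] enumerates the fiber coordinates [K], so that jets of [Y] (with [K] = 'I_p)
   and of bundles over [Y] (with [K] = 'I_p + 'I_w) are treated alike. *)
Section Jets.
Variables (R : realType) (n p : nat) (K : finType) (c : 'I_p -> K).
Hypothesis c_bij : bijective c.
Variable D : openset ('rV[R]_n * 'rV[R]_p)%type.
Implicit Types (f : jet R n K -> R) (z : jet R n K).

Definition jover : set (jet R n K) :=
  [set z | os_set D (z.1, \row_i z.2 (c i) [ffun=> 0%N])].

Definition jtrunc k z : 'rV[R]_n * 'M[R]_(p, #|kindex n k|) :=
  (z.1, \matrix_(i, j) z.2 (c i) (kidx j)).

(** Describes the truncations of [jover] by a condition on the order-zero coordinates, which makes
    openness visible; [jdom_image] identifies the two sets. *)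
Definition jdom k : set ('rV[R]_n * 'M[R]_(p, #|kindex n k|)) :=
  [set w : 'rV[R]_n * 'M[R]_(p, #|kindex n k|) | os_set D (w.1, \row_i w.2 i (jidx0 n k))].

Arguments jdom : clear implicits.

Lemma jtrunc_jdom k z : jdom k (jtrunc k z) <-> jover z.
Proof.
rewrite /jdom /jover /=; suff -> : \row_i (\matrix_(i, j) z.2 (c i) (kidx j)) i (jidx0 n k) =
  \row_i z.2 (c i) [ffun=> 0%N] by [].
by apply/rowP => i; rewrite !mxE kidx0.
Qed.

Lemma jdom_image k : jtrunc k @` jover = jdom k.
Proof.
apply/seteqP; split=> [w [z jz <-]|w Dw]; first exact/jtrunc_jdom.
have [d dK cK] := c_bij.
(* Coordinates of order above [k] are unconstrained; [jidx] fills them arbitrarily. *)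
pose z : jet R n K := (w.1, fun i al => w.2 (d i) (jidx k al)).
have zw : jtrunc k z = w.
  apply: injective_projections => //=; apply/matrixP => i j; rewrite mxE dK.
  by congr (w.2 _ _); apply: kidx_inj; apply: jidxK; exact: kidx_le.
by exists z => //; apply/(jtrunc_jdom k); rewrite zw.
Qed.

Definition jbasis k : fdbasis ('rV[R]_n * 'M[R]_(p, #|kindex n k|))%type :=
  pairbasis (mxbasis R 1 n) (mxbasis R p #|kindex n k|).

Lemma smooth_jfst k (O : set ('rV[R]_n * 'M[R]_(p, #|kindex n k|))) : open O ->
  smooth_on O (fun w => w.1).
Proof. by move=> oO; apply: (smooth_lin (L := fst)) => // x; exact: cvg_fst. Qed.

Lemma smooth_jsnd k (O : set ('rV[R]_n * 'M[R]_(p, #|kindex n k|))) i j : open O ->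
  smooth_on O (fun w => w.2 i j : R^o).
Proof.
move=> oO; apply: (smooth_lin (L := mxcoord (i, j) \o snd)) => // x.
by apply: continuous_comp; [exact: cvg_snd|exact: mxcoord_continuous].
Qed.

Lemma jdom_open k : open (jdom k).
Proof.
apply: (@open_comp _ _ (fun w : 'rV[R]_n * 'M[R]_(p, #|kindex n k|) =>
   (w.1, \row_i w.2 i (jidx0 n k)))); last exact: os_open.
move=> w _; apply: differentiable_continuous.
apply: (@smooth_on_differentiable R _ _ setT) => //.
apply: (smooth_pair (mxbasis R 1 n) (mxbasis R 1 p) openT (smooth_jfst openT)).
apply/(smooth_mxP _ openT) => a i; apply: (eq_smooth_on openT _ (smooth_jsnd i (jidx0 n k) openT)) => x _.
by rewrite mxE.
Qed.

(** [jet_smooth] with the representative as an argument: derivatives of [f] in jet coordinates are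
    derivatives of [g], and two functions that agree only over [D] can share one [g]. *)
Definition jrep k f (g : 'rV[R]_n * 'M[R]_(p, #|kindex n k|) -> R^o) :=
  smooth_on (jdom k) g /\ forall z, jover z -> f z = g (jtrunc k z).

Definition dx k (l : 'I_n) : 'rV[R]_n * 'M[R]_(p, #|kindex n k|) := (dvec R l, 0).
Definition du k (i : 'I_p) (j : 'I_#|kindex n k|) : 'rV[R]_n * 'M[R]_(p, #|kindex n k|) :=
  (0, delta_mx i j).

Lemma jtrunc_near k z : jover z -> forall v : 'rV[R]_n * 'M[R]_(p, #|kindex n k|),
  \forall t \near (0 : R), jdom k (t *: v + jtrunc k z).
Proof.
move=> jz v.
have cl : {for 0, continuous (fun t : R => t *: v + jtrunc k z)}.
  apply: continuousD; last exact: cst_continuous.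
  exact: scalel_continuous.
have nb : nbhs ((fun t : R => t *: v + jtrunc k z) 0) (jdom k).
  rewrite scale0r add0r; apply: open_nbhs_nbhs; split; first exact: jdom_open.
  exact/jtrunc_jdom.
exact: cl nb.
Qed.

Lemma dbaseE k f g l z : jrep f g -> jover z ->
  dbase l f z = 'D_(dx k l) g (jtrunc k z).
Proof.
move=> [sg fg] jz; rewrite /dbase.
pose G : 'rV[R]_n -> R^o := fun x => g (x, (jtrunc k z).2).
transitivity ('D_(dvec R l) G z.1); last first.
  rewrite /derive; congr (lim (_ @ 0^')); apply/funext => h /=.
  congr (_ *: (g _ - g _)).
  by apply: injective_projections => //=; rewrite scaler0 add0r.
apply: near_eq_derive.
have oG : open [set x | jover (x, z.2)].
  apply: (@open_comp _ _ (fun x : 'rV[R]_n => (x, \row_i z.2 (c i) [ffun=> 0%N]))); last exact: os_open.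
  move=> x _; apply: differentiable_continuous.
  by apply: differentiable_pair; [exact: (smooth_on_differentiable (smooth_id openT))|exact: differentiable_cst].
have jz' : [set x | jover (x, z.2)] z.1 by case: (z) jz.
by apply: filterS (open_nbhs_nbhs (conj oG jz')) => x jx; rewrite fg.
Qed.

(** The jet with one coordinate varied truncates to [jtrunc k z] displaced along [du i j], and it
    stays over [D] for small displacements. *)
Lemma djetE k f g i j z : jrep f g -> jover z ->
  djet (c i) (kidx j) f z = 'D_(du i j) g (jtrunc k z).
Proof.
move=> [sg fg] jz; rewrite /djet /derive1 /derive.
pose Z t : jet R n K := (z.1, fun i' be =>
  if (i' == c i) && (be == kidx j) then t else z.2 i' be).
have ZE h : jtrunc k (Z (h + z.2 (c i) (kidx j))) = h *: du i j + jtrunc k z.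
  apply: injective_projections; first by rewrite /= scaler0 add0r.
  apply/matrixP => a b; rewrite !mxE /=.
  rewrite (inj_eq (bij_inj c_bij)) (inj_eq (@kidx_inj n k)).
  case: ifP => [/andP[/eqP-> /eqP->]|ab]; first by rewrite ?eqxx mulr1.
  by rewrite ?ab mulr0 add0r.
have Z0 : f (Z (z.2 (c i) (kidx j))) = g (jtrunc k z).
  have := ZE 0; rewrite add0r scale0r add0r => e.
  by rewrite fg ?e //; apply/(jtrunc_jdom k); rewrite e; apply/jtrunc_jdom.
apply: congr_lim_near.
near=> h; rewrite -/(Z _) -/(Z _) Z0; congr (_ *: (_ - _)).
rewrite fg ?ZE //; apply/(jtrunc_jdom k); rewrite ZE.
near: h; apply: nbhs_dnbhs; exact: jtrunc_near.
Unshelve. all: by end_near. Qed.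

(** Truncation to order [k] does not see the coordinate [al], so [f] is constant along it. This
    makes the sum over all multi-indices in [dtot] finite. *)
Lemma djet0 (k : nat) f g i (al : mindex n) z : @jrep k f g -> jover z ->
  (forall j : 'I_#|kindex n k|, kidx j != al) ->
  djet (c i) al f z = 0.
Proof.
move=> [sg fg] jz Hal; rewrite /djet.
pose Z t : jet R n K := (z.1, fun i' be =>
  if (i' == c i) && (be == al) then t else z.2 i' be).
have ZE t : jtrunc k (Z t) = jtrunc k z.
  apply: injective_projections => //; apply/matrixP => a b; rewrite !mxE /=.
  by rewrite (negPf (Hal b)) andbF.
have E : (fun t => f (Z t) : R^o) = cst (f z).
  apply/funext => t; rewrite /= !fg // ?ZE //.
  by apply/(jtrunc_jdom k); rewrite ZE; apply/jtrunc_jdom.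
by rewrite -[X in derive1 X]/(fun t => f (Z t) : R^o) E derive1_cst.
Qed.

Lemma dtotE k f g l z : jrep f g -> jover z ->
  dtot l f z = 'D_(dx k l) g (jtrunc k z) +
    \sum_i \sum_j z.2 (c i) (mindex_incr l (kidx j)) * 'D_(du i j) g (jtrunc k z).
Proof.
move=> fg jz; rewrite /dtot (dbaseE l fg jz); congr (_ + _).
rewrite (reindex c) /=; last exact: onW_bij.
apply: eq_bigr => i _.
rewrite (fsbigE [seq kidx j | j : 'I_#|kindex n k|]) //=.
- rewrite big_map big_mkcond big_enum /=; apply: eq_bigr => j _; rewrite in_setT.
  by rewrite (djetE i j fg jz).
- by rewrite map_inj_uniq ?enum_uniq //; exact: kidx_inj.
- move=> al _ alN; rewrite (djet0 i fg jz) ?mulr0 // => j.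
  by apply: contraNneq alN => <-; apply/mapP; exists j => //; rewrite mem_enum.
Qed.
End Jets.

Lemma derive_linear_comp (R : realType) (U V W : normedModType R) (L : {linear V -> W})
    (h : U -> V) x v :
  continuous L -> differentiable h x -> 'D_v (L \o h) x = L ('D_v h x).
Proof.
move=> cL dh.
have dL : differentiable L (h x) by exact: linear_differentiable.
rewrite deriveE; last exact: differentiable_comp.
by rewrite diff_comp // diff_lin //= -deriveE.
Qed.

Section JetCalculus.
Variables (R : realType) (n p : nat) (K : finType) (c : 'I_p -> K).
Hypothesis c_bij : bijective c.
Variable D : openset ('rV[R]_n * 'rV[R]_p)%type.
Implicit Types (f : jet R n K -> R) (z : jet R n K).
Local Notation jspc k := ('rV[R]_n * 'M[R]_(p, #|kindex n k|))%type.
Local Notation jover := (jover c D).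
Local Notation jtrunc := (jtrunc c).
Local Notation jdm k := (@jdom R n p D k).
Local Notation jrep := (jrep c D).

(** The projection from jets of order [k'] to jets of order [k]; composition with it raises the
    order of a representative. *)
Definition jraise k k' (w : jspc k') : jspc k :=
  (w.1, \matrix_(i, j) w.2 i (jidx k' (kidx j))).

Lemma jtrunc_raise k k' z : (k <= k')%N -> jraise k (jtrunc k' z) = jtrunc k z.
Proof.
move=> kk'; apply: injective_projections => //=; apply/matrixP => i j; rewrite !mxE.
by rewrite jidxK // (leq_trans (kidx_le j)).
Qed.

Lemma jraise_dom k k' (w : jspc k') : jdm k' w -> jdm k (jraise k w).
Proof.
rewrite /jdom /=; suff -> : \row_i (jraise k w).2 i (jidx0 n k) = \row_i w.2 i (jidx0 n k') by [].
apply/rowP => i; rewrite !mxE; congr (w.2 _ _); apply: kidx_inj.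
by rewrite kidx0 jidxK ?kidx0 // big1 // => l _; rewrite ffunE.
Qed.

Lemma jraise_smooth k k' : smooth_on (jdm k') (@jraise k k').
Proof.
have oJ := @jdom_open R n p D k'.
apply: (smooth_pair (mxbasis R 1 n) (mxbasis R p #|kindex n k|) oJ (smooth_jfst oJ)).
apply/(smooth_mxP _ oJ) => a i; apply: (eq_smooth_on oJ _ (smooth_jsnd a (jidx k' (kidx i)) oJ)) => x _.
by rewrite mxE.
Qed.

Lemma smooth_jraise k k' (g : jspc k -> R^o) : smooth_on (jdm k) g ->
  smooth_on (jdm k') (g \o @jraise k k').
Proof.
move=> sg; apply: (smooth_comp (jbasis R n p k) (jdom_open (D := D) (k := k')) _ (@jraise_smooth k k') sg).
by move=> w; exact: jraise_dom.
Qed.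

Lemma jrep_raise k k' f g : (k <= k')%N -> jrep f g -> jrep f (g \o @jraise k k').
Proof.
move=> kk' [sg fg]; split; first exact: smooth_jraise.
by move=> z jz; rewrite fg //= jtrunc_raise.
Qed.

Definition dtot_rep k l (g : jspc k -> R^o) : jspc k.+1 -> R^o := fun w =>
  'D_(@dx R n p k l) g (jraise k w) +
  \sum_i \sum_j w.2 i (jidx k.+1 (mindex_incr l (kidx j))) *
     'D_(@du R n p k i j) g (jraise k w).

Lemma dtot_rep_smooth k l (g : jspc k -> R^o) : smooth_on (jdm k) g -> smooth_on (jdm k.+1) (dtot_rep l g).
Proof.
move=> sg; have oJ := jdom_open (D := D) (k := k.+1).
apply: smoothD => //.
  exact: (smooth_jraise (smooth_on_derive _ sg)).
apply: smooth_sum => // i; apply: smooth_sum => // j; apply: smoothM => //.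
  exact: smooth_jsnd.
exact: (smooth_jraise (smooth_on_derive _ sg)).
Qed.

Lemma jrep_dtot k l f g : @jrep k f g -> jrep (dtot l f) (dtot_rep l g).
Proof.
move=> fg; split=> [|z jz]; first exact: dtot_rep_smooth (proj1 fg).
rewrite (dtotE c_bij l fg jz) /dtot_rep jtrunc_raise //; congr (_ + _).
apply: eq_bigr => i _; apply: eq_bigr => j _; congr (_ * _).
rewrite mxE jidxK // mindex_incr_sum ltnS; exact: kidx_le.
Qed.

(** The order is written [size S + k] so that it computes along the recursion and no cast between
    jet spaces occurs. *)
Fixpoint dtots_rep k (S : seq 'I_n) (g : jspc k -> R^o) : jspc (size S + k) -> R^o :=
  match S return jspc (size S + k) -> R^o with
  | [::] => g
  | l :: S' => dtot_rep l (@dtots_rep k S' g)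
  end.

Lemma jrep_dtots k S f g : @jrep k f g -> @jrep (size S + k) (dtots S f) (@dtots_rep k S g).
Proof. by move=> fg; elim: S => [|l S IH] //=; apply: jrep_dtot. Qed.

Lemma jrep_sum k (I : Type) (r : seq I) (f : I -> jet R n K -> R) (g : I -> jspc k -> R^o) :
  (forall i, jrep (f i) (g i)) ->
  jrep (fun z => \sum_(i <- r) f i z) (fun w => \sum_(i <- r) g i w).
Proof.
move=> H; split=> [|z jz]; last by apply: eq_bigr => i _; exact: (proj2 (H i)).
by apply: (smooth_sum r (jdom_open (D := D) (k := k))) => i; case: (H i).
Qed.

Lemma jrep_scale k (a : R) f (g : jspc k -> R^o) :
  jrep f g -> jrep (fun z => a * f z) (fun w => a * g w).
Proof.
move=> [sg fg]; split=> [|z jz]; last by rewrite fg.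
exact: (smoothM (jdom_open (D := D) (k := k)) (@smooth_cst _ _ _ _ (a : R^o)) sg).
Qed.

Section Prolongation.
Variables (O : openset 'rV[R]_n) (y : K -> 'rV[R]_n -> R^o).
Hypothesis sy : forall i, smooth_on O (y i).
Hypothesis Dy : forall x, os_set O x -> os_set D (x, \row_i y (c i) x).

(** The infinite jet prolongation of the section with components [y]. Derivatives are taken in the
    order of [mindex_seq]; [jprol_pders] removes this choice. *)
Definition jprol x : jet R n K := (x, fun i al => pders (mindex_seq al) (y i) x).

Lemma jprol_pders i S x : os_set O x -> (jprol x).2 i (mindex_of S) = pders S (y i) x.
Proof.
move=> Ox; apply: (@perm_pders R n O _ _ (y i) x) => //.
by rewrite -mindex_of_perm mindex_seqK.
Qed.

Lemma jprol0 i x : os_set O x -> (jprol x).2 i [ffun=> 0%N] = y i x.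
Proof.
move=> Ox; rewrite -[RHS]/(pders [::] (y i) x) -jprol_pders //; congr ((jprol x).2 i _).
Qed.

Lemma jprol_over x : os_set O x -> jover (jprol x).
Proof.
move=> Ox; rewrite /jover /=; suff -> : \row_i (jprol x).2 (c i) [ffun=> 0%N] = \row_i y (c i) x.
  exact: Dy.
by apply/rowP => i; rewrite !mxE jprol0.
Qed.

Lemma jprol_smooth k : smooth_on O (fun x => jtrunc k (jprol x)).
Proof.
apply: (smooth_pair (mxbasis R 1 n) (mxbasis R p #|kindex n k|) (os_open O) (smooth_id (os_open O))).
apply/(smooth_mxP _ (os_open O)) => i j.
apply: (eq_smooth_on (os_open O) _ (smooth_on_pders (mindex_seq (kidx j)) (sy (c i)))) => x Ox.
by rewrite mxE.
Qed.

Lemma jprol_jdom k x : os_set O x -> jdm k (jtrunc k (jprol x)).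
Proof. by move=> Ox; apply/jtrunc_jdom/jprol_over. Qed.

Lemma jrep_jprol k f g x : @jrep k f g -> os_set O x -> f (jprol x) = g (jtrunc k (jprol x)).
Proof. by move=> [_ fg] Ox; exact: fg (jprol_over Ox). Qed.

Lemma jrep_jprol_smooth k f g : @jrep k f g -> smooth_on O (f \o jprol : _ -> R^o).
Proof.
move=> fg; apply: (eq_smooth_on (os_open O) _ (smooth_comp (jbasis R n p k) (os_open O)
  (@jprol_jdom k) (@jprol_smooth k) (proj1 fg))) => x Ox.
by rewrite /= (jrep_jprol fg).
Qed.

(** Chain rule for [g] along the prolonged section: the base coordinates contribute the unit vector
    [l], and the coordinate of index [al] has as derivative the one of index [mindex_incr l al]. *)
Lemma dtot_jprol k l f g x : @jrep k f g -> os_set O x ->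
  dtot l f (jprol x) = 'D_(dvec R l) (f \o jprol : _ -> R^o) x.
Proof.
move=> fg Ox; rewrite (dtotE c_bij l fg (jprol_over Ox)).
pose h x := jtrunc k (jprol x).
have dh : differentiable h x := smooth_on_differentiable (@jprol_smooth k) Ox.
have dg : differentiable g (h x) := smooth_on_differentiable (proj1 fg) (jprol_jdom k Ox).
have -> : 'D_(dvec R l) (f \o jprol : _ -> R^o) x = 'D_(dvec R l) (g \o h) x.
  by apply: derive_eqO Ox => u Ou /=; rewrite (jrep_jprol fg).
have coordE (i : fd_idx (jbasis R n p k)) :
    fd_coord i ('D_(dvec R l) h x) = 'D_(dvec R l) (fd_coord i \o h) x.
  by rewrite derive_linear_comp //; exact: fd_cont.
have cfst a b : fd_coord (f := jbasis R n p k) (inl (a, b)) ('D_(dvec R l) h x) = (b == l)%:R.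
  rewrite coordE.
  have -> : fd_coord (f := jbasis R n p k) (inl (a, b)) \o h = mxcoord (a, b) by [].
  rewrite derive_linear; last exact: mxcoord_continuous.
  by rewrite -[LHS]/((delta_mx 0 l : 'rV[R]_n) a b) mxE ord1 eqxx.
have csnd i j : fd_coord (f := jbasis R n p k) (inr (i, j)) ('D_(dvec R l) h x) =
    (jprol x).2 (c i) (mindex_incr l (kidx j)).
  rewrite coordE -[kidx j in RHS]mindex_seqK -mindex_of_cons jprol_pders //=.
  by apply: derive_eqO Ox => u Ou; rewrite -[LHS]/((h u).2 i j) mxE.
rewrite [RHS](derive_comp_basis (jbasis R n p k)) // [RHS]big_sumType; congr (_ + _).
  rewrite (eq_bigr (fun ab : 'I_1 * 'I_n => (ab.2 == l)%:R *
      'D_((delta_mx ab.1 ab.2, 0) : jspc k) g (h x))); last by case=> a b _; rewrite cfst.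
  rewrite (bigD1 (ord0, l)) //= [X in _ + X]big1 ?addr0 => [|[a b] /= ab].
    by rewrite eqxx mul1r.
  have [bl|_] := eqVneq b l; last by rewrite mul0r.
  by rewrite bl ord1 eqxx in ab.
rewrite pair_big; apply: eq_bigr => -[i j] _.
by rewrite csnd.
Qed.

Lemma dtots_jprol k S f g x : @jrep k f g -> os_set O x ->
  dtots S f (jprol x) = pders S (f \o jprol) x.
Proof.
move=> fg; elim: S x => [|l S IH] x Ox //=.
rewrite (dtot_jprol l (jrep_dtots S fg)) //.
by apply: derive_eqO Ox => u Ou; exact: IH.
Qed.
End Prolongation.

(** The components are polynomials with the jet of [z] up to order [N], and [O] is where their graph
    stays in [D]. As only a finite order is matched, each use takes [N] from the orders of the
    functions compared. *)
Lemma exists_section N z : jover z ->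
  exists (O : openset 'rV[R]_n) (y : K -> 'rV[R]_n -> R^o),
  [/\ forall i, smooth_on O (y i),
      forall x, os_set O x -> os_set D (x, \row_i y (c i) x),
      os_set O z.1
    & forall i (S : seq 'I_n), (size S <= N)%N ->
        (jprol y z.1).2 i (mindex_of S) = z.2 i (mindex_of S)].
Proof.
move=> jz.
have H i : exists f : 'rV[R]_n -> R^o, smooth_on setT f /\
    forall S, (size S <= N)%N -> pders S f z.1 = z.2 i (mindex_of S).
  by have [f sf fE] := exists_jet z.1 N (z.2 i); exists f.
have [y yP] := choice H.
have oO : open [set x | os_set D (x, \row_i y (c i) x)].
  apply: (@open_comp _ _ (fun x : 'rV[R]_n => (x, \row_i y (c i) x : 'rV[R]_p))); last exact: os_open.
  move=> x _; apply: differentiable_continuous.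
  apply: (@smooth_on_differentiable R _ _ setT) => //.
  apply: (smooth_pair (mxbasis R 1 n) (mxbasis R 1 p) openT (smooth_id openT)).
  apply/(smooth_mxP _ openT) => a i; apply: (eq_smooth_on openT _ (proj1 (yP (c i)))) => u _.
  by rewrite mxE.
exists (OpenSet oO), y; split=> //=.
- by move=> i; apply: smooth_on_sub (proj1 (yP i)).
- suff -> : \row_i y (c i) z.1 = \row_i z.2 (c i) [ffun=> 0%N] by exact: jz.
  apply/rowP => i; rewrite !mxE; have := (yP (c i)).2 [::] (leq0n _).
  have -> : mindex_of [::] = [ffun=> 0%N] :> mindex n by apply/ffunP => l; rewrite !ffunE.
  exact.
- move=> i S sS; rewrite -(yP i).2 //.
  apply: (@perm_pders R n (OpenSet openT) _ _ (y i)) => //; first exact: (yP i).1.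
  by rewrite -mindex_of_perm mindex_seqK.
Qed.

Lemma jtrunc_eq k z z' : z.1 = z'.1 ->
  (forall i (S : seq 'I_n), (size S <= k)%N -> z.2 (c i) (mindex_of S) = z'.2 (c i) (mindex_of S)) ->
  jtrunc k z = jtrunc k z'.
Proof.
move=> z1 z2; apply: injective_projections => //; apply/matrixP => i j; rewrite !mxE.
by rewrite -[kidx j]mindex_seqK z2 // -mindex_of_sum mindex_seqK kidx_le.
Qed.

Lemma jrep_eq k f g z z' : @jrep k f g -> jover z -> jover z' ->
  jtrunc k z = jtrunc k z' -> f z = f z'.
Proof. by move=> [_ fg] jz jz' e; rewrite !fg // e. Qed.
End JetCalculus.

(** * The adjoint along a section *)

(** Total, with value 0 on functions that are not smooth, so that formulas carry no smoothness
    proofs. *)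
Definition tosfun (R : realType) n (O : openset 'rV[R]_n) (f : 'rV[R]_n -> R^o) : sfun O :=
  match pselect (smooth_on O f) with left sf => mksfun sf | right _ => 0 end.

Lemma tosfunE (R : realType) n (O : openset 'rV[R]_n) (f : 'rV[R]_n -> R^o) x :
  smooth_on O f -> os_set O x -> tosfun O f x = f x.
Proof. by rewrite /tosfun; case: pselect => // sf _ Ox; rewrite mksfunE. Qed.

Lemma ders_tosfun (R : realType) n (O : openset 'rV[R]_n) (f : 'rV[R]_n -> R^o) S x :
  smooth_on O f -> os_set O x -> ders (sfun_cderiv O) S (tosfun O f) x = pders S f x.
Proof.
move=> sf Ox; rewrite sfun_dersE //; apply: (@eq_pders _ _ O) => // u Ou.
exact: tosfunE.
Qed.

Lemma sfun_signE (R : realType) n (O : openset 'rV[R]_n) k b (f : sfun O) x : os_set O x ->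
  ((-1) ^+ k * b%:R * f) x = (-1) ^+ k * b%:R * f x :> R.
Proof.
move=> Ox; rewrite sfunME // sfunME //; congr (_ * _ * _).
  elim: k => [|k IH]; first by rewrite sfun1E.
  by rewrite !exprS sfunME // IH sfunNE // sfun1E.
elim: b => [|b IH]; first by rewrite sfun0E.
by rewrite -!natr1 sfunDE // IH sfun1E.
Qed.

Lemma sfun_sign1E (R : realType) n (O : openset 'rV[R]_n) k (f : sfun O) x : os_set O x ->
  ((-1) ^+ k * f) x = (-1) ^+ k * f x :> R.
Proof. by move=> Ox; have := sfun_signE k 1 f Ox; rewrite !mulr1. Qed.

Lemma size_cat_leq n (S L : seq 'I_n) m k : size S = k -> (k < (m - size L).+1)%N ->
  (size L <= m)%N -> (size (S ++ L) <= m)%N.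
Proof. by rewrite size_cat => ->; lia. Qed.

Section EtaLocal.
Variables (R : realType) (n p v w m k : nat).
Variable D : openset ('rV[R]_n * 'rV[R]_p)%type.
Variable u : lcoef R n p w v.
Let c := @id 'I_p.
Let c_bij : bijective c. Proof. by exists id. Qed.
Hypothesis u_sym : forall L L' a r z, (size L <= m)%N -> perm_eq L L' ->
  jover c D z -> u L a r z = u L' a r z.
Hypothesis u_rep : forall L a r, (size L <= m)%N -> exists g, @jrep R n p 'I_p c D k (u L a r) g.

(** At most [m] derivatives fall on coefficients of order [k], so [m + k] is an order common to all
    terms; their representatives are raised to it and then summed. *)
Lemma eta_rep L a r : (size L <= m)%N -> exists g, @jrep R n p 'I_p c D (m + k) (eta m u L r a) g.
Proof.
move=> sL.
have H (i : 'I_(m - size L).+1) (S : i.-tuple 'I_n) : exists g, @jrep R n p 'I_p c D (m + k)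
    (fun z => (-1) ^+ (i + size L) * 'C(i + size L, i)%:R * dtots S (u (S ++ L) a r) z) g.
  have sS : (size (S ++ L) <= m)%N := size_cat_leq (size_tuple S) (ltn_ord i) sL.
  have [g gP] := u_rep a r sS.
  have le : (size S + k <= m + k)%N.
    by rewrite leq_add2r size_tuple; have := ltn_ord i; lia.
  have := jrep_raise le (jrep_dtots c_bij S gP).
  by move=> /(jrep_scale ((-1) ^+ (i + size L) * 'C(i + size L, i)%:R)) ?; eexists; eassumption.
have {}H (i : 'I_(m - size L).+1) : exists g, @jrep R n p 'I_p c D (m + k)
    (fun z => \sum_(S : i.-tuple 'I_n) (-1) ^+ (i + size L) * 'C(i + size L, i)%:R *
       dtots S (u (S ++ L) a r) z) g.
  have [g gP] := choice (H i).
  by have := jrep_sum (index_enum (i.-tuple 'I_n)) gP; eexists; eassumption.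
have [g gP] := choice H.
by have := jrep_sum (index_enum 'I_(m - size L).+1) gP; eexists; eassumption.
Qed.

(** The coefficients at [S ++ L] and [S ++ L'] agree only over [D], which does not by itself
    identify their total derivatives; they share a representative, and that determines the
    derivatives. *)
Lemma eta_sym L L' a r z : (size L <= m)%N -> perm_eq L L' -> jover c D z ->
  eta m u L r a z = eta m u L' r a z.
Proof.
move=> sL LL' jz; rewrite /eta -(perm_size LL').
apply: eq_bigr => i _; apply: eq_bigr => S _; congr (_ * _).
have sS : (size (S ++ L) <= m)%N := size_cat_leq (size_tuple S) (ltn_ord i) sL.
have [g gP] := u_rep a r sS.
have gP' : jrep c D (u (S ++ L') a r) g.
  split=> [|z' jz']; first exact: (proj1 gP).
  by rewrite -(proj2 gP) // -(u_sym a r sS) // perm_cat2l.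
by rewrite (proj2 (jrep_dtots c_bij S gP)) // (proj2 (jrep_dtots c_bij S gP')).
Qed.

Section AlongSection.
Variables (O : openset 'rV[R]_n) (y : 'I_p -> 'rV[R]_n -> R^o).
Hypothesis sy : forall i, smooth_on O (y i).
Hypothesis Dy : forall x, os_set O x -> os_set D (x, \row_i y (c i) x).
Local Notation d := (sfun_cderiv O).

Definition scoef (u : lcoef R n p w v) L a r : sfun O := tosfun O (u L a r \o jprol y).

Lemma u_smooth L a r : (size L <= m)%N -> smooth_on O (u L a r \o jprol y : _ -> R^o).
Proof. by move=> /(u_rep a r)[g gP]; exact: (jrep_jprol_smooth sy Dy gP). Qed.

Lemma scoefE L a r x : (size L <= m)%N -> os_set O x -> scoef u L a r x = u L a r (jprol y x).
Proof. by move=> sL Ox; rewrite /scoef tosfunE //; exact: u_smooth. Qed.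

Lemma scoef_sym a r : perm_inv m (fun L => scoef u L a r).
Proof.
move=> L L' sL LL'; apply: sfun_eq => x Ox.
rewrite !scoefE //; last by rewrite -(perm_size LL').
by apply: u_sym => //; exact: (jprol_over sy Dy).
Qed.

Lemma eta_section L a r x : (size L <= m)%N -> os_set O x ->
  eta m u L r a (jprol y x) = dopadj d m (fun L => scoef u L a r) L x.
Proof.
move=> sL Ox; rewrite /eta /dopadj sfun_sumE //; apply: eq_bigr => i _.
rewrite sfun_tsumE // -tsumE; apply: eq_bigr => S _.
have sS : (size (S ++ L) <= m)%N := size_cat_leq (size_tuple S) (ltn_ord i) sL.
rewrite sfun_signE // ders_tosfun //; last exact: u_smooth.
have [g gP] := u_rep a r sS.
by rewrite (dtots_jprol c_bij sy Dy S gP).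
Qed.
End AlongSection.
End EtaLocal.

Lemma eq_dopadj (A : comPzRingType) n (d : cderiv A n) m (P P' : seq 'I_n -> A) L :
  (forall L, (size L <= m)%N -> P L = P' L) -> (size L <= m)%N ->
  dopadj d m P L = dopadj d m P' L.
Proof.
move=> PP' sL; apply: eq_bigr => i _; apply: eq_tsum => S sS.
by rewrite PP' // (size_cat_leq sS (ltn_ord i) sL).
Qed.

(** * The involution and the adjoint formula on jets *)

Section EtaIdentities.
Variables (R : realType) (n p v w m k : nat).
Variable D : openset ('rV[R]_n * 'rV[R]_p)%type.
Variable u : lcoef R n p w v.
Let c := @id 'I_p.
Let c_bij : bijective c. Proof. by exists id. Qed.
Hypothesis u_sym : forall L L' a r z, (size L <= m)%N -> perm_eq L L' ->
  jover c D z -> u L a r z = u L' a r z.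
Hypothesis u_rep : forall L a r, (size L <= m)%N -> exists g, @jrep R n p 'I_p c D k (u L a r) g.

Lemma scoef_eta (O : openset 'rV[R]_n) (y : 'I_p -> 'rV[R]_n -> R^o) L a r :
  (forall i, smooth_on O (y i)) ->
  (forall x, os_set O x -> os_set D (x, \row_i y (c i) x)) -> (size L <= m)%N ->
  scoef O y (eta m u) L r a = dopadj (sfun_cderiv O) m (fun L => scoef O y u L a r) L.
Proof.
move=> sy Dy sL; apply: sfun_eq => x Ox.
rewrite (scoefE (eta_rep u_rep) sy Dy) //.
exact: (eta_section u_rep sy Dy).
Qed.

(** Both sides have representatives of order [m + (m + k)], so [z] may be replaced by the jet of a
    section with the same truncation; there [eta] is [dopadj], and [dopadjK] applies. *)
Lemma etaK L a r z : (size L <= m)%N -> jover c D z ->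
  eta m (eta m u) L a r z = u L a r z.
Proof.
move=> sL jz.
have eu_rep L' r' a' : (size L' <= m)%N ->
    exists g, @jrep R n p 'I_p c D (m + k) (eta m u L' r' a') g.
  exact: eta_rep.
have [g1 g1P] : exists g, @jrep R n p 'I_p c D (m + (m + k)) (eta m (eta m u) L a r) g.
  exact: eta_rep.
have [g2' g2P'] := u_rep a r sL.
have le : (k <= m + (m + k))%N by lia.
have g2P := jrep_raise le g2P'.
have [ O [y [sy Dy Oz zE]]] := exists_section (m + (m + k)) jz.
have jz' : jover c D (jprol y z.1) := jprol_over sy Dy Oz.
have e : jtrunc c (m + (m + k)) z = jtrunc c (m + (m + k)) (jprol y z.1).
  by apply: jtrunc_eq => // i S sS; rewrite zE.
rewrite (jrep_eq g1P jz jz' e) (jrep_eq g2P jz jz' e).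
rewrite (eta_section eu_rep sy Dy) //.
rewrite (eq_dopadj _ (P' := dopadj (sfun_cderiv O) m (fun L => scoef O y u L a r))) //; last first.
  by move=> L' sL'; exact: scoef_eta.
rewrite dopadjK //; last exact: (scoef_sym u_sym u_rep sy Dy).
exact: (scoefE u_rep sy Dy).
Qed.

(** Views a bundle over [Y] with [v] fiber coordinates as one over the base with [p + v]. The jet
    calculus then covers [adj_fun], whose total derivatives also act on those [v] coordinates. *)
Definition jet_split (i : 'I_(p + v)) : ('I_p + 'I_v)%type := fintype.split i.

Lemma jet_split_bij : bijective jet_split.
Proof. by exists (@unsplit p v); [exact: splitK|exact: unsplitK]. Qed.

Lemma jet_splitl i : jet_split (lshift v i) = inl i.
Proof. by apply: (can_inj (@unsplitK p v)); rewrite splitK. Qed.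

Lemma jet_splitr i : jet_split (rshift p i) = inr i.
Proof. by apply: (can_inj (@unsplitK p v)); rewrite splitK. Qed.

Lemma jet_split_dom_open : open [set xV : 'rV[R]_n * 'rV[R]_(p + v) | os_set D (xV.1, lsubmx xV.2)].
Proof.
apply: (@open_comp _ _ (fun xV : 'rV[R]_n * 'rV[R]_(p + v) => (xV.1, lsubmx xV.2 : 'rV[R]_p)));
  last exact: os_open.
move=> x _; apply: differentiable_continuous.
apply: (@smooth_on_differentiable R _ _ setT) => //.
apply: (smooth_pair (mxbasis R 1 n) (mxbasis R 1 p) openT).
  by apply: (smooth_lin (L := fst)) openT _ => u'; exact: cvg_fst.
apply/(smooth_mxP _ openT) => a i.
have sl : smooth_on setT (fun xV : 'rV[R]_n * 'rV[R]_(p + v) => xV.2 a (lshift v i) : R^o).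
  apply: (smooth_lin (L := mxcoord (a, lshift v i) \o snd)) openT _ => u'.
  by apply: continuous_comp; [exact: cvg_snd|exact: mxcoord_continuous].
by apply: (eq_smooth_on openT _ sl) => u' _; rewrite mxE.
Qed.

Definition jet_split_dom : openset ('rV[R]_n * 'rV[R]_(p + v))%type := OpenSet jet_split_dom_open.

Lemma jover_split z : jover jet_split jet_split_dom z <-> jover c D (yjet z).
Proof.
rewrite /jover /=; suff -> : lsubmx (\row_i z.2 (jet_split i) [ffun=> 0%N]) =
  \row_i z.2 (inl i) [ffun=> 0%N] by [].
by apply/rowP => i; rewrite !mxE jet_splitl.
Qed.

Lemma jrep_yjet N f g : @jrep R n p 'I_p c D N f g ->
  exists g', @jrep R n (p + v) _ jet_split jet_split_dom N (fun z => f (yjet z)) g'.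
Proof.
move=> [sg fg].
(* The projection of jets that forgets the last [v] fiber coordinates. *)
pose sigma (w : 'rV[R]_n * 'M[R]_(p + v, #|kindex n N|)) : 'rV[R]_n * 'M[R]_(p, #|kindex n N|) :=
  (w.1, \matrix_(i, j) w.2 (lshift v i) j).
have oJ := @jdom_open R n (p + v) jet_split_dom N.
exists (g \o sigma); split=> [|z jz].
  apply: (smooth_comp (jbasis R n p N) oJ _ _ sg) => [w0|].
    rewrite /jdom /=; suff -> : lsubmx (\row_i w0.2 i (jidx0 n N)) =
      \row_i (sigma w0).2 i (jidx0 n N) by [].
    by apply/rowP => i; rewrite !mxE.
  apply: (smooth_pair (mxbasis R 1 n) (mxbasis R p #|kindex n N|) oJ (smooth_jfst oJ)).
  apply/(smooth_mxP _ oJ) => i j.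
  apply: (eq_smooth_on oJ _ (smooth_jsnd (lshift v i) j oJ)) => x _.
  by rewrite mxE.
rewrite fg /=; last exact/jover_split; congr (g _).
apply: injective_projections => //; apply/matrixP => i j; rewrite !mxE.
by rewrite jet_splitl.
Qed.

Lemma jrep_coord N (a : 'I_v) : exists g,
  @jrep R n (p + v) _ jet_split jet_split_dom N (fun z => z.2 (inr a) [ffun=> 0%N]) g.
Proof.
exists (fun w : 'rV[R]_n * 'M[R]_(p + v, #|kindex n N|) => w.2 (rshift p a) (jidx0 n N)); split=> [|z jz].
  exact: (smooth_jsnd _ _ (jdom_open (D := jet_split_dom) (k := N))).
by rewrite mxE kidx0 jet_splitr.
Qed.

Lemma jrep_mul N f1 f2 g1 g2 : @jrep R n (p + v) _ jet_split jet_split_dom N f1 g1 ->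
  @jrep R n (p + v) _ jet_split jet_split_dom N f2 g2 -> 
  jrep jet_split jet_split_dom (fun z => f1 z * f2 z) (fun w => g1 w * g2 w).
Proof.
move=> [s1 e1] [s2 e2]; split=> [|z jz]; last by rewrite e1 // e2.
exact: (smoothM (jdom_open (D := jet_split_dom) (k := N)) s1 s2).
Qed.

Definition adj_term (r : 'I_w) (S : seq 'I_n) (z : jet R n ('I_p + 'I_v)%type) : R :=
  \sum_(a < v) u S a r (yjet z) * z.2 (inr a) [ffun=> 0%N].

Lemma adj_term_rep r S : (size S <= m)%N ->
  exists g, @jrep R n (p + v) _ jet_split jet_split_dom k (adj_term r S) g.
Proof.
move=> sS.
have H (a : 'I_v) : exists g, @jrep R n (p + v) _ jet_split jet_split_dom k
    (fun z => u S a r (yjet z) * z.2 (inr a) [ffun=> 0%N]) g.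
  have [g gP] := u_rep a r sS; have [g' gP'] := jrep_yjet gP.
  have [h hP] := jrep_coord k a.
  by have := jrep_mul gP' hP; eexists; eassumption.
have [g gP] := choice H.
by have := jrep_sum (index_enum 'I_v) gP; eexists; eassumption.
Qed.

Section AlongSection.
Variables (O : openset 'rV[R]_n) (fy : 'rV[R]_n -> 'rV[R]_p) (fw : 'rV[R]_n -> 'rV[R]_v).
Hypothesis sfy : smooth_on O fy.
Hypothesis sfw : smooth_on O fw.
Hypothesis Dfy : forall x, os_set O x -> os_set D (x, fy x).
Local Notation d := (sfun_cderiv O).
Let y (i : 'I_p) (x : 'rV[R]_n) : R^o := fy x 0 i.
Let y2 (i : 'I_p + 'I_v) (x : 'rV[R]_n) : R^o :=
  match i with inl i => fy x 0 i | inr a => fw x 0 a end.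

Let sy i : smooth_on O (y i).
Proof. by have /(smooth_mxP _ (os_open O)) := sfy; exact. Qed.

Let sw i : smooth_on O (fun x => fw x 0 i : R^o).
Proof. by have /(smooth_mxP _ (os_open O)) := sfw; exact. Qed.

Let Dy x : os_set O x -> os_set D (x, \row_i y (c i) x).
Proof.
move=> Ox; suff -> : \row_i y (c i) x = fy x by exact: Dfy.
by apply/rowP => i; rewrite mxE.
Qed.

Let sy2 i : smooth_on O (y2 i).
Proof. by case: i => i; [exact: sy|exact: sw]. Qed.

Let Dy2 x : os_set O x -> os_set jet_split_dom (x, \row_i y2 (jet_split i) x).
Proof.
move=> Ox; rewrite /jet_split_dom /=.
suff -> : lsubmx (\row_i y2 (jet_split i) x) = fy x by exact: Dfy.
by apply/rowP => i; rewrite !mxE jet_splitl.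
Qed.

Let jE x : section_jet fy fw x = jprol y2 x.
Proof. by congr pair; apply/funext => -[i|i]; apply/funext. Qed.

(** The common value of both expressions along a section: [adj_fun_section] reaches it directly,
    [op_fun_eta_section] through the Leibniz formula [dadjE]. *)
Definition sadj r : sfun O := \sum_(i < m.+1) (-1) ^+ i * tsum i (fun S =>
  ders d S (\sum_a scoef O y u S a r * tosfun O (fun x => fw x 0 a))).

Lemma adj_fun_section r x : os_set O x -> adj_fun m u r (section_jet fy fw x) = sadj r x.
Proof.
move=> Ox; rewrite /adj_fun /sadj sfun_sumE //; apply: eq_bigr => i _.
rewrite mulr_tsumr sfun_tsumE // -tsumE; apply: eq_bigr => S _.
have sSm : (size S <= m)%N by rewrite size_tuple -ltnS.
rewrite sfun_sign1E //; congr (_ * _).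
have [g gP] := adj_term_rep r sSm.
rewrite -[dtots S _]/(dtots S (adj_term r S)) jE (dtots_jprol jet_split_bij sy2 Dy2 S gP) //.
rewrite sfun_dersE //; apply: (@eq_pders _ _ O) => // x' Ox'.
rewrite /= /adj_term sfun_sumE //; apply: eq_bigr => a _.
rewrite sfunME // (scoefE u_rep sy Dy) // tosfunE //.
by rewrite (jprol0 sy2).
Qed.

Lemma op_fun_eta_section r x : os_set O x ->
  op_fun m (eta m u) r (section_jet fy fw x) = sadj r x.
Proof.
move=> Ox.
have -> : sadj r = \sum_a dadj d m (fun S => scoef O y u S a r) (tosfun O (fun x => fw x 0 a)).
  rewrite /sadj /dadj exchange_big /=; apply: eq_bigr => i _.
  rewrite -mulr_sumr -tsum_sum; congr (_ * _); apply: eq_tsum => S _.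
  by rewrite ders_sum.
rewrite sfun_sumE //.
transitivity (\sum_a \sum_(i < m.+1) tsum i (fun L =>
    eta m u L r a (yjet (section_jet fy fw x)) * (section_jet fy fw x).2 (inr a) (mindex_of L))).
  rewrite /op_fun exchange_big /=; apply: eq_bigr => i _.
  by rewrite -tsum_sum -tsumE.
apply: eq_bigr => a _; rewrite dadjE; last exact: (scoef_sym u_sym u_rep sy Dy).
rewrite /dop sfun_sumE //; apply: eq_bigr => i _.
rewrite sfun_tsumE //; apply: eq_tsum => L sL.
have sLm : (size L <= m)%N by rewrite sL -ltnS.
rewrite sfunME // ders_tosfun // -(eta_section u_rep sy Dy) //; congr (_ * _).
by rewrite jE (jprol_pders sy2).
Qed.
End AlongSection.

(** Reduction to a section as in [etaK]. Order [m + k] suffices: on the left, functions of order [k]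
    are differentiated at most [m] times; on the right, the coefficients have order [m + k] and the
    fiber coordinates order at most [m]. *)
Lemma adj_fun_eta r (z : jet R n ('I_p + 'I_v)%type) : jover c D (yjet z) ->
  adj_fun m u r z = op_fun m (eta m u) r z.
Proof.
move=> jyz; have jz : jover jet_split jet_split_dom z by apply/jover_split.
have [ O [y [sy Dy Oz zE]]] := exists_section (m + k) jz.
pose fy (x : 'rV[R]_n) : 'rV[R]_p := \row_i y (inl i) x.
pose fw (x : 'rV[R]_n) : 'rV[R]_v := \row_i y (inr i) x.
have sfy : smooth_on O fy.
  apply/(smooth_mxP _ (os_open O)) => a i.
  by apply: (eq_smooth_on (os_open O) _ (sy (inl i))) => x _; rewrite mxE.
have sfw : smooth_on O fw.
  apply/(smooth_mxP _ (os_open O)) => a i.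
  by apply: (eq_smooth_on (os_open O) _ (sy (inr i))) => x _; rewrite mxE.
have Dfy x : os_set O x -> os_set D (x, fy x).
  move=> Ox; have := Dy x Ox; rewrite /jet_split_dom /=.
  suff -> : lsubmx (\row_i y (jet_split i) x) = fy x by [].
  by apply/rowP => i; rewrite !mxE jet_splitl.
have jE : jprol y z.1 = section_jet fy fw z.1.
  congr pair; apply/funext => -[i|i]; apply/funext => al.
    by congr (pders _ _ _); apply/funext => x; rewrite mxE.
  by congr (pders _ _ _); apply/funext => x; rewrite mxE.
have jz' : jover jet_split jet_split_dom (jprol y z.1) := jprol_over sy Dy Oz.
have e : jtrunc jet_split (m + k) z = jtrunc jet_split (m + k) (jprol y z.1).
  by apply: jtrunc_eq => // i S sS; rewrite zE.
transitivity (adj_fun m u r (jprol y z.1)).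
  apply: eq_bigr => i _; apply: eq_bigr => S _; congr (_ * _).
  have sS : (size S <= m)%N by rewrite size_tuple -ltnS.
  have [g gP] := adj_term_rep r sS.
  have le : (size S + k <= m + k)%N by rewrite leq_add2r.
  exact: (jrep_eq (jrep_raise le (jrep_dtots jet_split_bij S gP)) jz jz' e).
rewrite jE (adj_fun_section sfy sfw Dfy) // -(op_fun_eta_section sfy sfw Dfy) // -jE.
apply: eq_bigr => i _; apply: eq_bigr => L _; apply: eq_bigr => a _.
have sL : (size L <= m)%N by rewrite size_tuple -ltnS.
rewrite zE; last by rewrite (leq_trans sL) // leq_addr.
have [g gP] := eta_rep u_rep a r sL; have [g' gP'] := jrep_yjet gP.
by rewrite (jrep_eq gP' jz jz' e).
Qed.
End EtaIdentities.

(** * Charts, sections and transition functions *)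

Lemma image_open_chart (R : realType) (V : normedModType R) (M : topologicalType)
    (c : chart V M) (A : set M) : open A -> A `<=` cdom c -> open (cmap c @` A).
Proof.
move=> oA Ac; rewrite openE => v [q Aq <-].
have dq := Ac _ Aq.
have n1 : nbhs (cmap c q) (cmap c @` cdom c).
  by apply: open_nbhs_nbhs; split; [exact: cimg_open|exists q].
have n2 : nbhs (cmap c q) (cinv c @^-1` A).
  apply: (cinv_cont (v := cmap c q)); first by exists q.
  by rewrite cmapK //; apply: open_nbhs_nbhs.
have n3 : nbhs (cmap c q) (cmap c @` cdom c `&` cinv c @^-1` A) by exact: filterI.
apply: filterS n3 => w [[q' dq' <-]] /=; rewrite cmapK // => Aq'.
by exists q'.
Qed.

Section AdmissibleCharts.
Variables (R : realType) (V : normedModType R) (M : manifold V) (b : fdbasis V).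
Implicit Types c : chart V M.

Lemma m_atlas_adm c : @m_atlas R V M c -> adm_chart c.
Proof. by move=> ca c' ca'; split; apply: m_compat. Qed.

(** Admissibility is compatibility with the atlas only, so near each point the two charts are
    compared through a chart of the atlas. *)
Lemma adm_transition c c' : adm_chart c -> adm_chart c' -> smooth_transition c c'.
Proof.
move=> ac ac'; apply: smooth_on_local => _ [q [cq cq'] <-].
have [c0 a0 c0q] := m_cover q.
pose A := cdom c `&` cdom c' `&` cdom c0.
have oA : open A by apply: openI; [apply: openI|]; exact: cdom_open.
have oO : open (cmap c @` A) by apply: image_open_chart => // z [[]].
have oO0 : open (cmap c0 @` A) by apply: image_open_chart => // z [].
exists (cmap c @` A); first by exists q.
apply: (eq_smooth_on oO (f := (cmap c' \o cinv c0) \o (cmap c0 \o cinv c))).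
  by move=> _ [z [[cz cz'] c0z] <-] /=; rewrite cmapK // cmapK.
apply: (smooth_comp_basis b b oO oO0 (D' := cmap c0 @` A)).
- by move=> _ [z Az <-] /=; exists z => //; rewrite cmapK //; case: Az => -[].
- apply: smooth_on_sub (proj1 (ac c0 a0)) => _ [z [[cz cz'] c0z] <-].
  by exists z.
- apply: smooth_on_sub (proj2 (ac' c0 a0)) => _ [z [[cz cz'] c0z] <-].
  by exists z.
Qed.
End AdmissibleCharts.

Section Sections.
Variables (R : realType) (n p e q : nat) (B : fiber_bundle R n p).
Variables (E : vbundle (fb_tot B) e) (Q : vbundle (fb_tot B) q).
Local Notation C := (csys E Q).
Local Notation X := (fb_base B).
Local Notation Y := (fb_tot B).
Implicit Types (c : C) (s : X -> Y) (U : set X).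

Lemma csdom_open c : open (csdom c).
Proof. by apply: openI; [exact: cdom_open|apply: openI; exact: tdom_open]. Qed.

Lemma csimg_open c : open (csimg c).
Proof. by apply: image_open_chart; [exact: csdom_open|move=> y []]. Qed.

Definition csO c : openset ('rV[R]_n * 'rV[R]_p)%type := @OpenSet _ (csimg c) (@csimg_open c).

(** The part of [local_section] that concerns the section of [Y], on a fixed [U]: different sections
    of bundles over [Y] are put along the same [s]. *)
Record good_section s U : Prop := GoodSection {
  gs_open : open U;
  gs_proj : forall x, U x -> fb_proj (s x) = x;
  gs_cont : forall x, U x -> {for x, continuous s};
  gs_smooth : forall c, smooth_on (cmap (cs_x c) @` (U `&` s @^-1` csdom c)) (yrep c s) }.

Lemma gs_preimage s U (A : set Y) : good_section s U -> open A -> open (U `&` s @^-1` A).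
Proof.
move=> gs oA; rewrite openE => x [Ux Ax].
apply: filterI; first by apply: open_nbhs_nbhs; split=> //; exact: gs_open gs.
by apply: (gs_cont gs Ux); apply: open_nbhs_nbhs.
Qed.

Lemma gs_cdom s U c x : good_section s U -> U x -> csdom c (s x) -> cdom (cs_x c) x.
Proof. by move=> gs Ux [/cs_fibered[+ _] _]; rewrite (gs_proj gs). Qed.

Lemma gs_sub s U A : good_section s U -> open A -> good_section s (U `&` s @^-1` A).
Proof.
move=> gs oA; split.
- exact: gs_preimage.
- by move=> x [/(gs_proj gs)].
- by move=> x [/(gs_cont gs)].
- move=> c; apply: smooth_on_sub (@gs_smooth _ _ gs c) => _ [x [[Ux Ax] cx] <-].
  by exists x.
Qed.

(** With [A] the domain of a second system, this is where both systems describe the section, in the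
    base coordinates of [c]. Two coordinate expressions are compared in the ring of smooth functions
    on it. *)
Definition sdom c s U (A : set Y) : set 'rV[R]_n :=
  cmap (cs_x c) @` (U `&` s @^-1` (csdom c `&` A)).

Lemma sdom_open c s U A : good_section s U -> open A -> open (sdom c s U A).
Proof.
move=> gs oA; apply: image_open_chart.
  by apply: gs_preimage => //; apply: openI => //; exact: csdom_open.
by move=> x [Ux [cx _]]; exact: gs_cdom gs Ux cx.
Qed.

Lemma gs_graph c s U x : good_section s U -> U x -> csdom c (s x) ->
  (cmap (cs_x c) x, yrep c s (cmap (cs_x c) x)) = cmap (cs_xy c) (s x).
Proof.
move=> gs Ux cx; rewrite /yrep cmapK; last exact: gs_cdom gs Ux cx.
case: cx => cxy _; have [_] := cs_fibered cxy; rewrite (gs_proj gs) // => <-.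
by case: (cmap _ _).
Qed.

Definition ybasis : fdbasis ('rV[R]_n * 'rV[R]_p)%type :=
  pairbasis (mxbasis R 1 n) (mxbasis R 1 p).

Lemma gs_chart_smooth c s U (cy : chart ('rV[R]_n * 'rV[R]_p)%type Y) :
  good_section s U -> adm_chart cy ->
  smooth_on (sdom c s U (cdom cy)) (fun x => cmap cy (s (cinv (cs_x c) x))).
Proof.
move=> gs acy; have oO : open (sdom c s U (cdom cy)) := sdom_open gs (@cdom_open _ _ _ cy).
have oA : open (cmap (cs_xy c) @` (csdom c `&` cdom cy)).
  apply: image_open_chart; first by apply: openI; [exact: csdom_open|exact: cdom_open].
  by move=> y [[]].
apply: (eq_smooth_on oO (f := (cmap cy \o cinv (cs_xy c)) \o (fun x => (x, yrep c s x)))).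
  move=> _ [x [Ux [cx cyx]] <-] /=; rewrite (gs_graph gs Ux cx) !cmapK //; first exact: gs_cdom gs Ux cx.
  by case: cx.
apply: (smooth_comp_basis ybasis ybasis oO oA).
- move=> _ [x [Ux [cx cyx]] <-]; rewrite (gs_graph gs Ux cx).
  by exists (s x).
- apply: (smooth_pair (mxbasis R 1 n) (mxbasis R 1 p) oO (smooth_id oO)).
  apply: smooth_on_sub (@gs_smooth _ _ gs c) => _ [x [Ux [cx cyx]] <-].
  by exists x.
- apply: smooth_on_sub (adm_transition ybasis (cs_xy_adm c) acy) => _ [y [[cy1 _] cy2] <-].
  by exists y.
Qed.

Lemma smooth_mulmx (V : normedModType R) (O : set V) a b d (F : V -> 'M[R]_(a, b)) (G : V -> 'M[R]_(b, d)) :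
  open O -> smooth_on O F -> smooth_on O G -> smooth_on O (fun x => F x *m G x).
Proof.
move=> oO /(smooth_mxP _ oO) sF /(smooth_mxP _ oO) sG; apply/(smooth_mxP _ oO) => i j.
apply: (eq_smooth_on oO (f := fun x => \sum_k F x i k * G x k j : R^o)).
  by move=> x _; rewrite mxE.
by apply: (smooth_sum _ oO) => k; apply: (smoothM oO).
Qed.

Section Trivializations.
Variables (r : nat) (F : vbundle Y r).
Implicit Types t : triv r (vfib F).

(** Compatibility only asserts that some transition matrix exists. This one is computed from the
    trivializations, and by [tmx_triv_transition] it agrees with any such matrix on overlaps. *)
Definition tmx t t' (y : Y) : 'M[R]_r :=
  \matrix_(i, j) (tmap t' y (tinv t y (delta_mx 0 i))) 0 j.

Lemma tinvE t y v : tdom t y -> tinv t y v = \sum_i v 0 i *: tinv t y (delta_mx 0 i).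
Proof.
move=> ty; rewrite -[RHS](tmapK ty); congr (tinv _ _ _).
rewrite linear_sum {1}[v]row_sum_delta; apply: eq_bigr => i _.
by rewrite linearZ /= tinvK.
Qed.

Lemma tmxE t t' y u : tdom t y -> tmap t' y u = tmap t y u *m tmx t t' y.
Proof.
move=> ty; rewrite -{1}[u](tmapK ty) (tinvE _ ty) linear_sum; apply/rowP => j.
rewrite summxE mxE; apply: eq_bigr => i _.
by rewrite linearZ /= !mxE.
Qed.

Lemma tmx_triv_transition t t' (G : Y -> 'M[R]_r) y : tdom t y -> tdom t' y ->
  (forall u : vfib F y, tmap t' y u = tmap t y u *m G y) -> tmx t t' y = G y.
Proof.
move=> ty ty' H; apply/matrixP => i j; rewrite mxE H tinvK //.
by rewrite -rowE mxE.
Qed.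

Lemma tmxM t t' t'' y : tdom t y -> tdom t' y -> tmx t t'' y = tmx t t' y *m tmx t' t'' y.
Proof.
move=> ty ty'; apply/row_matrixP => i; rewrite row_mul.
have rE t0 : row i (tmx t t0 y) = tmap t0 y (tinv t y (delta_mx 0 i)).
  by apply/rowP => j; rewrite !mxE.
by rewrite !rE (tmxE t'' _ ty').
Qed.

(** Smooth matrices are given only towards trivializations of the atlas and in charts of the atlas.
    Near each point one of each is inserted: the matrix factors through [t0], and the section is
    read in [cy]. *)
Lemma tmx_smooth c s U t t' : good_section s U -> adm_triv t -> adm_triv t' ->
  smooth_on (sdom c s U (tdom t `&` tdom t')) (fun x => tmx t t' (s (cinv (cs_x c) x))).
Proof.
move=> gs at_ at'; apply: smooth_on_local => _ [x [Ux [cx [tx tx']]] <-].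
have [t0 a0 t0x] := v_cover F (s x).
have [cy acy cyx] := m_cover (s x).
pose A := tdom t `&` tdom t' `&` tdom t0 `&` cdom cy.
have oA : open A.
  by do 3?[apply: openI]; try exact: tdom_open; exact: cdom_open.
have oO : open (sdom c s U A) := sdom_open gs oA.
exists (sdom c s U A); first by exists x.
have [G1 [e1 s1]] := proj1 (at_ t0 a0).
have [G2 [e2 s2]] := proj2 (at' t0 a0).
pose f x := cmap cy (s (cinv (cs_x c) x)).
have sf : smooth_on (sdom c s U A) f.
  apply: smooth_on_sub (@gs_chart_smooth c s U cy gs (m_atlas_adm acy)) => _ [z [Uz [cz Az]] <-].
  by exists z => //; split=> //; split=> //; case: Az.
have cA : A `<=` cdom cy by move=> z [].
have oI : open (cmap cy @` A) by exact: image_open_chart.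
have ff x' : sdom c s U A x' -> (cmap cy @` A) (f x').
  move=> [z [Uz [cz Az]] <-]; exists (s z) => //.
  by rewrite /f cmapK //; exact: gs_cdom gs Uz cz.
apply: (eq_smooth_on oO (f := fun x => ((G1 \o cinv cy) \o f) x *m ((G2 \o cinv cy) \o f) x)).
  move=> _ [z [Uz [cz [[[tz tz'] t0z] cyz]]] <-].
  rewrite /= /f (cmapK (gs_cdom gs Uz cz)) (cmapK cyz).
  rewrite (tmxM _ tz t0z); congr (_ *m _); apply/esym/tmx_triv_transition => // u.
    exact: e1.
  exact: e2.
apply: (smooth_mulmx oO).
  apply: (smooth_comp_basis ybasis (mxbasis R r r) oO oI ff sf).
  by apply: smooth_on_sub (s1 cy acy) => _ [z [[[tz tz'] t0z] cyz] <-]; exists z.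
apply: (smooth_comp_basis ybasis (mxbasis R r r) oO oI ff sf).
by apply: smooth_on_sub (s2 cy acy) => _ [z [[[tz tz'] t0z] cyz] <-]; exists z.
Qed.
End Trivializations.
End Sections.

Lemma sfun_detE (R : realType) n (O : openset 'rV[R]_n) k (M : 'M[sfun O]_k) x : os_set O x ->
  (\det M) x = \det (\matrix_(i, j) (M i j x : R)).
Proof.
move=> Ox; rewrite /determinant sfun_sumE //; apply: eq_bigr => s _.
rewrite sfun_sign1E //; congr (_ * _).
rewrite (big_morph (fun f : sfun O => f x) (fun f g => sfunME f g Ox) (sfun1E Ox)).
by apply: eq_bigr => i _; rewrite mxE.
Qed.

Section Jacobians.
Variables (R : realType) (n : nat).
Implicit Types (f g : 'rV[R]_n -> 'rV[R]_n) (x : 'rV[R]_n).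

Lemma jacobian_eq f (A : 'M[R]_n) x : differentiable f x ->
  (forall v, 'D_v f x = v *m A) -> 'J f x = A.
Proof.
move=> df H; apply/row_matrixP => i; rewrite !rowE -H deriveEjacobian //.
Qed.

Lemma jacobian_comp f g x : differentiable f x -> differentiable g (f x) ->
  'J (g \o f) x = 'J f x *m 'J g (f x).
Proof.
move=> df dg; apply: jacobian_eq => [|v]; first exact: differentiable_comp.
rewrite deriveE; last exact: differentiable_comp.
apply: (etrans (congr1 (fun h : 'rV[R]_n -> 'rV[R]_n => h v) (diff_comp df dg))).
apply: (etrans (congr1 ('d g (f x)) (esym (deriveE v df)))).
apply: (etrans (esym (deriveE ('D_v f x) dg))).
apply: (etrans (deriveEjacobian ('D_v f x) dg)).
by rewrite (deriveEjacobian v df) mulmxA.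
Qed.

Lemma jacobianE f x i j : differentiable f x ->
  'J f x i j = 'D_(dvec R i) (fun u => f u 0 j : R^o) x.
Proof.
move=> df; have -> : (fun u => f u 0 j : R^o) = mxcoord (0, j) \o f by [].
rewrite derive_linear_comp //; last exact: mxcoord_continuous.
rewrite deriveEjacobian // -[RHS]/((delta_mx 0 i *m 'J f x) 0 j) -rowE.
by rewrite [RHS]mxE.
Qed.

Lemma jacobian_smooth (O : openset 'rV[R]_n) f : smooth_on O f ->
  smooth_on O (fun x => \det ('J f x) : R^o).
Proof.
move=> sf; have /(smooth_mxP _ (os_open O)) sfj := sf.
pose M : 'M[sfun O]_n := \matrix_(i, j) mksfun (smooth_on_derive (dvec R i) (sfj 0 j)).
apply: (eq_smooth_on (os_open O) _ (sf_smooth (\det M))) => x Ox.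
rewrite sfun_detE //; congr (\det _); apply/matrixP => i j.
by rewrite [LHS]mxE [M i j]mxE mksfunE // jacobianE //; exact: smooth_on_differentiable sf Ox.
Qed.
End Jacobians.

Section ChartJacobians.
Variables (R : realType) (n : nat) (M : @manifold R 'rV[R]_n).
Implicit Types (c : chart 'rV[R]_n M).

Definition cjac c c' (q : M) : R := \det ('J (cmap c' \o cinv c) (cmap c q)).

Lemma transition_differentiable c c' q : adm_chart c -> adm_chart c' -> cdom c q -> cdom c' q ->
  differentiable (cmap c' \o cinv c) (cmap c q).
Proof.
move=> ac ac' cq cq'.
apply: (smooth_on_differentiable (adm_transition (mxbasis R 1 n) ac ac')).
by exists q.
Qed.

Lemma cjac_id c q : cdom c q -> cjac c c q = 1.
Proof.
move=> cq; rewrite /cjac -(det1 R n); congr (\det _).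
have oc := cimg_open c.
have near_id : \forall v \near cmap c q, (id : 'rV[R]_n -> 'rV[R]_n) v = (cmap c \o cinv c) v.
  have N : nbhs (cmap c q) (cmap c @` cdom c) by apply: open_nbhs_nbhs; split=> //; exists q.
  by apply: filterS N => _ [z cz <-] /=; rewrite cmapK.
apply: jacobian_eq => [|v].
  apply: near_eq_differentiable near_id _.
  exact: (smooth_on_differentiable (smooth_id openT)).
by rewrite -(near_eq_derive v near_id) mulmx1 derive_id.
Qed.

(** The cocycle rule that makes [dd_law] consistent: a component prescribed in one chart extends to
    all others. *)
Lemma cjac_chain c1 c2 c3 q : adm_chart c1 -> adm_chart c2 -> adm_chart c3 ->
  cdom c1 q -> cdom c2 q -> cdom c3 q -> cjac c1 c3 q = cjac c1 c2 q * cjac c2 c3 q.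
Proof.
move=> a1 a2 a3 q1 q2 q3; rewrite /cjac -det_mulmx; congr (\det _).
have d12 := transition_differentiable a1 a2 q1 q2.
have e12 : (cmap c2 \o cinv c1) (cmap c1 q) = cmap c2 q by rewrite /= cmapK.
have d23 : differentiable (cmap c3 \o cinv c2) ((cmap c2 \o cinv c1) (cmap c1 q)).
  by rewrite e12; exact: transition_differentiable.
rewrite -e12 -(jacobian_comp d12 d23).
apply: jacobian_eq => [|v]; first exact: transition_differentiable.
rewrite -deriveEjacobian; last exact: differentiable_comp.
apply: near_eq_derive.
have oA : open (cmap c1 @` (cdom c1 `&` cdom c2)).
  by apply: image_open_chart; [apply: openI; exact: cdom_open|move=> z []].
have N : nbhs (cmap c1 q) (cmap c1 @` (cdom c1 `&` cdom c2)).
  by apply: open_nbhs_nbhs; split=> //; exists q.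
by apply: filterS N => _ [z [z1 z2] <-] /=; rewrite cmapK // cmapK.
Qed.

Lemma cjacV c c' q : adm_chart c -> adm_chart c' -> cdom c q -> cdom c' q ->
  cjac c c' q * cjac c' c q = 1.
Proof. by move=> a a' q1 q2; rewrite -cjac_chain // cjac_id. Qed.
End ChartJacobians.

(** * Bundles and their density-duals *)

Section DualPairs.
Variables (R : realType) (n p e q : nat) (B : fiber_bundle R n p).
Variables (E : vbundle (fb_tot B) e) (Q : vbundle (fb_tot B) q).
Local Notation C := (csys E Q).
Local Notation X := (fb_base B).
Local Notation Y := (fb_tot B).
Implicit Types (c : C) (s : X -> Y) (U : set X).

(* In [dp_trans] the coordinates on [Wd] change contragrediently to those on [W],
   up to the Jacobian determinant of the base coordinates.  The relation is
   symmetric, so it holds both for a bundle and its density-dual and conversely. *)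
Record dual_pair w (W Wd : fcoord E Q w) : Prop := DualPair {
  dp_surj : forall c y, csdom c y -> forall v, exists a : fc_fib W y, fc_map c a = v;
  dp_surjd : forall c y, csdom c y -> forall v, exists b : fc_fib Wd y, fc_map c b = v;
  dp_inh : forall y, inhabited (fc_fib W y);
  dp_inhd : forall y, inhabited (fc_fib Wd y);
  dp_trans : forall s U c c', good_section E Q s U -> exists G : 'rV[R]_n -> 'M[R]_w,
    [/\ smooth_on (sdom c s U (csdom c')) G,
        forall x, U x -> csdom c (s x) -> csdom c' (s x) -> forall a : fc_fib W (s x),
          fc_map c' a = fc_map c a *m G (cmap (cs_x c) x)
      & forall x, U x -> csdom c (s x) -> csdom c' (s x) -> forall b : fc_fib Wd (s x),
          fc_map c b = cjac (cs_x c) (cs_x c') x *: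
            (fc_map c' b *m (G (cmap (cs_x c) x))^T)] }.

Definition xtrans c c' : 'rV[R]_n -> 'rV[R]_n := cmap (cs_x c') \o cinv (cs_x c).

Lemma xtransE c c' s U x : good_section E Q s U -> U x -> csdom c (s x) ->
  xtrans c c' (cmap (cs_x c) x) = cmap (cs_x c') x.
Proof. by move=> gs Ux cx; rewrite /xtrans /= cmapK //; exact: gs_cdom gs Ux cx. Qed.

Lemma xtrans_smooth c c' s U : good_section E Q s U ->
  smooth_on (sdom c s U (csdom c')) (xtrans c c').
Proof.
move=> gs; apply: smooth_on_sub (adm_transition (mxbasis R 1 n) (cs_x_adm c) (cs_x_adm c')).
move=> _ [x [Ux [cx cx']] <-]; exists x => //.
by split; [exact: gs_cdom gs Ux cx|exact: gs_cdom gs Ux cx'].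
Qed.

Definition sdomO c s U (A : set Y) (gs : good_section E Q s U) (oA : open A) : openset 'rV[R]_n :=
  OpenSet (sdom_open (c := c) gs oA).

Lemma cjac_smooth c c' s U : good_section E Q s U ->
  smooth_on (sdom c s U (csdom c')) (fun u => cjac (cs_x c) (cs_x c') (cinv (cs_x c) u) : R^o).
Proof.
move=> gs; pose O := sdomO c gs (@csdom_open _ _ _ _ _ _ _ _ c').
have oO : open (sdom c s U (csdom c')) := os_open O.
have sj : smooth_on (sdom c s U (csdom c')) (fun x => \det ('J (xtrans c c') x) : R^o).
  exact: (jacobian_smooth (O := O) (@xtrans_smooth c c' s U gs)).
apply: (eq_smooth_on oO _ sj).
by move=> _ [x [Ux [cx cx']] <-]; rewrite /cjac cmapK //; exact: gs_cdom gs Ux cx.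
Qed.

Lemma cjac_smooth' c c' s U : good_section E Q s U ->
  smooth_on (sdom c s U (csdom c')) (fun u => cjac (cs_x c') (cs_x c) (cinv (cs_x c) u) : R^o).
Proof.
move=> gs; have oO : open (sdom c s U (csdom c')) := sdom_open gs (@csdom_open _ _ _ _ _ _ _ _ c').
apply: (eq_smooth_on oO _ (smooth_comp (mxbasis R 1 n) oO _ (@xtrans_smooth c c' s U gs)
  (@cjac_smooth c' c s U gs))).
  move=> _ [x [Ux [cx cx']] <-]; rewrite /comp (xtransE _ gs Ux cx) !cmapK //.
    exact: gs_cdom gs Ux cx.
  exact: gs_cdom gs Ux cx'.
by move=> _ [x [Ux [cx cx']] <-]; rewrite (xtransE _ gs Ux cx); exists x.
Qed.

Section OneBundle.
Variables (r : nat) (F : vbundle Y r) (tr : C -> triv r (vfib F)).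
Hypothesis tr_adm : forall c, adm_triv (tr c).
Hypothesis tr_dom : forall c, csdom c `<=` tdom (tr c).

Definition fcF : fcoord E Q r :=
  {| fc_fib := fun y => vfib F y; fc_map := fun c y u => tmap (tr c) y u |}.

Definition fcFd : fcoord E Q r :=
  {| fc_fib := fun y => density_dual F y;
     fc_map := fun c y u =>
       \row_i dd_comp u (cs_x c) (tinv (tr c) y (delta_mx 0 i)) |}.

Definition tfunctional y (t : triv r (vfib F)) (v : 'rV[R]_r) (a : R) (u : vfib F y) : R^o :=
  a * \sum_i v 0 i * tmap t y u 0 i.

Lemma tfunctional_is_linear y t v a : linear (@tfunctional y t v a).
Proof.
move=> k u1 u2; rewrite /tfunctional linearP /=.
rewrite -[k *: (_ : R^o)]/(k * _) mulrCA -mulrDr; congr (_ * _).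
rewrite mulr_sumr -big_split; apply: eq_bigr => i _ /=.
by rewrite !mxE; ring.
Qed.

HB.instance Definition _ y t v a :=
  GRing.isLinear.Build R (vfib F y) R^o _ (@tfunctional y t v a)
    (@tfunctional_is_linear y t v a).

(** The component in [cs_x c] is free. In any other chart [b] around the point [dd_law] forces the
    factor [cjac b (cs_x c)], and the cocycle rule makes these choices compatible. Charts not around
    the point are unconstrained and get 0. *)
Lemma density_of_law c y (v : 'rV[R]_r) : csdom c y ->
  exists b : density_dual F y, fc_map (f := fcFd) c b = v.
Proof.
move=> cy; have cyx : cdom (cs_x c) (fb_proj y) by case: cy => /cs_fibered[].
pose a b : R := if `[< cdom b (fb_proj y) >] then cjac b (cs_x c) (fb_proj y) else 0.
pose comp b : {linear vfib F y -> R^o} := @tfunctional y (tr c) v (a b).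
have law b b' : adm_chart b -> adm_chart b' -> cdom b (fb_proj y) -> cdom b' (fb_proj y) ->
    forall u, comp b u = \det ('J (cmap b' \o cinv b) (cmap b (fb_proj y))) * comp b' u.
  move=> ab ab' yb yb' u.
  have ea : a b = cjac b b' (fb_proj y) * a b'.
    by rewrite /a (asboolT yb) (asboolT yb') (cjac_chain ab ab' (cs_x_adm c) yb yb' cyx).
  transitivity (a b * \sum_i v 0 i * tmap (tr c) y u 0 i); first by [].
  by rewrite ea -mulrA.
exists (DensityDual law); apply/rowP => i; rewrite mxE /comp /= /tfunctional.
rewrite /a asboolT // cjac_id // mul1r tinvK; last exact: tr_dom.
rewrite (bigD1 i) //= mxE !eqxx mulr1 big1 ?addr0 // => j /negPf ji.
by rewrite mxE ji andbF mulr0.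
Qed.

Lemma density_inhabited y : inhabited (density_dual F y).
Proof.
pose comp (b : chart 'rV[R]_n X) : {linear vfib F y -> R^o} := \0%R.
have law b b' : adm_chart b -> adm_chart b' -> cdom b (fb_proj y) -> cdom b' (fb_proj y) ->
    forall u, comp b u = \det ('J (cmap b' \o cinv b) (cmap b (fb_proj y))) * comp b' u.
  by move=> *; rewrite /comp /= mulr0.
exact: (inhabits (DensityDual law)).
Qed.

Lemma fcF_trans c c' y (u : vfib F y) : csdom c y ->
  fc_map (f := fcF) c' u = fc_map (f := fcF) c u *m tmx (tr c) (tr c') y.
Proof. by move=> /tr_dom; exact: tmxE. Qed.

Lemma fcFd_trans c c' y (b : density_dual F y) : csdom c y -> csdom c' y ->
  fc_map (f := fcFd) c b = cjac (cs_x c) (cs_x c') (fb_proj y) *: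
    (fc_map (f := fcFd) c' b *m (tmx (tr c) (tr c') y)^T).
Proof.
move=> cy cy'; apply/rowP => i; rewrite !mxE.
have cyx : cdom (cs_x c) (fb_proj y) by case: cy => /cs_fibered[].
have cyx' : cdom (cs_x c') (fb_proj y) by case: cy' => /cs_fibered[].
rewrite (dd_law b (cs_x_adm c) (cs_x_adm c')) //; congr (_ * _).
have -> : tinv (tr c) y (delta_mx 0 i) = tinv (tr c') y (row i (tmx (tr c) (tr c') y)).
  rewrite -[LHS](tmapK (tr_dom cy')) (tmxE _ _ (tr_dom cy)) tinvK; last exact: tr_dom.
  by rewrite -rowE.
rewrite (tinvE _ (tr_dom cy')) linear_sum; apply: eq_bigr => j _.
by rewrite linearZ /= !mxE mulrC.
Qed.

Lemma tmx_smooth_cs c c' s U : good_section E Q s U ->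
  smooth_on (sdom c s U (csdom c')) (fun u => tmx (tr c) (tr c') (s (cinv (cs_x c) u))) /\
  smooth_on (sdom c s U (csdom c')) (fun u => tmx (tr c') (tr c) (s (cinv (cs_x c) u))).
Proof.
move=> gs; split; [apply: smooth_on_sub (tmx_smooth (c := c) gs (tr_adm c) (tr_adm c'))
  |apply: smooth_on_sub (tmx_smooth (c := c) gs (tr_adm c') (tr_adm c))];
  move=> _ [x [Ux [cx cx']] <-]; exists x => //; split=> //; split=> //; split; exact: tr_dom.
Qed.

Lemma dual_pair_bundle : dual_pair fcF fcFd.
Proof.
split=> [c y cy v|c y cy v|y|y|s U c c' gs].
- by exists (tinv (tr c) y v) => /=; rewrite tinvK //; exact: tr_dom.
- exact: density_of_law.
- exact: (inhabits 0).
- exact: density_inhabited.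
- exists (fun u => tmx (tr c) (tr c') (s (cinv (cs_x c) u))); split.
  + exact: (proj1 (@tmx_smooth_cs c c' s U gs)).
  + move=> x Ux cx cx' a; rewrite cmapK; last exact: gs_cdom gs Ux cx.
    exact: fcF_trans.
  + move=> x Ux cx cx' b; rewrite cmapK; last exact: gs_cdom gs Ux cx.
    by rewrite (fcFd_trans b cx cx') (gs_proj gs).
Qed.

Lemma dual_pair_density : dual_pair fcFd fcF.
Proof.
split=> [c y cy v|c y cy v|y|y|s U c c' gs].
- exact: density_of_law.
- by exists (tinv (tr c) y v) => /=; rewrite tinvK //; exact: tr_dom.
- exact: density_inhabited.
- exact: (inhabits 0).
have oO : open (sdom c s U (csdom c')) := sdom_open gs (@csdom_open _ _ _ _ _ _ _ _ c').
(* The contragredient of the density law: inverse Jacobian times transposed inverse transition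
   matrix. In the second law the transpositions undo each other and [cjacV] cancels the
   Jacobians. *)
exists (fun u => cjac (cs_x c') (cs_x c) (cinv (cs_x c) u) *:
  (tmx (tr c') (tr c) (s (cinv (cs_x c) u)))^T); split.
- have /(smooth_mxP _ oO) st := proj2 (@tmx_smooth_cs c c' s U gs).
  apply/(smooth_mxP _ oO) => i j.
  apply: (eq_smooth_on oO _ (smoothM oO (@cjac_smooth' c c' s U gs) (st j i))) => x _.
  by rewrite !mxE.
- move=> x Ux cx cx' b; rewrite cmapK; last exact: gs_cdom gs Ux cx.
  by rewrite (fcFd_trans b cx' cx) (gs_proj gs) // -scalemxAr.
- move=> x Ux cx cx' a; rewrite cmapK; last exact: gs_cdom gs Ux cx.
  rewrite linearZ /= trmxK -scalemxAr scalerA cjacV ?scale1r.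
  + exact: fcF_trans.
  + exact: cs_x_adm.
  + exact: cs_x_adm.
  + exact: gs_cdom gs Ux cx.
  + exact: gs_cdom gs Ux cx'.
Qed.
End OneBundle.

Lemma csdom_E c : csdom c `<=` tdom (cs_E c). Proof. by move=> y [_ []]. Qed.
Lemma csdom_Q c : csdom c `<=` tdom (cs_Q c). Proof. by move=> y [_ []]. Qed.

Lemma dual_pair_E : dual_pair (fcE E Q) (fcEd E Q).
Proof. exact: (dual_pair_bundle (@cs_E_adm _ _ _ _ _ _ _ _) csdom_E). Qed.
Lemma dual_pair_Ed : dual_pair (fcEd E Q) (fcE E Q).
Proof. exact: (dual_pair_density (@cs_E_adm _ _ _ _ _ _ _ _) csdom_E). Qed.
Lemma dual_pair_Q : dual_pair (fcQ E Q) (fcQd E Q).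
Proof. exact: (dual_pair_bundle (@cs_Q_adm _ _ _ _ _ _ _ _) csdom_Q). Qed.
Lemma dual_pair_Qd : dual_pair (fcQd E Q) (fcQ E Q).
Proof. exact: (dual_pair_density (@cs_Q_adm _ _ _ _ _ _ _ _) csdom_Q). Qed.
End DualPairs.

(** * Partial derivatives of new base coordinates as a frame *)

Section Pullback.
Variables (R : realType) (n : nat) (O O' : openset 'rV[R]_n) (psi psi' : 'rV[R]_n -> 'rV[R]_n).
Hypothesis psi_smooth : smooth_on O psi.
Hypothesis psi'_smooth : smooth_on O' psi'.
Hypothesis psi_O : forall x, os_set O x -> os_set O' (psi x).
Hypothesis psi'_O : forall x, os_set O' x -> os_set O (psi' x).
Hypothesis psiK : forall x, os_set O x -> psi' (psi x) = x.
Hypothesis psi'K : forall x, os_set O' x -> psi (psi' x) = x.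
Local Notation d := (sfun_cderiv O).

Definition pb_coord (j : 'I_n) : sfun O := tosfun O (fun x => psi x 0 j).
(** Row [j] holds the partial derivatives of the inverse map at [psi x], so that [frame_der] is the
    [j]-th partial derivative in the coordinates [psi], expressed on [O]. *)
Definition pb_mx : 'M[sfun O]_n :=
  \matrix_(j, i) tosfun O (fun x => 'D_(dvec R j) (fun y => psi' y 0 i : R^o) (psi x)).

Let psi_coord j : smooth_on O (fun x => psi x 0 j : R^o).
Proof. by have /(smooth_mxP _ (os_open O)) := psi_smooth; exact. Qed.

Let psi'_coord j : smooth_on O' (fun x => psi' x 0 j : R^o).
Proof. by have /(smooth_mxP _ (os_open O')) := psi'_smooth; exact. Qed.

Lemma pullback_smooth (k : 'rV[R]_n -> R^o) : smooth_on O' k -> smooth_on O (k \o psi).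
Proof. exact: (smooth_comp (mxbasis R 1 n) (os_open O) psi_O psi_smooth). Qed.

Lemma pb_mxE j i x : os_set O x ->
  pb_mx j i x = 'D_(dvec R j) (fun y => psi' y 0 i : R^o) (psi x).
Proof.
move=> Ox; rewrite mxE tosfunE //.
exact: (pullback_smooth (smooth_on_derive (dvec R j) (psi'_coord i))).
Qed.

(** On [O'] the function [k] is [(k \o psi) \o psi']; the chain rule for this composite at [psi x]
    is the claim. *)
Lemma frame_der_pullback j (k : 'rV[R]_n -> R^o) : smooth_on O' k ->
  frame_der d pb_mx j (tosfun O (k \o psi)) = tosfun O ('D_(dvec R j) k \o psi).
Proof.
move=> sk; apply: sfun_eq => x Ox.
have sD := pullback_smooth (smooth_on_derive (dvec R j) sk).
rewrite (tosfunE sD Ox) /frame_der sfun_sumE //.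
have spk := pullback_smooth sk.
pose h := k \o psi.
have Opx := psi_O Ox.
have dpsi' : differentiable psi' (psi x) := smooth_on_differentiable psi'_smooth Opx.
have dh : differentiable h (psi' (psi x)).
  by rewrite psiK //; exact: smooth_on_differentiable spk Ox.
have -> : ('D_(dvec R j) k \o psi) x = 'D_(dvec R j) (h \o psi') (psi x).
  by apply: (derive_eqO (O := O')) Opx => y Oy; rewrite /h /= psi'K.
rewrite (derive_comp_basis (mxbasis R 1 n) _ dpsi' dh).
transitivity (\sum_(ab : 'I_1 * 'I_n) 'D_(dvec R j) (fun y => psi' y 0 ab.2 : R^o) (psi x) *
    'D_(dvec R ab.2) h x).
  rewrite -(pair_bigA _ (fun (a : 'I_1) (b : 'I_n) =>
    'D_(dvec R j) (fun y => psi' y 0 b : R^o) (psi x) * 'D_(dvec R b) h x)) big_ord1.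
  apply: eq_bigr => i _; rewrite sfunME // pb_mxE //; congr (_ * _).
  apply: (etrans (sfun_derE i _ Ox)); apply: (derive_eqO (O := O)) Ox => y Oy.
  exact: tosfunE.
apply: eq_bigr => -[a b] _; rewrite (psiK Ox) (ord1 a); apply: congr2 => //.
exact: (derive_linear_comp (L := mxcoord (0, b)) _ (mxcoord_continuous (ij := (0, b))) dpsi').
Qed.

(** The case of the coordinate functions in [frame_der_pullback]. *)
Lemma pb_mxK : pb_mx *m \matrix_(i, j) d i (pb_coord j) = 1%:M.
Proof.
apply/matrixP => j l; rewrite !mxE.
transitivity (frame_der d pb_mx j (pb_coord l)).
  by apply: eq_bigr => i _; rewrite [X in _ * X = _]mxE.
have sl : smooth_on O' (fun x : 'rV[R]_n => x 0 l : R^o) := @smooth_coord R n O' l.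
apply: (etrans (frame_der_pullback j sl)); apply: sfun_eq => x Ox.
rewrite tosfunE //; last exact: (pullback_smooth (smooth_on_derive (dvec R j) sl)).
apply: (etrans (derive_linear (L := mxcoord (0, l)) (psi x) (dvec R j) _)).
  exact: mxcoord_continuous.
rewrite -[LHS]/((delta_mx 0 j : 'rV[R]_n) 0 l) mxE eqxx /= eq_sym.
by case: eqP => _; rewrite ?sfun1E ?sfun0E.
Qed.

Definition pb_frame : cderiv (sfun O) n := frame pb_mxK.

Lemma ders_pullback S (k : 'rV[R]_n -> R^o) x : smooth_on O' k -> os_set O x ->
  ders pb_frame S (tosfun O (k \o psi)) x = pders S k (psi x).
Proof.
move=> sk Ox.
suff -> : ders pb_frame S (tosfun O (k \o psi)) = tosfun O (pders S k \o psi).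
  by rewrite tosfunE //; apply: pullback_smooth; exact: smooth_on_pders.
elim: S => [|l S IH] //=.
rewrite IH; apply: frame_der_pullback; exact: smooth_on_pders.
Qed.

Lemma pb_det x : os_set O x ->
  (\det (\matrix_(i, j) d i (pb_coord j))) x = \det ('J psi x).
Proof.
move=> Ox; rewrite sfun_detE //; congr (\det _); apply/matrixP => i j.
rewrite [LHS]mxE [X in sf_val X _]mxE jacobianE; last exact: smooth_on_differentiable psi_smooth Ox.
apply: (etrans (sfun_derE i _ Ox)); apply: (derive_eqO (O := O)) Ox => y Oy.
exact: tosfunE.
Qed.
End Pullback.

Lemma jet_smoothP (R : realType) n p k (D : openset ('rV[R]_n * 'rV[R]_p)%type)
    (f : jet R n 'I_p -> R) :
  jet_smooth k D f <-> exists g, @jrep R n p 'I_p id D k f g.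
Proof.
have idb : bijective (@id 'I_p) by exists id.
have e : @jet_trunc R n p k @` jet_over D = @jdom R n p D k by apply: (jdom_image (c := id)).
split=> [[g sg fg]|[g [sg fg]]]; exists g => //; last by rewrite e.
by split=> //; rewrite -e.
Qed.

Lemma op_fun_section (R : realType) n p v w m k (D : openset ('rV[R]_n * 'rV[R]_p)%type)
    (u : lcoef R n p w v) (O : openset 'rV[R]_n) (fy : 'rV[R]_n -> 'rV[R]_p)
    (fw : 'rV[R]_n -> 'rV[R]_w) a x :
  (forall L a r, (size L <= m)%N -> exists g, @jrep R n p 'I_p id D k (u L a r) g) ->
  smooth_on O fy -> smooth_on O fw -> (forall x, os_set O x -> os_set D (x, fy x)) ->
  os_set O x ->
  op_fun m u a (section_jet fy fw x) =
  \sum_(i < m.+1) tsum i (fun S => \sum_r u S a r (jprol (fun i x => fy x 0 i : R^o) x) *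
    pders S (fun x => fw x 0 r : R^o) x).
Proof.
move=> u_rep sfy sfw Dfy Ox; apply: eq_bigr => i _.
rewrite -tsumE; apply: eq_bigr => S _; apply: eq_bigr => r _; congr (_ * _).
apply: (@perm_pders R n O _ _ (fun x => fw x 0 r : R^o)) => //.
  by have /(smooth_mxP _ (os_open O)) := sfw; exact.
by rewrite -mindex_of_perm mindex_seqK.
Qed.

Lemma eq_section_jet (R : realType) n p w (O : openset 'rV[R]_n) (fy : 'rV[R]_n -> 'rV[R]_p)
    (fw fw' : 'rV[R]_n -> 'rV[R]_w) x :
  (forall x, os_set O x -> fw x = fw' x) -> os_set O x ->
  section_jet fy fw x = section_jet fy fw' x.
Proof.
move=> e Ox; congr pair; apply/funext => -[i|r]; apply/funext => al //.
by apply: (@eq_pders R n O) => // y Oy; rewrite e.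
Qed.

(** * Invariance of the adjoint *)

Section Invariance.
Variables (R : realType) (n p e q m : nat) (B : fiber_bundle R n p).
Variables (E : vbundle (fb_tot B) e) (Q : vbundle (fb_tot B) q).
Local Notation C := (csys E Q).
Local Notation X := (fb_base B).
Local Notation Y := (fb_tot B).
Implicit Types (c : C) (s : X -> Y) (U : set X).
Variables (w v : nat) (W Wd : fcoord E Q w) (Z Zd : fcoord E Q v).
Hypothesis WP : dual_pair W Wd.
Hypothesis ZP : dual_pair Z Zd.
Variable u : C -> lcoef R n p w v.
Hypothesis u_op : linear_diff_op m W Z u.

Let u_sym c L L' a r z : (size L <= m)%N -> perm_eq L L' ->
  jover (@id 'I_p) (csO c) z -> u c L a r z = u c L' a r z.
Proof. by case: u_op => H _ _; apply: H. Qed.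

Lemma op_rep : exists k, forall c L a r, (size L <= m)%N ->
  exists g, @jrep R n p 'I_p id (csO c) k (u c L a r) g.
Proof.
by case: u_op => _ [k H] _; exists k => c L a r sL; apply/jet_smoothP; exact: H.
Qed.

Lemma local_section_good w' (F : fcoord E Q w') s (sw : forall x, fc_fib F (s x)) x0 :
  local_section sw x0 -> exists U, [/\ good_section E Q s U, U x0 &
    forall c, smooth_on (cmap (cs_x c) @` (U `&` s @^-1` csdom c)) (wrep c sw)].
Proof.
move=> [U [oU Ux H1 H2]]; exists U; split=> //.
  by split=> // [x /H1[]|x /H1[]|c] //; case: (H2 c).
by move=> c; case: (H2 c).
Qed.

Lemma sdom_setI c s U (A : set Y) : sdom c s U A = cmap (cs_x c) @` ((U `&` s @^-1` A) `&` s @^-1` csdom c).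
Proof. by rewrite /sdom; congr image; apply/seteqP; split=> x /= => -[]; tauto. Qed.

(** Supplies enough sections to turn invariance, a statement about sections, into an identity of
    operators: the coordinates in [c] can be prescribed freely. *)
Lemma test_section s U c c' (f : 'rV[R]_n -> 'rV[R]_w) : good_section E Q s U ->
  smooth_on (sdom c s U (csdom c')) f ->
  exists sw : forall x, fc_fib W (s x),
    (forall x, U x -> csdom c (s x) -> csdom c' (s x) ->
       local_section sw x /\ fc_map c (sw x) = f (cmap (cs_x c) x)).
Proof.
move=> gs sf.
have H x : exists a : fc_fib W (s x), csdom c (s x) -> fc_map c a = f (cmap (cs_x c) x).
  have [cx|ncx] := pselect (csdom c (s x)).
    by have [a ea] := dp_surj WP cx (f (cmap (cs_x c) x)); exists a.
  by have [a] := dp_inh WP (s x); exists a.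
pose sw x := projT1 (cid (H x)).
have swE x : csdom c (s x) -> fc_map c (sw x) = f (cmap (cs_x c) x).
  exact: (projT2 (cid (H x))).
exists sw => x0 Ux0 cx0 cx0'; split; last exact: swE.
have oA : open (csdom c `&` csdom c') by apply: openI; exact: csdom_open.
(* [local_section] demands smoothness in every system, while [f] is smooth only where both [c] and
   [c'] apply. On this smaller set the expression in any system [c2] is [f] followed by a
   transition. *)
pose U' := U `&` s @^-1` (csdom c `&` csdom c').
have gs' : good_section E Q s U' := gs_sub gs oA.
exists U'; split=> //; first exact: (gs_open gs').
  by move=> x U'x; split; [exact: (gs_proj gs' U'x)|exact: (gs_cont gs' U'x)].
move=> c2; split; first exact: (gs_smooth gs').
have [G [sG GE _]] := dp_trans WP c c2 gs'.
have oO : open (sdom c s U' (csdom c2)) := sdom_open gs' (@csdom_open _ _ _ _ _ _ _ _ c2).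
have oO2 : open (sdom c2 s U' (csdom c)) := sdom_open gs' (@csdom_open _ _ _ _ _ _ _ _ c).
have D2E : cmap (cs_x c2) @` (U' `&` s @^-1` csdom c2) = sdom c2 s U' (csdom c).
  rewrite sdom_setI; congr image; apply/seteqP.
  split=> x /=; first by case=> [[Ux [cx cx']] c2x]; exact: (conj (conj (conj Ux (conj cx cx')) cx) c2x).
  by case=> [[[Ux [cx cx']] _] c2x]; exact: (conj (conj Ux (conj cx cx')) c2x).
rewrite D2E.
have sfG : smooth_on (sdom c s U' (csdom c2)) (fun x => f x *m G x).
  apply: (smooth_mulmx oO) => //; apply: smooth_on_sub sf => _ [x [[Ux [cx cx']] _] <-].
  by exists x.
apply: (eq_smooth_on oO2 _ (smooth_comp_basis (mxbasis R 1 n) (mxbasis R 1 w) oO2 oO _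
  (@xtrans_smooth _ _ _ _ _ _ _ _ c2 c s U' gs') sfG)).
  move=> _ [x [U'x [c2x cx]] <-]; rewrite /comp (xtransE _ gs' U'x c2x) /wrep cmapK.
    by rewrite (GE x U'x cx c2x) swE.
  exact: gs_cdom gs' U'x c2x.
by move=> _ [x [U'x [c2x cx]] <-]; rewrite (xtransE _ gs' U'x c2x); exists x.
Qed.

Section TwoCharts.
Variables (c c0 : C) (s : X -> Y) (U : set X) (gs : good_section E Q s U).
Let O : openset 'rV[R]_n := sdomO c gs (@csdom_open _ _ _ _ _ _ _ _ c0).
Let O' : openset 'rV[R]_n := sdomO c0 gs (@csdom_open _ _ _ _ _ _ _ _ c).
Let psi := xtrans c c0.
Let psi' := xtrans c0 c.

Let psi_s : smooth_on O psi. Proof. exact: xtrans_smooth. Qed.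
Let psi'_s : smooth_on O' psi'. Proof. exact: xtrans_smooth. Qed.
Let psi_O x : os_set O x -> os_set O' (psi x).
Proof. by move=> [z [Uz [cz c0z]] <-]; rewrite /psi (xtransE _ gs Uz cz); exists z. Qed.
Let psi'_O x : os_set O' x -> os_set O (psi' x).
Proof. by move=> [z [Uz [cz c0z]] <-]; rewrite /psi' (xtransE _ gs Uz cz); exists z. Qed.
Let psiK x : os_set O x -> psi' (psi x) = x.
Proof.
by move=> [z [Uz [cz c0z]] <-]; rewrite /psi (xtransE _ gs Uz cz) /psi' (xtransE _ gs Uz c0z).
Qed.
Let psi'K x : os_set O' x -> psi (psi' x) = x.
Proof.
by move=> [z [Uz [cz c0z]] <-]; rewrite /psi' (xtransE _ gs Uz cz) /psi (xtransE _ gs Uz c0z).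
Qed.

Let yrep_s : smooth_on O (yrep c s).
Proof.
have H : smooth_on (cmap (cs_x c) @` (U `&` s @^-1` csdom c)) (yrep c s) by exact: (gs_smooth gs).
by apply: smooth_on_sub H => _ [z [Uz [cz c0z]] <-]; exists z.
Qed.

Let yrep_s' : smooth_on O' (yrep c0 s).
Proof.
have H : smooth_on (cmap (cs_x c0) @` (U `&` s @^-1` csdom c0)) (yrep c0 s) by exact: (gs_smooth gs).
by apply: smooth_on_sub H => _ [z [Uz [cz c0z]] <-]; exists z.
Qed.

Let yrep_D x : os_set O x -> os_set (csO c) (x, yrep c s x).
Proof. by move=> [z [Uz [cz c0z]] <-]; rewrite (gs_graph gs Uz cz); exists (s z). Qed.

Let yrep_D' x : os_set O' x -> os_set (csO c0) (x, yrep c0 s x).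
Proof. by move=> [z [Uz [cz c0z]] <-]; rewrite (gs_graph gs Uz cz); exists (s z). Qed.

Let wrep_c w' (F : fcoord E Q w') (sw : forall x, fc_fib F (s x)) z :
  U z -> csdom c (s z) -> wrep c sw (cmap (cs_x c) z) = fc_map c (sw z).
Proof. by move=> Uz cz; rewrite /wrep cmapK //; exact: gs_cdom gs Uz cz. Qed.

Let wrep_c0 w' (F : fcoord E Q w') (sw : forall x, fc_fib F (s x)) z :
  U z -> csdom c0 (s z) -> wrep c0 sw (cmap (cs_x c0) z) = fc_map c0 (sw z).
Proof. by move=> Uz cz; rewrite /wrep cmapK //; exact: gs_cdom gs Uz cz. Qed.

Let y_s i : smooth_on O (fun x => yrep c s x 0 i : R^o).
Proof. by have /(smooth_mxP _ (os_open O)) := yrep_s; exact. Qed.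

Let y0_s i : smooth_on O' (fun x => yrep c0 s x 0 i : R^o).
Proof. by have /(smooth_mxP _ (os_open O')) := yrep_s'; exact. Qed.

Let y_D x : os_set O x -> os_set (csO c) (x, \row_i yrep c s x 0 (id i)).
Proof. move=> Ox; rewrite (_ : \row_i _ = yrep c s x); first exact: yrep_D.
by apply/rowP => i; rewrite mxE. Qed.

Let y0_D x : os_set O' x -> os_set (csO c0) (x, \row_i yrep c0 s x 0 (id i)).
Proof. move=> Ox; rewrite (_ : \row_i _ = yrep c0 s x); first exact: yrep_D'.
by apply/rowP => i; rewrite mxE. Qed.

Let P S a r : sfun O := scoef O (fun i x => yrep c s x 0 i) (u c) S a r.
Let P' S a r : sfun O :=
  tosfun O ((u c0 S a r \o jprol (fun i x => yrep c0 s x 0 i : R^o)) \o psi).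
Let fr : cderiv (sfun O) n := pb_frame psi_s psi'_s psi_O psiK psi'K.

(** Provides the hypothesis of [system_adjoint]. Invariance gives one element of the fiber of [Z]
    whose coordinates in [c] and [c0] are the two local expressions, and [GZ] compares them. The
    functions [xi] are arbitrary, as coordinates of a test section; [P'] and [fr] carry the [c0]
    side over to [O]. *)
Lemma op_change GW GZ (sGW : smooth_on O GW) (sGZ : smooth_on O GZ) :
  (forall x, U x -> csdom c (s x) -> csdom c0 (s x) -> forall a : fc_fib W (s x),
     fc_map c0 a = fc_map c a *m GW (cmap (cs_x c) x)) ->
  (forall x, U x -> csdom c (s x) -> csdom c0 (s x) -> forall a : fc_fib Z (s x),
     fc_map c0 a = fc_map c a *m GZ (cmap (cs_x c) x)) ->
  forall (xi : 'I_w -> sfun O) a',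
    \sum_(k < m.+1) tsum k (fun S => \sum_r' P' S a' r' *
       ders fr S (\sum_r xi r * tosfun O (fun x => GW x r r'))) =
    \sum_a (\sum_(k < m.+1) tsum k (fun S => \sum_r P S a r * ders (sfun_cderiv O) S (xi r))) *
       tosfun O (fun x => GZ x a a').
Proof.
move=> HW HZ xi a'; apply: sfun_eq => _ [z [Uz [cz c0z]] <-].
set x := cmap (cs_x c) z.
have Ox : os_set O x by exists z.
have xE : cmap (cs_x c0) z = psi x by rewrite /psi (xtransE _ gs Uz cz).
pose f (y : 'rV[R]_n) : 'rV[R]_w := \row_r xi r y.
have sf : smooth_on O f.
  apply/(smooth_mxP _ (os_open O)) => i r.
  by apply: (eq_smooth_on (os_open O) _ (sf_smooth (xi r))) => y _; rewrite mxE.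
have [sw swP] := test_section gs sf.
have [loc _] := swP z Uz cz c0z.
have [k rep] := op_rep.
case: u_op => _ _ /(_ s sw z loc)[zeta zetaP].
have := HZ z Uz cz c0z zeta; rewrite (zetaP c0 c0z) (zetaP c cz).
move=> /rowP/(_ a'); rewrite mxE [in RHS]mxE -/x xE => E1.
(* The coordinates of the test section in [c0], as functions of the base coordinates of [c0]. *)
pose f0 y := f (psi' y) *m GW (psi' y).
have sf0 : smooth_on O' f0.
  apply: (smooth_comp_basis (mxbasis R 1 n) (mxbasis R 1 w) (os_open O') (os_open O) psi'_O psi'_s
    (g := fun y => f y *m GW y)).
  exact: (smooth_mulmx (os_open O)).
have wE y : os_set O y -> wrep c sw y = f y.
  move=> [z' [Uz' [cz' c0z']] <-]; rewrite wrep_c //.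
  by have [_ ->] := swP z' Uz' cz' c0z'.
have wE0 y : os_set O' y -> wrep c0 sw y = f0 y.
  move=> [z' [Uz' [c0z' cz']] <-]; rewrite wrep_c0 // /f0 /psi' (xtransE _ gs Uz' c0z').
  by rewrite (HW z' Uz' cz' c0z'); have [_ ->] := swP z' Uz' cz' c0z'.
move: E1; rewrite (eq_section_jet (O := O) _ wE) // (eq_section_jet (O := O') _ wE0); last exact: psi_O.
rewrite (op_fun_section _ (rep c0) yrep_s' sf0 yrep_D' (psi_O Ox)).
move=> E1; transitivity (\sum_(i < m.+1) tsum i (fun S => \sum_r u c0 S a' r
     (jprol (fun i x => yrep c0 s x 0 i : R^o) (psi x)) *
    pders S (fun x => f0 x 0 r : R^o) (psi x))).
  rewrite sfun_sumE //; apply: eq_bigr => i _; rewrite sfun_tsumE //; apply: eq_tsum => S sS.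
  have sSm : (size S <= m)%N by rewrite sS -ltnS.
  rewrite sfun_sumE //; apply: eq_bigr => r' _; rewrite sfunME //; congr (_ * _).
    rewrite tosfunE //; apply: (pullback_smooth psi_s psi_O).
    exact: (u_smooth (rep c0) y0_s y0_D).
  have -> : \sum_r xi r * tosfun O (fun x => GW x r r') = tosfun O ((fun x => f0 x 0 r' : R^o) \o psi).
    have sf0r : smooth_on O' (fun x => f0 x 0 r' : R^o).
      by have /(smooth_mxP _ (os_open O')) := sf0; exact.
    apply: sfun_eq => y Oy; rewrite sfun_sumE // tosfunE //; last exact: (pullback_smooth psi_s psi_O).
    rewrite /f0 /comp psiK // mxE; apply: eq_bigr => r _; rewrite sfunME // mxE tosfunE //.
    by have /(smooth_mxP _ (os_open O)) := sGW; exact.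
  rewrite ders_pullback //.
  by have /(smooth_mxP _ (os_open O')) := sf0; exact.
rewrite E1 sfun_sumE //; apply: eq_bigr => a _; rewrite sfunME // mxE; congr (_ * _); last first.
  by rewrite tosfunE //; have /(smooth_mxP _ (os_open O)) := sGZ; exact.
rewrite (op_fun_section _ (rep c) yrep_s sf yrep_D Ox).
rewrite sfun_sumE //; apply: eq_bigr => i _; rewrite sfun_tsumE //; apply: eq_tsum => S sS.
have sSm : (size S <= m)%N by rewrite sS -ltnS.
rewrite sfun_sumE //; apply: eq_bigr => r _; rewrite sfunME //; congr (_ * _).
  by rewrite (scoefE (rep c) y_s y_D).
rewrite sfun_dersE //; apply: (@eq_pders _ _ O) => // y Oy.
by rewrite mxE.
Qed.

(** [system_adjoint] with [th] and [th'] the coordinates of [swd] in the two systems. The law of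
    [Zd] is the relation it requires, and its conclusion has the form of the law of [Wd]; one [G] is
    returned for both so that they can be matched. *)
Lemma eta_change (swd : forall x, fc_fib Zd (s x)) z :
  smooth_on O (wrep c swd) -> smooth_on O' (wrep c0 swd) ->
  U z -> csdom c (s z) -> csdom c0 (s z) ->
  exists2 G : 'M[R]_w,
    (forall b : fc_fib Wd (s z), fc_map c b = cjac (cs_x c) (cs_x c0) z *: (fc_map c0 b *m G^T)) &
    \row_r op_fun m (eta m (u c)) r (section_jet (yrep c s) (wrep c swd) (cmap (cs_x c) z)) =
    cjac (cs_x c) (cs_x c0) z *: ((\row_r op_fun m (eta m (u c0)) r
      (section_jet (yrep c0 s) (wrep c0 swd) (cmap (cs_x c0) z))) *m G^T).
Proof.
move=> sc sc0 Uz cz c0z.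
have [GW [sGW HW HWd]] := dp_trans WP c c0 gs.
have [GZ [sGZ HZ HZd]] := dp_trans ZP c c0 gs.
have [k rep] := op_rep.
set x := cmap (cs_x c) z.
have Ox : os_set O x by exists z.
have xE : cmap (cs_x c0) z = psi x by rewrite /psi (xtransE _ gs Uz cz).
exists (GW x) => [b|]; first exact: HWd.
have scr a : smooth_on O (fun x => wrep c swd x 0 a : R^o).
  by have /(smooth_mxP _ (os_open O)) := sc; exact.
have sc0r a : smooth_on O' (fun x => wrep c0 swd x 0 a : R^o).
  by have /(smooth_mxP _ (os_open O')) := sc0; exact.
have sGZr a b : smooth_on O (fun x => GZ x a b : R^o).
  by have /(smooth_mxP _ (os_open O)) := sGZ; exact.
have sGWr a b : smooth_on O (fun x => GW x a b : R^o).
  by have /(smooth_mxP _ (os_open O)) := sGW; exact.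
have detE z' : U z' -> csdom c (s z') -> csdom c0 (s z') ->
    \det (\matrix_(i, j) sfun_cderiv O i (pb_coord O psi j)) (cmap (cs_x c) z') =
    cjac (cs_x c) (cs_x c0) z'.
  by move=> Uz' cz' c0z'; rewrite (pb_det psi_s) //; exists z'.
pose th a : sfun O := tosfun O (fun x => wrep c swd x 0 a).
pose th' a : sfun O := tosfun O ((fun x => wrep c0 swd x 0 a : R^o) \o psi).
have th_th' a : th a = \sum_a' tosfun O (fun x => GZ x a a') *
    (\det (\matrix_(i, j) sfun_cderiv O i (pb_coord O psi j)) * th' a').
  apply: sfun_eq => _ [z' [Uz' [cz' c0z']] <-].
  have Oz' : os_set O (cmap (cs_x c) z') by exists z'.
  rewrite tosfunE // wrep_c // (HZd z' Uz' cz' c0z') sfun_sumE // mxE mxE mulr_sumr.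
  apply: eq_bigr => a' _; rewrite sfunME // sfunME // detE // !tosfunE //; last first.
    exact: (pullback_smooth psi_s psi_O).
  by rewrite /comp /psi (xtransE _ gs Uz' cz') wrep_c0 // mxE; ring.
have := system_adjoint (d := sfun_cderiv O) (NM := pb_mxK psi_s psi'_s psi_O psiK psi'K)
  (P := P) (P' := P') (@sfun_separated R n O) (op_change sGW sGZ HW HZ) th_th'.
move=> SA; apply/rowP => r; rewrite !mxE.
have := congr1 (fun f : sfun O => f x) (SA r).
have -> : (fun f : sfun O => f x) (\sum_(k0 < m.+1) (-1) ^+ k0 * tsum k0 (fun S =>
    ders (sfun_cderiv O) S (\sum_a P S a r * th a))) =
    op_fun m (eta m (u c)) r (section_jet (yrep c s) (wrep c swd) x).
  by rewrite (op_fun_eta_section (@u_sym c) (rep c) yrep_s sc yrep_D).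
move=> ->; rewrite sfun_sumE // mulr_sumr; apply: eq_bigr => r' _.
rewrite sfunME // sfunME // tosfunE // detE // !mxE xE.
rewrite (op_fun_eta_section (@u_sym c0) (rep c0) yrep_s' sc0 yrep_D' r' (psi_O Ox)).
rewrite mulrCA; congr (_ * _); rewrite mulrC; congr (_ * _).
have Opx := psi_O Ox.
rewrite /sadj sfun_sumE // [RHS]sfun_sumE //; apply: eq_bigr => i _.
rewrite sfun_sign1E // [RHS]sfun_sign1E //; congr (_ * _).
rewrite sfun_tsumE // [RHS]sfun_tsumE //; apply: eq_tsum => S sS.
have sSm : (size S <= m)%N by rewrite sS -ltnS.
(* What is differentiated in the adjoint in [c0], as a function of the coordinates of [c0]; frame
   derivatives of its pullback are its partial derivatives. *)
pose K y : R^o := \sum_a u c0 S a r' (jprol (fun i x => yrep c0 s x 0 i : R^o) y) * wrep c0 swd y 0 a.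
have su a : smooth_on O' (u c0 S a r' \o jprol (fun i x => yrep c0 s x 0 i : R^o) : _ -> R^o).
  exact: (u_smooth (rep c0) y0_s y0_D).
have sK : smooth_on O' K.
  by apply: (smooth_sum _ (os_open O')) => a; exact: (smoothM (os_open O') (su a) (sc0r a)).
have -> : \sum_a' P' S a' r' * th' a' = tosfun O (K \o psi).
  apply: sfun_eq => y Oy; rewrite sfun_sumE // tosfunE //; last exact: (pullback_smooth psi_s psi_O).
  apply: eq_bigr => a _; rewrite sfunME // !tosfunE //; exact: (pullback_smooth psi_s psi_O).
rewrite ders_pullback // [RHS]sfun_dersE //; apply: (@eq_pders _ _ O') => // y Oy.
rewrite sfun_sumE //; apply: eq_bigr => a _; rewrite sfunME // tosfunE //.
by rewrite (scoefE (rep c0) y0_s y0_D).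
Qed.
End TwoCharts.

(** The fiber element is built from its coordinates in one system [c0] at [s x0]; by [eta_change] it
    has the right coordinates in all others. *)
Lemma eta_linear_diff_op : linear_diff_op m Zd Wd (fun c => eta m (u c)).
Proof.
have [k rep] := op_rep; split.
- by move=> c L L' r a z sL LL' jz; exact: (eta_sym (@u_sym c) (rep c)).
- exists (m + k)%N => c L r a sL; apply/(jet_smoothP (m + k) (csO c)).
  exact: (eta_rep (rep c)).
move=> s swd x0 /local_section_good[U [gs Ux0 sw_s]].
(* If no coordinate system contains [s x0] there is no condition, and any element serves. *)
have [[c0 c0x]|nc] := pselect (exists c, csdom c (s x0)); last first.
  have [zeta] := dp_inhd WP (s x0); exists zeta => c cx.
  by case: nc; exists c.
have [zeta zetaE] := dp_surjd WP c0x (\row_r op_fun m (eta m (u c0)) r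
  (section_jet (yrep c0 s) (wrep c0 swd) (cmap (cs_x c0) x0))).
exists zeta => c cx.
have sub c1 c2 : smooth_on (sdom c1 s U (csdom c2)) (wrep c1 swd).
  by apply: smooth_on_sub (sw_s c1) => _ [z [Uz [c1z c2z]] <-]; exists z.
have [G -> ->] := eta_change (gs := gs) (sub c c0) (sub c0 c) Ux0 cx c0x.
by rewrite zetaE.
Qed.

Lemma eta_adjoint c (r : 'I_w) z : jet_over (csimg c) (yjet z) ->
  adj_fun m (u c) r z = op_fun m (eta m (u c)) r z.
Proof. by have [k rep] := op_rep; exact: (adj_fun_eta (@u_sym c) (rep c)). Qed.

Lemma eta_eta c (L : seq 'I_n) (a : 'I_v) (r : 'I_w) z : (size L <= m)%N ->
  jet_over (csimg c) z -> eta m (eta m (u c)) L a r z = u c L a r z.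
Proof. by have [k rep] := op_rep; exact: (etaK (@u_sym c) (rep c)). Qed.
End Invariance.

Theorem theorem8p1 (R : realType) (n p e q m : nat) (B : fiber_bundle R n p)
    (E : vbundle (fb_tot B) e) (Q : vbundle (fb_tot B) q) :
  (forall ups : csys E Q -> lcoef R n p e q,
     linear_diff_op m (fcE E Q) (fcQ E Q) ups ->
     [/\ linear_diff_op m (fcQd E Q) (fcEd E Q) (fun c => eta m (ups c)),
         forall c (r : 'I_e) (z : jet R n ('I_p + 'I_q)%type),
           jet_over (csimg c) (yjet z) ->
           adj_fun m (ups c) r z = op_fun m (eta m (ups c)) r z
       & forall c (L : seq 'I_n) (a : 'I_q) (r : 'I_e) (z : jet R n 'I_p),
           (size L <= m)%N -> jet_over (csimg c) z ->
           eta m (eta m (ups c)) L a r z = ups c L a r z])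
  /\
  (forall Del : csys E Q -> lcoef R n p q e,
     linear_diff_op m (fcQd E Q) (fcEd E Q) Del ->
     [/\ linear_diff_op m (fcE E Q) (fcQ E Q) (fun c => eta m (Del c)),
         forall c (a : 'I_q) (z : jet R n ('I_p + 'I_e)%type),
           jet_over (csimg c) (yjet z) ->
           adj_fun m (Del c) a z = op_fun m (eta m (Del c)) a z
       & forall c (L : seq 'I_n) (r : 'I_e) (a : 'I_q) (z : jet R n 'I_p),
           (size L <= m)%N -> jet_over (csimg c) z ->
           eta m (eta m (Del c)) L r a z = Del c L r a z]).
Proof.
split=> [ups|Del] op.
  split=> [|c r z|c L a r z].
  - exact: (eta_linear_diff_op (dual_pair_E E Q) (dual_pair_Q E Q) op).
  - exact: (eta_adjoint op).
  - exact: (eta_eta op).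
split=> [|c a z|c L r a z].
- exact: (eta_linear_diff_op (dual_pair_Qd E Q) (dual_pair_Ed E Q) op).
- exact: (eta_adjoint op).
- exact: (eta_eta op).
Qed.
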